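(* Consider the disordered monomer-dimer model on a finite graph $G$ with maximum degree $D$ and with $E(G)\neq\emptyset$. Assume that the vertex weights and the edge weights have finite fourth moments and that the edge weight distribution is non-degenerate (not a point mass). Let $F=\log Z_G$. Then there exist constants $c,C>0$, depending only on $D$ and the distributions of the weights (and not otherwise on $G$), such that for all $R\ge 1$, $$\sup_{s\in\mathbb{R}}\left|\mathbf{P}\left(\frac{F-\mathbf{E}F}{\sqrt{\mathrm{Var}(F)}}\le s\right)-\Phi(s)\right|\le C\left(\frac{|V(G)|^{1/4}}{|E(G)|^{1/2}}\Psi_G(3R)^{1/4}+\frac{|V(G)|^{1/2}}{|E(G)|^{1/2}}e^{-cR}+\frac{|V(G)|^{1/2}}{|E(G)|^{3/4}}\right).$$ Assume further that for some positive constants $K_1$ and $K_2$ the weight distributions satisfy (i) $\max(\mathbf{E}|w_e|^2,\mathbf{E}|\nu_x|^2)\le K_1$, and (ii) $\mathbf{E}|w_e-w_e'|\ge K_2$, where $w_e'$ is an i.i.d. copy of $w_e$. Then the constant $C$ can be taken to be $C=C_1(1+\mathbf{E}|w_e|^4+\mathbf{E}|\nu_x|^4)^{3/8}$, that is, for all $R\ge 1$, $$\sup_{s\in\mathbb{R}}\left|\mathbf{P}\left(\frac{F-\mathbf{E}F}{\sqrt{\mathrm{Var}(F)}}\le s\right)-\Phi(s)\right|\le C_1(1+\mathbf{E}|w_e|^4+\mathbf{E}|\nu_x|^4)^{3/8}\left(\frac{|V(G)|^{1/4}}{|E(G)|^{1/2}}\Psi_G(3R)^{1/4}+\frac{|V(G)|^{1/2}}{|E(G)|^{1/2}}e^{-cR}+\frac{|V(G)|^{1/2}}{|E(G)|^{3/4}}\right),$$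 where the constants $c>0$ and $C_1>0$ can be chosen depending only on $D$, $K_1$ and $K_2$.
   Context: Let $G=(V(G),E(G))$ be a finite graph. A (partial) matching of $G$ is a set of edges of $G$ no two of which share a vertex; $\mathcal{M}_G$ is the set of all matchings of $G$ (including the empty one). For $x\in V(G)$ and $M\in\mathcal{M}_G$, $x\notin M$ means that $x$ is not an endpoint of any edge of $M$ (it is unmatched). The edges carry i.i.d. real weights $(w_e)_{e\in E(G)}$ and the vertices carry i.i.d. real weights $(\nu_x)_{x\in V(G)}$; the edge weights are independent of the vertex weights, and the two distributions may differ. The disordered monomer-dimer model on $G$ (with inverse temperature normalized to $1$, absorbed in the weights) is the random Gibbs measure $\mu_G(M)=Z_G^{-1}\exp(\sum_{e\in M}w_e+\sum_{x\notin M}\nu_x)$, $M\in\mathcal{M}_G$, with partition function $Z_G=\sum_{M\in\mathcal{M}_G}\exp(\sum_{e\in M}w_e+\sum_{x\notin M}\nu_x)$. The free energy is $F=\log Z_G$. $\mathbf{P},\mathbf{E},\mathrm{Var}$ refer to the randomness of the weights. For $x\in V(G)$, $\mathbb{B}^x_R$ is the subgraph of $G$ induced by all vertices at graph distance at most $R$ from $x$, and the volume growth function is $\Psi_G(R)=\max_{x\in V(G)}|V(\mathbb{B}^x_R)|$. $\Phi$ is the cumulative distribution function of the standard Gaussian distribution. In expressions such as $\mathbf{E}|w_e|^2$, $w_e$ (resp. $\nu_x$) denotes a generic edge (resp. vertex) weight. *)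

(* Defs.v *)
From HB Require Import structures.
From mathcomp Require Import all_boot all_order all_algebra.
From mathcomp Require Import all_classical all_reals all_analysis.

Set Implicit Arguments.
Unset Strict Implicit.
Unset Printing Implicit Defensive.

Import Order.TTheory GRing.Theory Num.Theory.
Import numFieldNormedType.Exports.

Local Open Scope classical_set_scope.
Local Open Scope ring_scope.

Record sgraph := SGraph {
  vertex :> finType;
  adj : rel vertex;
  adj_sym : symmetric adj;
  adj_irr : irreflexive adj
}.

Section Graph.
Variable G : sgraph.

Definition edge_set : {set {set G}} :=
  [set [set p.1; p.2] | p : G * G & adj p.1 p.2]%SET.

Definition edge : finType := {e : {set G} | e \in edge_set}.

Definition max_degree : nat := \max_(x : G) #|[set y | adj x y]%SET|.

Definition is_matching (M : {set edge}) : bool :=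
  [forall e in M, forall f in M,
    (e != f) ==> [disjoint (\val e : {set G}) & (\val f : {set G})]].

Definition unmatched (M : {set edge}) (x : G) : bool :=
  [forall e in M, x \notin (\val e : {set G})].

(* The infimum of the lengths of the walks from x to y; it is +oo when y is
   not reachable from x. *)
Definition gdist (R : realType) (x y : G) : \bar R :=
  ereal_inf [set ((size p)%:R)%:E | p in
    [set p : seq G | path (@adj G) x p /\ last x p = y]].

Definition ball_vertices (R : realType) (x : G) (r : R) : {set G} :=
  [set y | (gdist R x y <= r%:E)%E]%SET.

Definition volume_growth (R : realType) (r : R) : nat :=
  \max_(x : G) #|ball_vertices x r|.

Section Gibbs.
Variables (R : realType) (w : edge -> R) (nu : G -> R).

Definition gibbs_weight (M : {set edge}) : R :=
  expR (\sum_(e in M) w e + \sum_(x | unmatched M x) nu x).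

Definition partition_function : R :=
  \sum_(M : {set edge} | is_matching M) gibbs_weight M.

Definition free_energy : R := ln partition_function.

End Gibbs.

Definition clt_rate (R : realType) (c r : R) : R :=
  let V : R := #|G|%:R in
  let E : R := #|edge_set|%:R in
  V `^ (1 / 4) / E `^ (1 / 2) * (volume_growth (3 * r))%:R `^ (1 / 4)
  + V `^ (1 / 2) / E `^ (1 / 2) * expR (- (c * r))
  + V `^ (1 / 2) / E `^ (3 / 4).

End Graph.

Section Laws.
Context (R : realType).
Implicit Type mu : probability (measurableTypeR R) R.

Definition abs_moment mu (k : nat) : \bar R :=
  (\int[mu]_x (`|x| ^+ k)%:E)%E.

Definition point_mass mu : Prop :=
  exists a : R, forall A : set R, measurable A -> mu A = \d_a A.

(* E|X - X'| for independent X and X' with law mu. *)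
Definition mean_abs_diff mu : \bar R :=
  (\int[mu \x mu]_z `|z.1 - z.2|%:E)%E.

Definition fourth_moment_factor (mue muv : probability (measurableTypeR R) R)
    : R :=
  (1 + fine (abs_moment mue 4) + fine (abs_moment muv 4)) `^ (3 / 8).

End Laws.

Section Randomness.
Context (d : measure_display) (Omega : measurableType d) (R : realType).
Variable P : probability Omega R.

Definition has_law (X : {RV P >-> R}) (mu : probability (measurableTypeR R) R)
    : Prop :=
  forall A : set R, measurable A -> distribution P X A = mu A.

Definition mutually_independent (I : finType) (X : I -> {RV P >-> R}) : Prop :=
  forall (J : {set I}) (A : I -> set R), (forall i, measurable (A i)) ->
    P (\bigcap_(i in [set` J]) X i @^-1` A i) =
    (\prod_(i in J) P (X i @^-1` A i))%E.

Definition disordered_weights (G : sgraph)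
    (mue muv : probability (measurableTypeR R) R)
    (w : edge G -> {RV P >-> R}) (nu : G -> {RV P >-> R}) : Prop :=
  [/\ forall e, has_law (w e) mue,
      forall x, has_law (nu x) muv &
      mutually_independent (fun i : edge G + G =>
        match i with inl e => w e | inr x => nu x end)].

Definition random_free_energy (G : sgraph)
    (w : edge G -> {RV P >-> R}) (nu : G -> {RV P >-> R}) : Omega -> R :=
  fun t => free_energy (fun e => w e t) (fun x => nu x t).

Definition standardized (F : Omega -> R) : Omega -> R :=
  fun t => (F t - fine 'E_P[F]) / Num.sqrt (fine 'V_P[F]).

Definition gaussian_cdf (s : R) : \bar R := normal_prob (0 : R) 1 `]-oo, s].

Definition kolmogorov_to_gaussian (X : Omega -> R) : \bar R :=
  ereal_sup (range (fun s : R =>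
    `|P [set t | (X t <= s)%R] - gaussian_cdf s|%E)).

End Randomness.

(* Main.v *)
Require Import Defs.
From HB Require Import structures.
From mathcomp Require Import all_boot all_order all_algebra.
From mathcomp Require Import all_classical all_reals all_analysis.
From mathcomp Require Import measurable_realfun.
From mathcomp Require Import ring lra zify.
Set Implicit Arguments.
Unset Strict Implicit.
Unset Printing Implicit Defensive.
Import Order.TTheory GRing.Theory Num.Theory.
Import numFieldNormedType.Exports.
Local Open Scope classical_set_scope.
Local Open Scope ring_scope.

(** Why the theorem holds.

    The free energy F = ln Z is a function of independent weights, one for each
    vertex and one for each edge, and it is 1-Lipschitz in each of them.  Normal
    approximation comes from Stein's method for such functions.  Let b be an
    independent copy of the weights a.  Replacing the weights by those of b, one
    at a time and in a fixed order, telescopes F(a) - F(b), and the symmetry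
    between a and b turns this into an exact formula for covariances with F
    ([covariance_dif]).  It involves the products T_i of two increments of F at
    the i-th coordinate: with T = (1/2) sum_i T_i one has E T = Var F, and a
    solution of Stein's equation for a ramp function h of width e gives
    ([normal_approximation]), for W = (F - E F) / sd(F) and N standard Gaussian,
      |E h(W) - E h(N)| <= 2 sd(T) / Var F + 7 / e * S / (Var F)^(3/2),
    where S is a sum of third absolute moments of increments, hence of order |V|.
    Two facts about the model are needed: Var F is at least of order |E|, and T
    has a small variance.

    Lower bound on the variance ([variance_lower]).  The conditional expectations
    of F - E F given the single edge weights are orthogonal, so Var F is at least
    the sum of their variances.  The derivative of F in an edge weight is the
    Gibbs probability that the edge belongs to the matching; it is bounded below
    as soon as its own weight and the boundedly many weights around it are at most
    l in absolute value, and the latter has probability at least 1/2 by Chebyshev's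
    inequality.

    Decay of correlations ([zratio_decay], [Ex_path_sum]).  The partition
    functions Z_U of the induced subgraphs satisfy a recursion along which the
    ratios Z_U / Z_(U minus x) are compared in the distance |a - b| / (a + b).
    One step never increases this distance, and contracts it by a fixed factor at
    a vertex around which all weights are at most l.  Paying 1 / eps for each
    weight larger than l, one bounds the m-th power of the distance after k steps
    by a sum over self-avoiding paths of length k; when large weights are rare
    its expectation is at most of order 2^(-k).  So an increment of F at i changes,
    in mean square, by an amount exponentially small in k when all weights at
    distance more than k + 1 are frozen ([product_freeze]).

    Therefore T_i and T_j are nearly independent when their windows are disjoint
    ([cov_far]), and the number of other pairs is at most of order |V| times the
    volume growth ([carre_du_champ_var_le]).  This is the bound for ramp functions
    when the weights take finitely many values ([discrete_clt]).  General laws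
    follow by rounding the weights to a finite grid towards 0, which does not
    increase absolute moments, and by dominated convergence ([smooth_clt]).

    Finally two ramps of width e enclose an indicator function, so that a bound
    A / e for ramps makes the Kolmogorov distance at most e + A / e, that is
    2 sqrt A for e = sqrt A ([kolmogorov_le_sqrt]).  The exponents of the theorem
    are those of the square root of the bound A = C (1 + m4)^(3/4) ... for ramps.
    The constants of [kolmogorov_clt] only depend on D, on a bound on the second
    moments and on a lower bound on E|w - w'|; the latter is positive for every
    non-degenerate law ([mean_abs_diff_gt0]), which gives the first assertion. *)

(** * Stein's equation *)

Section SteinEquation.
Context {R : realType}.

Lemma mean_value (f df : R -> R) (a b : R) : a <= b ->
  (forall x : R, is_derive x 1 f (df x)) ->
  exists2 c, a <= c <= b & f b - f a = df c * (b - a).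
Proof.
move=> ab fdf; have [|c] := @MVT_segment R f df a b ab.
- by apply: derivable_within_continuous => x _; case: (fdf x).
- by rewrite in_itv /= => cab cE; exists c.
Qed.

Lemma derive_le_lipschitz (f df : R -> R) (L : R) :
  (forall x : R, is_derive x 1 f (df x)) -> (forall x, `|df x| <= L) ->
  forall x y, `|f x - f y| <= L * `|x - y|.
Proof.
move=> fdf dfL x y; wlog xy : x y / y <= x.
  move=> W; case: (leP y x) => [/W//|/ltW /W]; by rewrite distrC (distrC y).
have [c _ ->] := mean_value xy fdf.
by rewrite normrM ler_wpM2r.
Qed.

Let eneg (x : R) := expR (- (x ^+ 2 / 2)).

Let bounded_stein_le_pos (u k : R -> R) (K M : R) :
  (forall x : R, is_derive x 1 u (x * u x + k x)) ->
  (forall x, `|k x| <= K) -> (forall x, `|u x| <= M) ->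
  forall x, 0 < x -> x * u x <= K.
Proof.
move=> udu kK uM x0 x0_gt0; rewrite leNgt; apply/negP => Kx.
pose w x := (u x - K / x0) * eneg x.
pose dw x := (k x + x * (K / x0)) * eneg x.
have wdw (x : R) : is_derive x 1 w (dw x).
  rewrite /w; apply: is_derive_eq.
  by rewrite /dw /eneg /GRing.scale /= ?mulr0; field; rewrite ?gt_eqF.
have K0 : 0 <= K by exact: le_trans (kK 0).
have M0 : 0 <= M by exact: le_trans (uM 0).
pose eta := u x0 - K / x0.
have eta0 : 0 < eta by rewrite /eta subr_gt0 ltr_pdivrMr // mulrC.
pose t := (M + 1) / (eta * x0).
have t0 : 0 <= t by rewrite /t divr_ge0 ?addr_ge0 // mulr_ge0 ?ltW.
have [c /andP[xc _] wE] := @mean_value w dw x0 (x0 + t) ltac:(by rewrite lerDl) wdw.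
have : 0 <= w (x0 + t) - w x0.
  rewrite wE mulr_ge0 ?(addrC x0) ?addrK //.
  rewrite /dw mulr_ge0 ?expR_ge0 //.
  have : K <= c * (K / x0) by rewrite mulrCA ler_peMr // ler_pdivlMr // mul1r.
  by move: (kK c); rewrite ler_norml => /andP[+ _]; lra.
rewrite subr_ge0 /w -/eta -ler_pdivrMr ?expR_gt0 //.
rewrite -mulrA /eneg -expRN -expRD opprK => h1.
have h2 : 1 + ((x0 + t) ^+ 2 / 2 - x0 ^+ 2 / 2) <= expR (- (x0 ^+ 2 / 2) + (x0 + t) ^+ 2 / 2).
  by rewrite addrC (addrC (- _)) addrC; exact: expR_ge1Dx.
have h3 : eta * (1 + ((x0 + t) ^+ 2 / 2 - x0 ^+ 2 / 2)) <= u (x0 + t) - K / x0.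
  by apply: le_trans h1; rewrite ler_pM2l.
have h4 : eta * (x0 * t) = M + 1.
  by rewrite /t; field; rewrite !gt_eqF.
have h5 := uM (x0 + t); have h6 : 0 <= K / x0 by rewrite divr_ge0 // ltW.
move: h5; rewrite ler_norml => /andP[_ h5].
have h7 : 0 <= eta * t ^+ 2 by rewrite mulr_ge0 ?sqr_ge0 // ltW.
move: h3; rewrite (_ : eta * _ = eta + eta * (x0 * t) + eta * t ^+ 2 / 2); last by field.
by rewrite h4; lra.
Qed.

Lemma is_derive_comp_opp (u du : R -> R) :
  (forall x : R, is_derive x 1 u (du x)) ->
  forall x : R, is_derive x 1 (fun x => u (- x)) (- du (- x)).
Proof.
move=> udu x.
have H : is_derive (- x) 1 u (du (- x)) by exact: udu.
have := @is_derive1_comp R u -%R x (du (- x)) (- 1) H (is_deriveNid x 1).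
by rewrite mulrN1.
Qed.

(** If u' = x u + k with k and u bounded, then x u cannot exceed sup |k| at a
    point x0 > 0: otherwise (u - K / x0) exp (- x^2 / 2) would be nondecreasing to
    the right of x0, and u would grow at least quadratically.  The conclusion is uniform in
    M, as the application to difference quotients requires. *)
Lemma bounded_stein_le (u k : R -> R) (K M : R) :
  (forall x : R, is_derive x 1 u (x * u x + k x)) ->
  (forall x, `|k x| <= K) -> (forall x, `|u x| <= M) ->
  forall x, `|x * u x + k x| <= 2 * K.
Proof.
move=> udu kK uM x.
have K0 : 0 <= K by exact: le_trans (kK 0).
suff xK : `|x * u x| <= K.
  by have := ler_normD (x * u x) (k x); have := kK x; lra.
have pos (v l : R -> R) : (forall x : R, is_derive x 1 v (x * v x + l x)) ->
    (forall x, `|l x| <= K) -> (forall x, `|v x| <= M) ->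
    forall y, 0 < y -> `|y * v y| <= K.
  move=> vdv lK vM y y0; rewrite ler_norml lerNl -mulrN; apply/andP; split.
    apply: (@bounded_stein_le_pos (fun x => - v x) (fun x => - l x) K M) => // z.
    + by have := is_deriveN (vdv z); rewrite opprD mulrN.
    + by rewrite normrN.
    + by rewrite normrN.
  exact: (@bounded_stein_le_pos v l K M).
have [x0|x0|->] := ltgtP x 0; last by rewrite mul0r normr0.
- have := pos (fun x => u (- x)) (fun x => - k (- x)) _ _ _ (- x).
  rewrite opprK mulNr normrN; apply => //; last by rewrite oppr_gt0.
  + move=> y; have := is_derive_comp_opp udu y.
    by rewrite opprD mulNr opprK.
  + by move=> y; rewrite normrN.
- exact: pos udu kK uM _ x0.
Qed.
End SteinEquation.

Section SteinSolution.
Context {R : realType}.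
Local Notation leb := (@lebesgue_measure R).
Let pdf : R -> R := normal_pdf 0 1.

Let one_neq0 : (1 : R) != 0. Proof. exact: oner_neq0. Qed.

Let pdfE x : pdf x = normal_peak 1 * expR (- (x ^+ 2 / 2)).
Proof.
by rewrite /pdf normal_pdfE // /normal_fun subr0 expr1n mulNr.
Qed.

Let pdf_gt0 x : 0 < pdf x.
Proof. by rewrite pdfE mulr_gt0 ?expR_gt0 ?normal_peak_gt0. Qed.

Let pdf_ge0 x : 0 <= pdf x. Proof. exact: ltW. Qed.

Let is_derive_pdf (x : R) : is_derive x 1 pdf (- x * pdf x).
Proof.
have -> : pdf = (fun x => normal_peak 1 * expR (- (x ^+ 2 / 2))).
  by apply/funext => y; exact: pdfE.
apply: is_derive_eq.
by rewrite /GRing.scale /= !mulr0; field.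
Qed.

Let ipdf (x : R) := (normal_peak 1)^-1 * expR (x ^+ 2 / 2).

Let ipdfK x : pdf x * ipdf x = 1.
Proof.
rewrite pdfE /ipdf expRN.
have := expR_gt0 (x ^+ 2 / 2); have := @normal_peak_gt0 R 1 one_neq0.
by move=> h1 h2; field; rewrite !gt_eqF.
Qed.

Let is_derive_ipdf (x : R) : is_derive x 1 ipdf (x * ipdf x).
Proof.
rewrite /ipdf; apply: is_derive_eq.
by rewrite /GRing.scale /= !mulr0; field; rewrite gt_eqF ?normal_peak_gt0.
Qed.

Let integrable_pdf (A : set (measurableTypeR R)) : measurable A -> leb.-integrable A (EFin \o pdf).
Proof.
move=> mA; apply: (@integrableS _ _ _ leb setT) => //.
exact: integrable_normal_pdf.
Qed.

Let Rint_pdf : \int[leb]_x pdf x = 1.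
Proof. by rewrite /Rintegral integral_normal_pdf. Qed.

Let cdfR (x : R) : R := \int[leb]_(t in `]-oo, x]) pdf t.

Let cdfRE x : (cdfR x)%:E = gaussian_cdf x.
Proof.
rewrite /gaussian_cdf /normal_prob /cdfR /Rintegral fineK //.
by apply: integrable_fin_num => //; exact: integrable_pdf.
Qed.

Let idTR : measurableTypeR R -> R := idfun.
#[local] HB.instance Definition _ :=
  @isMeasurableFun.Build _ _ _ _ idTR (@measurable_id _ _ setT).

Let cdf_idE x : cdf (idTR : {RV (normal_prob (0:R) 1) >-> R}) x = (cdfR x)%:E.
Proof. by rewrite cdfRE. Qed.

#[local] Existing Instance is_derive_pdf.
#[local] Existing Instance is_derive_ipdf.

Let cvg_cdfR_pinfty : cdfR x @[x --> +oo] --> (1 : R).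
Proof.
have := cvg_cdfy1 (idTR : {RV (normal_prob (0:R) 1) >-> R}).
move/fine_cvg; apply: cvg_trans; apply: near_eq_cvg; near=> x.
by have := congr1 fine (cdf_idE x).
Unshelve. all: by end_near. Qed.

Let cvg_cdfR_ninfty : cdfR x @[x --> -oo] --> (0 : R).
Proof.
have := cvg_cdfNy0 (idTR : {RV (normal_prob (0:R) 1) >-> R}).
move/fine_cvg; apply: cvg_trans; apply: near_eq_cvg; near=> x.
by have := congr1 fine (cdf_idE x).
Unshelve. all: by end_near. Qed.

Let tail_pinfty e x0 : 0 < e -> exists2 x, x0 <= x & 1 - cdfR x < e.
Proof.
move=> e0; move/cvgrPdist_lt: cvg_cdfR_pinfty => /(_ e e0)[M [Mr H]].
exists (Num.max x0 (M + 1)); first by rewrite le_max lexx.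
apply: le_lt_trans (H (Num.max x0 (M + 1)) _); last by rewrite lt_max ltrDl ltr01 orbT.
exact: ler_norm.
Qed.

Let tail_ninfty e x0 : 0 < e -> exists2 x, x <= x0 & cdfR x < e.
Proof.
move=> e0; move/cvgrPdist_lt: cvg_cdfR_ninfty => /(_ e e0)[M [Mr H]].
exists (Num.min x0 (M - 1)); first by rewrite ge_min lexx.
have := H (Num.min x0 (M - 1)) _; rewrite sub0r normrN => H'.
apply: le_lt_trans (H' _); last by rewrite gt_min ltrBlDr ltrDl ltr01 orbT.
exact: ler_norm.
Qed.

Let is_derive_integral (f : R -> R) : continuous f ->
  leb.-integrable setT (EFin \o f) ->
  forall x : R, is_derive x 1 (fun x => \int[leb]_(t in `]-oo, x]) f t) (f x).
Proof.
move=> fc fi x; have [] := @continuous_FTC1 R f -oo%O x (x + 1) _ _ _ (@fc x).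
- by rewrite ltrDl.
- exact: integrableS fi.
- by rewrite ltNyr.
move=> dH HE; apply: DeriveDef; first exact: dH.
by rewrite -derive1E; exact: HE.
Qed.

Let Rint_split (f : R -> R) (x : R) : leb.-integrable setT (EFin \o f) ->
  \int[leb]_t f t
  = \int[leb]_(t in `]-oo, x]) f t + \int[leb]_(t in `]x, +oo[) f t.
Proof.
move=> fi; have := @Rintegral_itvB R f -oo%O +oo%O x.
rewrite set_itvNyy => /(_ fi) <- //.
by rewrite addrC subrK.
Qed.

Let pdf_le1 x : pdf x <= 1.
Proof.
apply: (le_trans (normal_pdf_ub _ _ one_neq0)).
have pi2 : 1 <= (pi : R) *+ 2 by have := pi_ge2 R; rewrite mulr2n; lra.
rewrite /normal_peak expr1n mul1r invf_le1 ?sqrtr_gt0 ?(lt_le_trans ltr01) //.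
by rewrite -[leLHS]sqrtr1 ler_sqrt // (le_trans ler01).
Qed.

Lemma gaussian_cdf_lipschitz (s e : R) : 0 <= e ->
  fine (gaussian_cdf (s + e)) <= fine (gaussian_cdf s) + e.
Proof.
move=> e0; rewrite -!cdfRE /= -lerBlDl.
have d (x : R) : is_derive x 1 cdfR (pdf x).
  by apply: is_derive_integral; [exact: continuous_normal_pdf|exact: integrable_pdf].
have d1 x : `|pdf x| <= 1 by rewrite ger0_norm ?pdf_le1 ?pdf_ge0.
have := derive_le_lipschitz d d1 (s + e) s.
by rewrite (addrC s) addrK mul1r (ger0_norm e0); apply: le_trans; exact: ler_norm.
Qed.

Definition gauss_mean (h : R -> R) : R := \int[leb]_x (h x * pdf x).

Let integrable_hpdf (h : R -> R) (A : set (measurableTypeR R)) : continuous h ->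
  (forall x, `|h x| <= 1) -> measurable A ->
  leb.-integrable A (EFin \o (fun x => h x * pdf x)).
Proof.
move=> hc h1 mA; apply: (@integrableS _ _ _ leb setT) => //.
apply: (le_integrable measurableT _ _ (integrable_pdf measurableT)).
- apply/measurable_EFinP/measurable_funM; last exact: measurable_normal_pdf.
  exact: continuous_measurable_fun.
- move=> x _; rewrite /= lee_fin normrM (ger0_norm (pdf_ge0 x)).
  by rewrite ler_piMl.
Qed.

Lemma gauss_mean_bounds (h : R -> R) : continuous h ->
  (forall x, 0 <= h x <= 1) -> 0 <= gauss_mean h <= 1.
Proof.
move=> hc h01; apply/andP; split.
  by apply: Rintegral_ge0 => x _; rewrite mulr_ge0 //; case/andP: (h01 x).
rewrite -Rint_pdf; apply: le_Rintegral => //.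
- apply: integrable_hpdf => // x; case/andP: (h01 x) => h0 h1.
  by rewrite ger0_norm.
- exact: integrable_pdf.
- by move=> x _; rewrite ler_piMl //; case/andP: (h01 x).
Qed.

Lemma gauss_mean_le_cdf (h : R -> R) (t : R) : continuous h ->
  (forall x, 0 <= h x <= 1) -> (forall x, t <= x -> h x = 0) ->
  gauss_mean h <= fine (gaussian_cdf t).
Proof.
move=> hc h01 ht; rewrite -cdfRE /=.
have hi A : measurable A -> leb.-integrable A (EFin \o (fun x => h x * pdf x)).
  apply: integrable_hpdf => // x; case/andP: (h01 x) => h0 h1.
  by rewrite ger0_norm.
rewrite /gauss_mean (Rint_split t (hi _ measurableT)).
rewrite [X in _ + X](_ : _ = 0) ?addr0; last first.
  rewrite (@eq_Rintegral _ _ _ leb _ (fun=> 0)) ?Rintegral_cst ?mul0r // => x.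
  by rewrite inE /= in_itv /= andbT => /ltW/ht ->; rewrite mul0r.
apply: le_Rintegral => //; first exact: hi.
- exact: integrable_pdf.
- by move=> x _; rewrite ler_piMl //; case/andP: (h01 x).
Qed.

Lemma cdf_le_gauss_mean (h : R -> R) (s : R) : continuous h ->
  (forall x, 0 <= h x <= 1) -> (forall x, x <= s -> h x = 1) ->
  fine (gaussian_cdf s) <= gauss_mean h.
Proof.
move=> hc h01 hs; rewrite -cdfRE /=.
have hi A : measurable A -> leb.-integrable A (EFin \o (fun x => h x * pdf x)).
  apply: integrable_hpdf => // x; case/andP: (h01 x) => h0 h1.
  by rewrite ger0_norm.
rewrite /gauss_mean (Rint_split s (hi _ measurableT)).
rewrite [leLHS](_ : _ = \int[leb]_(t in `]-oo, s]) (h t * pdf t)).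
  rewrite lerDl; apply: Rintegral_ge0 => x _.
  by rewrite mulr_ge0 //; case/andP: (h01 x).
apply: eq_Rintegral => x; rewrite inE /= in_itv /= => /hs ->.
by rewrite mul1r.
Qed.

Section Solution.
Variable h : R -> R.
Hypothesis hc : continuous h.
Hypothesis h01 : forall x, 0 <= h x <= 1.
Let c := gauss_mean h.
Let q (x : R) := (h x - c) * pdf x.
Let H (x : R) := \int[leb]_(t in `]-oo, x]) q t.

Let hc_le1 x : `|h x - c| <= 1.
Proof.
have /andP[c0 c1] := gauss_mean_bounds hc h01; have /andP[h0 h1] := h01 x.
by rewrite ler_norml /c; lra.
Qed.

Let kc : continuous (fun x => h x - c).
Proof. by move=> x; apply: (@cvgB _ _ _ _ _ h (fun=> c)); [exact: hc|exact: cvg_cst]. Qed.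

Let integrable_q (A : set (measurableTypeR R)) : measurable A -> leb.-integrable A (EFin \o q).
Proof. exact: (integrable_hpdf kc hc_le1). Qed.

Let qc : continuous q.
Proof.
by move=> x; apply: (@cvgM _ _ _ _ (fun x => h x - c) pdf); [exact: kc|exact: continuous_normal_pdf].
Qed.

Let is_derive_H (x : R) : is_derive x 1 H (q x).
Proof. by apply: is_derive_integral => //; exact: integrable_q. Qed.

#[local] Existing Instance is_derive_H.

Let Rint_q : \int[leb]_x q x = 0.
Proof.
rewrite (_ : (fun x => q x) = (fun x => h x * pdf x - c * pdf x)); last first.
  by apply/funext => x; rewrite /q mulrBl.
rewrite RintegralB //; first 1 last.
- by apply: integrable_hpdf => // x; case/andP: (h01 x) => h0 h1; rewrite ger0_norm.
- apply: integrable_hpdf => //; first by move=> x; exact: cvg_cst.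
  move=> _; have /andP[c0 c1] := gauss_mean_bounds hc h01.
  by rewrite /c ger0_norm.
rewrite RintegralZl //; last exact: integrable_pdf.
by rewrite Rint_pdf mulr1 subrr.
Qed.

Let q_le x : `|q x| <= pdf x.
Proof. by rewrite normrM (ger0_norm (pdf_ge0 x)) ler_piMl. Qed.

Let int_q_le (A : set (measurableTypeR R)) : measurable A ->
  `|\int[leb]_(t in A) q t| <= \int[leb]_(t in A) pdf t.
Proof.
move=> mA; have h1 := le_normr_Rintegral mA (integrable_q mA).
apply: (le_trans h1).
apply: le_Rintegral => //; last exact: integrable_pdf.
exact: integrable_norm (integrable_q mA).
Qed.

Let H_le_cdf x : `|H x| <= cdfR x.
Proof. exact: int_q_le. Qed.

Let H_le_ccdf x : `|H x| <= 1 - cdfR x.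
Proof.
have -> : H x = - \int[leb]_(t in `]x, +oo[) q t.
  have := Rint_split x (integrable_q measurableT); rewrite Rint_q => /esym/eqP.
  by rewrite addr_eq0 => /eqP.
rewrite normrN (le_trans (int_q_le _)) // -Rint_pdf.
by rewrite (Rint_split x (integrable_pdf measurableT)) addrAC subrr add0r.
Qed.

Let H_le_pdf_right x : 1 <= x -> `|H x| <= pdf x.
Proof.
move=> x1.
suff key (sg : R) : `|sg| = 1 -> sg * H x <= pdf x.
  rewrite ler_norml lerNl -mulN1r key ?normrN1 //= -[leLHS]mul1r.
  by rewrite key ?normr1.
move=> sg1; rewrite leNgt; apply/negP => xH.
have [y xy yH] := @tail_pinfty (sg * H x - pdf x) x ltac:(by rewrite subr_gt0).
pose v t := sg * H t - pdf t.
have vdv (t : R) : is_derive t 1 v (sg * q t + t * pdf t).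
  by rewrite /v; apply: is_derive_eq; rewrite /GRing.scale /=; ring.
have [z /andP[xz _] vE] := mean_value xy vdv.
have : 0 <= v y - v x.
  rewrite vE mulr_ge0 ?subr_ge0 //.
  have qz : - pdf z <= sg * q z.
    by rewrite lerNl -mulrN (le_trans (ler_norm _)) // normrM sg1 mul1r normrN q_le.
  have : pdf z <= z * pdf z by rewrite ler_peMl // (le_trans x1).
  by lra.
have : sg * H y <= 1 - cdfR y.
  by rewrite (le_trans (ler_norm _)) // normrM sg1 mul1r H_le_ccdf.
by rewrite /v; have := pdf_gt0 y; lra.
Qed.

Let H_le_pdf_left x : x <= - 1 -> `|H x| <= pdf x.
Proof.
move=> x1.
suff key (sg : R) : `|sg| = 1 -> sg * H x <= pdf x.
  rewrite ler_norml lerNl -mulN1r key ?normrN1 //= -[leLHS]mul1r.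
  by rewrite key ?normr1.
move=> sg1; rewrite leNgt; apply/negP => xH.
have [y yx yH] := @tail_ninfty (sg * H x - pdf x) x ltac:(by rewrite subr_gt0).
pose v t := sg * H t - pdf t.
have vdv (t : R) : is_derive t 1 v (sg * q t + t * pdf t).
  by rewrite /v; apply: is_derive_eq; rewrite /GRing.scale /=; ring.
have [z /andP[_ zx] vE] := mean_value yx vdv.
have : v x - v y <= 0.
  rewrite vE mulr_le0_ge0 ?subr_ge0 //.
  have qz : sg * q z <= pdf z.
    by rewrite (le_trans (ler_norm _)) // normrM sg1 mul1r q_le.
  have : z * pdf z <= - 1 * pdf z by rewrite ler_wpM2r // (le_trans zx).
  by lra.
have : sg * H y <= cdfR y.
  by rewrite (le_trans (ler_norm _)) // normrM sg1 mul1r H_le_cdf.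
by rewrite /v; have := pdf_gt0 y; lra.
Qed.

Let pdf0_le x : `|x| <= 1 -> pdf 0 <= 2 * pdf x.
Proof.
move=> x1; rewrite !pdfE expr0n /= mul0r oppr0 expR0 mulr1 mulrCA ler_peMr //.
  exact: normal_peak_ge0.
have : 1 - x ^+ 2 / 2 <= expR (- (x ^+ 2 / 2)) by exact: expR_ge1Dx.
have : x ^+ 2 <= 1 by rewrite -[x ^+ 2]ger0_norm ?sqr_ge0 // normrX expr_le1.
by lra.
Qed.

Let pdf_le0 x : pdf x <= pdf 0.
Proof.
rewrite !pdfE expr0n /= mul0r oppr0 expR0 mulr1 ler_piMr ?normal_peak_ge0 //.
by rewrite -expR0 ler_expR oppr_le0 divr_ge0 // sqr_ge0.
Qed.

(** The solution is H / pdf, where H is the primitive of (h - E h) pdf vanishing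
    at - oo.  As H also vanishes at + oo, and H + pdf and H - pdf are monotone
    outside [-1, 1], |H| is at most pdf there; between - 1 and 1 the density varies
    by a bounded factor, whence a crude constant. *)
Lemma stein_solution : exists2 g : R -> R,
  forall x : R, is_derive x 1 g (x * g x + (h x - gauss_mean h)) &
  forall x, `|g x| <= 6.
Proof.
exists (fun x => H x * ipdf x) => x.
  apply: is_derive_eq.
  have := ipdfK x; rewrite /GRing.scale /= /q -/c => pK.
  transitivity (H x * (x * ipdf x) + (h x - c) * (pdf x * ipdf x)); first by ring.
  by rewrite pK; ring.
have ip : 0 < ipdf x by rewrite -(pmulr_rgt0 _ (pdf_gt0 x)) ipdfK.
suff : `|H x| <= 6 * pdf x.
  by rewrite normrM (gtr0_norm ip) -(ler_pM2r ip) -mulrA ipdfK mulr1.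
have [x1|x1] := leP 1 x.
  by rewrite (le_trans (H_le_pdf_right x1)) // ler_peMl //; lra.
have [x2|x2] := leP x (-1).
  by rewrite (le_trans (H_le_pdf_left x2)) // ler_peMl //; lra.
have q0 y : `|q y| <= pdf 0 by exact: le_trans (q_le y) (pdf_le0 y).
have := derive_le_lipschitz is_derive_H q0 x 1.
have := H_le_pdf_right (lexx 1).
have := pdf_le0 1.
have x3 : `|x| <= 1 by rewrite ler_norml; apply/andP; split; exact: ltW.
have := pdf0_le x3.
have x4 : pdf 0 * `|x - 1| <= pdf 0 * 2 by rewrite ler_wpM2l // ler_norml; lra.
have := ler_normD (H x - H 1) (H 1); rewrite subrK.
by lra.
Qed.

End Solution.
End SteinSolution.

Section Ramp.
Context {R : realType}.
Implicit Types s e x y : R.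

Definition ramp s e x : R := Num.max 0 (Num.min 1 (1 - (x - s) / e)).

Lemma ramp_bounds s e x : 0 <= ramp s e x <= 1.
Proof. by rewrite /ramp le_max lexx /= ge_max ler01 ge_min lexx. Qed.

Lemma ramp_eq1 s e x : 0 < e -> x <= s -> ramp s e x = 1.
Proof.
move=> e0 xs; have h : 0 <= (s - x) / e by rewrite divr_ge0 ?subr_ge0 // ltW.
have h1 : (1 : R) <= 1 - (x - s) / e by rewrite lerDl -mulNr opprB.
by rewrite /ramp (min_idPl h1); apply/max_idPr.
Qed.

Lemma ramp_eq0 s e x : 0 < e -> s + e <= x -> ramp s e x = 0.
Proof.
move=> e0 xs; have h1 : 1 - (x - s) / e <= 0.
  by rewrite subr_le0 ler_pdivlMr // mul1r lerBrDl.
rewrite /ramp; apply/max_idPl.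
by rewrite ge_min h1 orbT.
Qed.

Lemma ramp_lipschitz s e x y : 0 < e -> `|ramp s e x - ramp s e y| <= `|x - y| / e.
Proof.
move=> e0; rewrite /ramp.
have -> : `|x - y| / e = `|(1 - (x - s) / e) - (1 - (y - s) / e)|.
  rewrite -[e in LHS]gtr0_norm // -normfV -normrM -normrN; congr `|_|.
  by rewrite mulrBl; field; rewrite gt_eqF.
set a := 1 - _; set b := 1 - _.
rewrite /Num.max /Num.min.
by case: (ltP 1 a) => h1; case: (ltP 1 b) => h2; rewrite ?ltr01;
  case: (ltP 0 a) => h3; case: (ltP 0 b) => h4;
  case: (ler0P (a - b)) => h5;
  first [lra | rewrite ler_norml; apply/andP; split; lra].
Qed.

Lemma ramp_continuous s e : 0 < e -> continuous (ramp s e).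
Proof.
move=> e0 x; apply/cvgrPdist_lt => eps eps0; near=> t.
apply: (le_lt_trans (ramp_lipschitz _ _ _ e0)).
rewrite ltr_pdivrMr //; near: t.
by apply: cvgr_dist_lt; rewrite ?mulr_gt0.
Unshelve. all: by end_near. Qed.

End Ramp.

Section RampStein.
Context {R : realType}.

Lemma gaussian_cdf_fin (s : R) : gaussian_cdf s \is a fin_num.
Proof. by rewrite /gaussian_cdf fin_num_measure. Qed.

Lemma gauss_mean_ramp (s e : R) : 0 < e ->
  fine (gaussian_cdf s) <= gauss_mean (ramp s e) <= fine (gaussian_cdf (s + e)).
Proof.
move=> e0; apply/andP; split.
  apply: cdf_le_gauss_mean; [exact: ramp_continuous|exact: ramp_bounds|].
  by move=> x; exact: ramp_eq1.
apply: gauss_mean_le_cdf; [exact: ramp_continuous|exact: ramp_bounds|].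
by move=> x; exact: ramp_eq0.
Qed.

(** The bound on the second-order remainder is a Lipschitz bound on dg.  Since
    (g (x + t) - g x) / t solves an equation of the same form, with right-hand side
    at most 6 + 1 / e, this follows from [bounded_stein_le]. *)
Lemma stein_ramp (s e : R) : 0 < e -> e <= 1 -> exists g dg : R -> R,
  [/\ forall x, dg x - x * g x = ramp s e x - gauss_mean (ramp s e),
      forall x, `|dg x| <= 2 &
      forall x y, `|g y - g x - dg x * (y - x)| <= 14 / e * (y - x) ^+ 2].
Proof.
move=> e0 e1.
have [g gdg g6] := stein_solution (ramp_continuous e0) (ramp_bounds s e).
set k := fun x => ramp s e x - gauss_mean (ramp s e) in gdg.
pose dg x := x * g x + k x.
have k1 x : `|k x| <= 1.
  have /andP[c0 c1] := gauss_mean_bounds (@ramp_continuous R s e e0) (ramp_bounds s e).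
  by have /andP[h0 h1] := ramp_bounds s e x; rewrite ler_norml /k; lra.
exists g, dg; split.
- by move=> x; rewrite /dg /k addrAC subrr add0r.
- by move=> x; have := bounded_stein_le gdg k1 g6 x; rewrite mulr1.
have gshift t (x : R) : is_derive x 1 (fun z => g (z + t)) (dg (x + t)).
  have H : is_derive (x + t) 1 g (dg (x + t)) by exact: gdg.
  have H2 : is_derive x 1 (fun z : R => z + t) 1.
    by apply: is_derive_eq; rewrite addr0.
  have := @is_derive1_comp R g (fun z => z + t) x _ _ H H2.
  by rewrite mulr1.
have dg_lip x t : `|dg (x + t) - dg x| <= 14 / e * `|t|.
  have [->|t0] := eqVneq t 0; first by rewrite addr0 subrr normr0 mulr0.
  pose u z := (g (z + t) - g z) / t.
  pose l z := g (z + t) + (k (z + t) - k z) / t.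
  have udu (z : R) : is_derive z 1 u (z * u z + l z).
    rewrite (_ : _ + _ = t^-1 * (dg (z + t) - dg z)); last first.
      by rewrite /u /l /dg; field.
    rewrite /u; have D : is_derive z 1 (fun z => g (z + t) - g z) (dg (z + t) - dg z).
      exact: (@is_deriveB _ _ _ (fun z => g (z + t)) g z 1 _ _ (gshift t z) (gdg z)).
    have := @is_deriveZ _ _ _ _ t^-1 z 1 _ D.
    by congr is_derive; apply/funext => y; rewrite /GRing.scale /= mulrC.
  have l6 z : `|l z| <= 7 / e.
    have : `|(k (z + t) - k z) / t| <= 1 / e.
      rewrite normrM normfV ler_pdivrMr ?normr_gt0 // mulrC mulrA mulr1.
      rewrite /k opprB addrA subrK; apply: le_trans (ramp_lipschitz _ _ _ e0) _.
      by rewrite addrAC subrr add0r.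
    have := ler_normD (g (z + t)) ((k (z + t) - k z) / t).
    have := g6 (z + t); rewrite -/(l z).
    have : 6 <= 6 / e by rewrite ler_pdivlMr // ler_piMr.
    lra.
  have u10 z : `|u z| <= 12 / `|t|.
    rewrite normrM normfV ler_wpM2r //.
    by have := ler_normB (g (z + t)) (g z); have := g6 (z + t); have := g6 z; lra.
  have := bounded_stein_le udu l6 u10 x.
  have -> : x * u x + l x = (dg (x + t) - dg x) / t by rewrite /u /l /dg; field.
  by rewrite normrM normfV ler_pdivrMr ?normr_gt0 // mulrA -[2 * 7]natrM.
move=> x y.
have [D c ->] : exists2 c, `|c - x| <= `|y - x| & g y - g x = dg c * (y - x).
  have [xy|/ltW yx] := leP x y.
    have [c /andP[xc cy] gE] := mean_value xy gdg.
    by exists c => //; rewrite !ger0_norm ?subr_ge0 // lerB.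
  have [c /andP[yc cx] gE] := mean_value yx gdg.
  exists c; first by rewrite distrC (distrC y) !ger0_norm ?subr_ge0 // lerB.
  by rewrite -[LHS]opprB gE -mulrN opprB.
rewrite -mulrBl normrM -[(y - x) ^+ 2]ger0_norm ?sqr_ge0 // normrX expr2 mulrA.
rewrite ler_wpM2r //.
have := dg_lip x (D - x); rewrite (addrC x) subrK => /le_trans; apply.
by rewrite ler_wpM2l // divr_ge0 // ltW.
Qed.

End RampStein.

(** * Independent variables with finitely many values *)

Section FiniteExpectation.
Context {R : realType} {S : finType}.
Variable P : S -> R.
Implicit Types (f g : S -> R) (k : R).

Definition fexp f : R := \sum_s P s * f s.

Lemma eq_fexp f g : f =1 g -> fexp f = fexp g.
Proof. by move=> fg; apply: eq_bigr => s _; rewrite fg. Qed.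

Lemma fexpD f g : fexp (fun s => f s + g s) = fexp f + fexp g.
Proof. by rewrite /fexp -big_split; apply: eq_bigr => s _; rewrite mulrDr. Qed.

Lemma fexpZ k f : fexp (fun s => k * f s) = k * fexp f.
Proof. by rewrite /fexp mulr_sumr; apply: eq_bigr => s _; rewrite mulrCA. Qed.

Lemma fexpZr k f : fexp (fun s => f s * k) = fexp f * k.
Proof. by rewrite /fexp mulr_suml; apply: eq_bigr => s _; rewrite mulrA. Qed.

Lemma fexpN f : fexp (fun s => - f s) = - fexp f.
Proof. by rewrite -mulN1r -fexpZ; apply: eq_fexp => s; rewrite mulN1r. Qed.

Lemma fexpB f g : fexp (fun s => f s - g s) = fexp f - fexp g.
Proof. by rewrite fexpD fexpN. Qed.

Lemma fexp_sum (J : finType) (A : pred J) (F : J -> S -> R) :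
  fexp (fun s => \sum_(j | A j) F j s) = \sum_(j | A j) fexp (F j).
Proof.
by rewrite /fexp exchange_big; apply: eq_bigr => s _; rewrite mulr_sumr.
Qed.

Hypothesis P0 : forall s, 0 <= P s.

Lemma fexp_ge0 f : (forall s, 0 <= f s) -> 0 <= fexp f.
Proof. by move=> f0; apply: sumr_ge0 => s _; rewrite mulr_ge0. Qed.

Lemma le_fexp f g : (forall s, f s <= g s) -> fexp f <= fexp g.
Proof. by move=> fg; apply: ler_sum => s _; rewrite ler_wpM2l. Qed.

Lemma ler_norm_fexp f : `|fexp f| <= fexp (fun s => `|f s|).
Proof.
apply: (le_trans (ler_norm_sum _ _ _)).
by apply: ler_sum => s _; rewrite normrM ger0_norm.
Qed.

Hypothesis P1 : \sum_s P s = 1.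

Lemma fexp_cst k : fexp (fun=> k) = k.
Proof. by rewrite /fexp -mulr_suml P1 mul1r. Qed.

Definition fvar f : R := fexp (fun s => (f s - fexp f) ^+ 2).

Lemma fvarE f : fvar f = fexp (fun s => f s ^+ 2) - fexp f ^+ 2.
Proof.
rewrite /fvar; set m := fexp f.
transitivity (fexp (fun s => (f s ^+ 2 - (2 * m) * f s) + m ^+ 2)).
  by apply: eq_fexp => s; ring.
by rewrite fexpD fexpB fexp_cst fexpZ -/m; ring.
Qed.

Lemma fvar_ge0 f : 0 <= fvar f.
Proof. by apply: fexp_ge0 => s; rewrite sqr_ge0. Qed.

Lemma fexp_sqr_le f : fexp f ^+ 2 <= fexp (fun s => f s ^+ 2).
Proof. by rewrite -subr_ge0 -fvarE fvar_ge0. Qed.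

Lemma fexp_norm_le_sqrt f : fexp (fun s => `|f s|) <= Num.sqrt (fexp (fun s => f s ^+ 2)).
Proof.
have h0 : 0 <= fexp (fun s => `|f s|) by apply: fexp_ge0 => s.
rewrite -[leLHS]ger0_norm // -sqrtr_sqr ler_wsqrtr //.
apply: (le_trans (fexp_sqr_le _)); apply: le_fexp => s.
by rewrite real_normK // num_real.
Qed.

(** The Cauchy-Schwarz inequality for two functions whose second moments have
    known bounds, obtained without square roots from 2 x y <= x^2 / q + q y^2. *)
Lemma fexp_mul_le f g M q : 0 < q ->
  fexp (fun s => f s ^+ 2) <= q ^+ 2 * M -> fexp (fun s => g s ^+ 2) <= M ->
  `|fexp (fun s => f s * g s)| <= q * M.
Proof.
move=> q0 fM gM; apply: (le_trans (ler_norm_fexp _)).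
have : fexp (fun s => `|f s * g s|) <=
    fexp (fun s => (2 * q)^-1 * f s ^+ 2 + (q / 2) * g s ^+ 2).
  apply: le_fexp => s.
  have -> : (2 * q)^-1 * f s ^+ 2 + q / 2 * g s ^+ 2
      = (2 * q)^-1 * (`|f s| ^+ 2 + (q * `|g s|) ^+ 2).
    rewrite exprMn !real_normK ?num_real //; field.
    by rewrite gt_eqF.
  rewrite normrM ler_pdivlMl ?mulr_gt0 //.
  by have := sqr_ge0 (`|f s| - q * `|g s|); lra.
move=> /le_trans; apply; rewrite fexpD !fexpZ.
have h1 : (2 * q)^-1 * fexp (fun s => f s ^+ 2) <= (2 * q)^-1 * (q ^+ 2 * M).
  by rewrite ler_wpM2l // invr_ge0 mulr_ge0 // ltW.
have h2 : q / 2 * fexp (fun s => g s ^+ 2) <= q / 2 * M.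
  by rewrite ler_wpM2l // divr_ge0 // ltW.
have h3 : (2 * q)^-1 * (q ^+ 2 * M) = q / 2 * M by field; rewrite gt_eqF.
have h4 : q * M = q / 2 * M + q / 2 * M by field.
by rewrite h4 lerD // -h3.
Qed.

End FiniteExpectation.

Section ProductSpace.
Context {R : realType} {I T : finType}.
Variable p : I -> T -> R.
Hypothesis p0 : forall i t, 0 <= p i t.
Hypothesis p1 : forall i, \sum_t p i t = 1.

Local Notation config := {ffun I -> T}.
Implicit Types (a b c : config) (J K : {set I}) (i j : I).

Definition cweight a : R := \prod_i p i (a i).

Lemma cweight_ge0 a : 0 <= cweight a.
Proof. by apply: prodr_ge0. Qed.

Lemma sum_cweight : \sum_a cweight a = 1.
Proof.
rewrite /cweight -(bigA_distr_bigA p); apply: big1 => i _; exact: p1.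
Qed.

Definition Ex (f : config -> R) : R := fexp cweight f.

Definition Ex2 (f : config -> config -> R) : R := Ex (fun a => Ex (f a)).

Lemma Ex_prod (psi : I -> T -> R) :
  Ex (fun a => \prod_i psi i (a i)) = \prod_i \sum_t p i t * psi i t.
Proof.
rewrite (bigA_distr_bigA (fun i t => p i t * psi i t)).
by apply: eq_bigr => a _; rewrite big_split.
Qed.

Lemma Ex_coord i (psi : T -> R) : Ex (fun a => psi (a i)) = \sum_t p i t * psi t.
Proof.
pose F j t := if j == i then psi t else 1.
transitivity (Ex (fun a => \prod_j F j (a j))).
  apply: eq_fexp => a; rewrite (bigD1 i) //= /F eqxx big1 ?mulr1 // => j ji.
  by rewrite (negbTE ji).
rewrite Ex_prod (bigD1 i) //= [X in _ * X]big1 ?mulr1 => [|j ji].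
  by apply: eq_bigr => t _; rewrite /F eqxx.
by rewrite /F (negbTE ji) -[RHS](p1 j); apply: eq_bigr => t _; rewrite mulr1.
Qed.

Definition mix J a b : config := [ffun i => if i \in J then b i else a i].

Lemma cweight_mix J a b :
  cweight (mix J a b) * cweight (mix J b a) = cweight a * cweight b.
Proof.
rewrite /cweight -!big_split; apply: eq_bigr => i _.
by rewrite !ffunE; case: ifP => _ //=; rewrite mulrC.
Qed.

Lemma mixK J a b : mix J (mix J a b) (mix J b a) = a.
Proof. by apply/ffunP => i; rewrite !ffunE; case: (i \in J). Qed.

Lemma Ex2E f : Ex2 f = \sum_ab cweight ab.1 * cweight ab.2 * f ab.1 ab.2.
Proof.
rewrite /Ex2 /Ex /fexp -(pair_bigA _ (fun a b => cweight a * cweight b * f a b)) /=.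
by apply: eq_bigr => a _; rewrite mulr_sumr; apply: eq_bigr => b _; rewrite mulrA.
Qed.

(** Exchanging the coordinates in J between two independent configurations does
    not change their joint law. *)
Lemma Ex2_mix J f : Ex2 (fun a b => f (mix J a b) (mix J b a)) = Ex2 f.
Proof.
rewrite !Ex2E; pose s (ab : config * config) := (mix J ab.1 ab.2, mix J ab.2 ab.1).
have sK : involutive s by case=> a b; rewrite /s /= !mixK.
rewrite [RHS](reindex_inj (inv_inj sK)) /=.
by apply: eq_bigr => -[a b] _ /=; rewrite cweight_mix.
Qed.

Lemma Ex2_fst f : Ex2 (fun a _ => f a) = Ex f.
Proof.
by apply: eq_fexp => a; rewrite /Ex fexp_cst //; exact: sum_cweight.
Qed.

Lemma Ex2_snd f : Ex2 (fun _ b => f b) = Ex f.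
Proof. by rewrite /Ex2 {1}/Ex fexp_cst //; exact: sum_cweight. Qed.

Lemma Ex2_mix_fst J f : Ex2 (fun a b => f (mix J a b)) = Ex f.
Proof. by rewrite (Ex2_mix J (fun a _ => f a)) Ex2_fst. Qed.

Definition agree J a b := forall i, i \in J -> a i = b i.

Definition depends_on J (f : config -> R) := forall a b, agree J a b -> f a = f b.

Lemma Ex_indep J K f g : depends_on J f -> depends_on K g -> [disjoint J & K]%B ->
  Ex (fun a => f a * g a) = Ex f * Ex g.
Proof.
move=> fJ gK JK.
transitivity (Ex2 (fun a b => f (mix K a b) * g (mix K a b))).
  by rewrite (Ex2_mix_fst K (fun a => f a * g a)).
transitivity (Ex2 (fun a b => f a * g b)).
  apply: eq_fexp => a; apply: eq_fexp => b; congr (_ * _).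
    apply: fJ => i iJ; rewrite ffunE; case: ifP => // iK.
    by move/disjoint_setI0/setP/(_ i): JK; rewrite !inE iJ iK.
  by apply: gK => i iK; rewrite ffunE iK.
by rewrite /Ex2 /Ex -fexpZr; apply: eq_fexp => a; rewrite fexpZ.
Qed.

Definition depends_on2 J (f : config -> config -> R) :=
  forall a a' b b', agree J a a' -> agree J b b' -> f a b = f a' b'.

Lemma Ex2_indep J K f g : depends_on2 J f -> depends_on2 K g -> [disjoint J & K]%B ->
  Ex2 (fun a b => f a b * g a b) = Ex2 f * Ex2 g.
Proof.
move=> fJ gK JK; rewrite /Ex2 -(@Ex_indep J K) //.
- apply: eq_fexp => a; apply: (@Ex_indep J K) => //.
    by move=> b b' bb'; apply: fJ.
  by move=> b b' bb'; apply: gK.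
- by move=> a a' aa'; apply: eq_fexp => b; apply: fJ.
- by move=> a a' aa'; apply: eq_fexp => b; apply: gK.
Qed.

Lemma eq_Ex2 f g : (forall a b, f a b = g a b) -> Ex2 f = Ex2 g.
Proof. by move=> fg; apply: eq_fexp => a; apply: eq_fexp. Qed.

Let P2 (ab : config * config) := cweight ab.1 * cweight ab.2.

Let Ex2_fexp f : Ex2 f = fexp P2 (fun ab => f ab.1 ab.2).
Proof. exact: Ex2E. Qed.

Let P2_ge0 ab : 0 <= P2 ab.
Proof. by rewrite mulr_ge0 ?cweight_ge0. Qed.

Let sum_P2 : \sum_ab P2 ab = 1.
Proof.
rewrite /P2 -(pair_bigA _ (fun a b => cweight a * cweight b)) /=.
by rewrite -[RHS]sum_cweight; apply: eq_bigr => a _; rewrite -mulr_sumr sum_cweight mulr1.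
Qed.

Lemma Ex2D f g : Ex2 (fun a b => f a b + g a b) = Ex2 f + Ex2 g.
Proof. by rewrite !Ex2_fexp fexpD. Qed.

Lemma Ex2B f g : Ex2 (fun a b => f a b - g a b) = Ex2 f - Ex2 g.
Proof. by rewrite !Ex2_fexp fexpB. Qed.

Lemma Ex2Z k f : Ex2 (fun a b => k * f a b) = k * Ex2 f.
Proof. by rewrite !Ex2_fexp fexpZ. Qed.

Lemma Ex2N f : Ex2 (fun a b => - f a b) = - Ex2 f.
Proof. by rewrite !Ex2_fexp fexpN. Qed.

Lemma Ex2_sum (J : finType) (F : J -> config -> config -> R) :
  Ex2 (fun a b => \sum_j F j a b) = \sum_j Ex2 (F j).
Proof. by rewrite Ex2_fexp fexp_sum; apply: eq_bigr => j _; rewrite Ex2_fexp. Qed.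

Lemma Ex2_cst k : Ex2 (fun _ _ => k) = k.
Proof. by rewrite Ex2_fexp fexp_cst. Qed.

Lemma le_Ex2 f g : (forall a b, f a b <= g a b) -> Ex2 f <= Ex2 g.
Proof. by move=> fg; rewrite !Ex2_fexp; apply: le_fexp. Qed.

Lemma Ex2_ge0 f : (forall a b, 0 <= f a b) -> 0 <= Ex2 f.
Proof. by move=> fg; rewrite !Ex2_fexp; apply: fexp_ge0. Qed.

Lemma ler_norm_Ex2 f : `|Ex2 f| <= Ex2 (fun a b => `|f a b|).
Proof. by rewrite !Ex2_fexp; apply: ler_norm_fexp. Qed.

Lemma Ex2_norm_le_sqrt f :
  Ex2 (fun a b => `|f a b|) <= Num.sqrt (Ex2 (fun a b => f a b ^+ 2)).
Proof. by rewrite !Ex2_fexp; apply: fexp_norm_le_sqrt. Qed.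

Lemma Ex2_sqr_le f : Ex2 f ^+ 2 <= Ex2 (fun a b => f a b ^+ 2).
Proof. by rewrite !Ex2_fexp; apply: fexp_sqr_le. Qed.

Lemma Ex2_mul_le f g M q : 0 < q ->
  Ex2 (fun a b => f a b ^+ 2) <= q ^+ 2 * M -> Ex2 (fun a b => g a b ^+ 2) <= M ->
  `|Ex2 (fun a b => f a b * g a b)| <= q * M.
Proof. by rewrite !Ex2_fexp => q0 fM gM; apply: fexp_mul_le. Qed.

Section SteinMethod.
Variable f : config -> R.

Definition dif (phi : config -> R) i a b := phi a - phi (mix [set i]%SET a b).

Let Pre (k : nat) : {set I} := [set i : I | (enum_rank i < k)%N]%SET.

Definition preds i : {set I} := Pre (enum_rank i).

Let mix_pre i a b : mix [set i]%SET (mix (preds i) a b) b = mix (Pre (enum_rank i).+1) a b.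
Proof.
apply/ffunP => j; rewrite !ffunE !inE ltnS (leq_eqVlt (enum_rank j)).
have -> : (enum_rank j == enum_rank i :> nat) = (j == i).
  by apply/eqP/eqP => [/val_inj/enum_rank_inj|->].
by case: eqP.
Qed.

Lemma notin_preds i : i \notin preds i.
Proof. by rewrite inE ltnn. Qed.

Lemma sum_dif_telescope a b : f a - f b = \sum_i dif f i (mix (preds i) a b) b.
Proof.
pose s k := f (mix (Pre k) a b).
transitivity (\sum_(i : I) (s (enum_rank i) - s (enum_rank i).+1)); last first.
  by apply: eq_bigr => i _; rewrite /dif mix_pre.
rewrite (reindex_onto enum_val enum_rank) /=; last by move=> i _; rewrite enum_rankK.
rewrite (eq_bigl predT) => [|k]; last by rewrite enum_valK eqxx.
under eq_bigr do rewrite enum_valK.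
rewrite -(big_mkord predT (fun k => s k - s k.+1)) /=.
under eq_bigr do rewrite -opprB.
rewrite sumrN telescope_sumr // opprB /s; congr (f _ - f _); apply/ffunP => i.
  by rewrite ffunE inE.
by rewrite ffunE inE ltn_ord.
Qed.

Let dif_swap i a b :
  dif f i (mix (preds i) (mix [set i]%SET a b) (mix [set i]%SET b a)) (mix [set i]%SET b a)
  = - dif f i (mix (preds i) a b) b.
Proof.
rewrite /dif opprB; congr (f _ - f _); apply/ffunP => j; rewrite !ffunE !inE;
  by case: (eqVneq j i) => [->|]; rewrite ?ltnn.
Qed.

(** E phi(a) (f(a) - f(b)) is telescoped along the fixed order.  Exchanging the
    i-th coordinates of a and b turns the i-th increment of f into its opposite and
    phi(a) into its value with the i-th coordinate resampled; averaging the two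
    expressions makes an increment of phi appear. *)
Lemma covariance_dif (phi : config -> R) :
  Ex (fun a => phi a * (f a - Ex f)) =
  Ex2 (fun a b => 2^-1 * \sum_i dif phi i a b * dif f i (mix (preds i) a b) b).
Proof.
transitivity (Ex2 (fun a b => phi a * (f a - f b))).
  apply: eq_fexp => a; rewrite /Ex fexpZ fexpB fexp_cst //; exact: sum_cweight.
rewrite Ex2Z Ex2_sum mulr_sumr.
transitivity (\sum_i Ex2 (fun a b => phi a * dif f i (mix (preds i) a b) b)).
  rewrite -Ex2_sum; apply: eq_Ex2 => a b; rewrite sum_dif_telescope.
  by rewrite mulr_sumr.
apply: eq_bigr => i _; rewrite /(dif phi).
have -> : Ex2 (fun a b => (phi a - phi (mix [set i]%SET a b)) * dif f i (mix (preds i) a b) b)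
  = Ex2 (fun a b => phi a * dif f i (mix (preds i) a b) b)
    - Ex2 (fun a b => phi (mix [set i]%SET a b) * dif f i (mix (preds i) a b) b).
  by rewrite -Ex2B; apply: eq_Ex2 => a b; rewrite mulrBl.
have -> : Ex2 (fun a b => phi (mix [set i]%SET a b) * dif f i (mix (preds i) a b) b)
  = - Ex2 (fun a b => phi a * dif f i (mix (preds i) a b) b).
  rewrite -(Ex2_mix [set i]%SET) -Ex2N; apply: eq_Ex2 => a b.
  by rewrite mixK dif_swap mulrN.
by rewrite opprK; field.
Qed.

Definition increment_product i a b := dif f i a b * dif f i (mix (preds i) a b) b.

(** The integrand of [covariance_dif] for phi = f, a random variable of mean
    Var f.  Its concentration is what makes f nearly Gaussian. *)
Definition carre_du_champ a b := 2^-1 * \sum_i increment_product i a b.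

Lemma Ex2_carre_du_champ : Ex2 carre_du_champ = fvar cweight f.
Proof.
rewrite -(covariance_dif f) /fvar /Ex.
transitivity (fexp cweight (fun a => (f a - fexp cweight f) ^+ 2
                            + fexp cweight f * (f a - fexp cweight f))).
  by apply: eq_fexp => a; ring.
rewrite fexpD fexpZ fexpB fexp_cst ?subrr ?mulr0 ?addr0 //; exact: sum_cweight.
Qed.

(** Stein's identity E g(N) N = E g'(N) up to two errors: replacing the
    increments of g (f) by dg (f) times those of f, and then carre_du_champ by its
    mean. *)
Lemma stein_product_bound (g dg : R -> R) (A B : R) :
  (forall x, `|dg x| <= A) ->
  (forall x y, `|g y - g x - dg x * (y - x)| <= B * (y - x) ^+ 2) ->
  `|Ex (fun a => g (f a) * (f a - Ex f)) - fvar cweight f * Ex (fun a => dg (f a))|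
  <= A * Num.sqrt (Ex2 (fun a b => (carre_du_champ a b - fvar cweight f) ^+ 2))
     + B / 2 * \sum_i Ex2 (fun a b => dif f i a b ^+ 2
                                      * `|dif f i (mix (preds i) a b) b|).
Proof.
move=> dgA gB; rewrite (covariance_dif (fun a => g (f a))).
set V := fvar _ f.
pose D i a b := dif f i (mix (preds i) a b) b.
have -> : Ex2 (fun a b => 2^-1 * \sum_i dif (fun a => g (f a)) i a b * D i a b)
    - V * Ex (fun a => dg (f a))
  = Ex2 (fun a b => 2^-1 * \sum_i
        (dif (fun a => g (f a)) i a b - dg (f a) * dif f i a b) * D i a b)
    + Ex2 (fun a b => dg (f a) * (carre_du_champ a b - V)).
  rewrite -Ex2D -(Ex2_fst (fun a => dg (f a))) -Ex2Z -Ex2B; apply: eq_Ex2 => a b.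
  rewrite mulrBr {1}/carre_du_champ mulrCA.
  have -> : dg (f a) * (\sum_i increment_product i a b)
      = \sum_i dg (f a) * dif f i a b * D i a b.
    by rewrite mulr_sumr; apply: eq_bigr => i _; rewrite mulrA.
  rewrite addrA -mulrDr -big_split /=; congr (_ * _ - _); last by rewrite mulrC.
  by apply: eq_bigr => i _; rewrite -mulrDl subrK.
rewrite addrC; apply: (le_trans (ler_normD _ _)); apply: lerD.
  apply: (le_trans (ler_norm_Ex2 _)).
  apply: (@le_trans _ _ (Ex2 (fun a b => A * `|carre_du_champ a b - V|))).
    by apply: le_Ex2 => a b; rewrite normrM ler_wpM2r.
  rewrite Ex2Z ler_wpM2l ?Ex2_norm_le_sqrt //.
  exact: le_trans (dgA 0).
rewrite -Ex2_sum -Ex2Z; apply: (le_trans (ler_norm_Ex2 _)); apply: le_Ex2 => a b.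
rewrite normrM ger0_norm // (mulrC B) -mulrA ler_wpM2l //.
apply: (le_trans (ler_norm_sum _ _ _)); rewrite mulr_sumr; apply: ler_sum => i _.
rewrite normrM mulrA ler_wpM2r //.
have := gB (f a) (f (mix [set i]%SET a b)).
rewrite /dif -(sqrrN (f a - _)) opprB; apply: le_trans.
set y := f (mix _ _ _).
have -> : g (f a) - g y - dg (f a) * (f a - y) = - (g y - g (f a) - dg (f a) * (y - f a)).
  by ring.
by rewrite normrN.
Qed.

End SteinMethod.
End ProductSpace.

(** * The recursion for the partition functions of induced subgraphs *)

Section Graph.
Variable G : sgraph.
Implicit Types (x y v : G) (e f : edge G) (U : {set G}) (M : {set edge G}).
Local Open Scope set_scope.

Lemma edgeP e : exists x y, adj x y /\ val e = [set x; y].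
Proof.
by have /imsetP[[x y]] := valP e; rewrite inE /= => xy eE; exists x, y.
Qed.

Lemma edge_anchor_ex e : exists x, x \in val e.
Proof. by have [x [y [_ ->]]] := edgeP e; exists x; rewrite !inE eqxx. Qed.

Definition opp e x : G := odflt x [pick y in val e | y != x].

Lemma oppP e x : x \in val e -> val e = [set x; opp e x] /\ adj x (opp e x).
Proof.
have [a [b [ab eE]]] := edgeP e; rewrite eE => xab.
have ab' : a != b by apply/eqP => abE; move: ab; rewrite abE adj_irr.
rewrite /opp eE; case: pickP => [y|none] /=.
  rewrite !inE => /andP[yab yx].
  move: xab yab yx; rewrite !inE => /orP[] /eqP-> /orP[] /eqP->; rewrite ?eqxx //= => _.
  by split; [rewrite finset.setUC|rewrite adj_sym].
exfalso; move: xab; rewrite !inE => /orP[] /eqP xE.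
- by have := none b; rewrite !inE eqxx orbT xE eq_sym ab'.
- by have := none a; rewrite !inE eqxx xE ab'.
Qed.

Lemma edge_opp e x : x \in val e -> val e = [set x; opp e x].
Proof. by case/oppP. Qed.

Lemma adj_opp e x : x \in val e -> adj x (opp e x).
Proof. by case/oppP. Qed.

Lemma opp_neq e x : x \in val e -> opp e x != x.
Proof.
by move=> xe; apply/eqP => h; have := adj_opp xe; rewrite h adj_irr.
Qed.

Lemma opp_in e x : x \in val e -> opp e x \in val e.
Proof. by move=> xe; rewrite (edge_opp xe) !inE eqxx orbT. Qed.

Definition incident x : {set edge G} := [set e : edge G | x \in val e].

Lemma card_incident x : (#|incident x| <= max_degree G)%N.
Proof.
have inj : {in incident x &, injective (opp ^~ x)}.
  move=> e f; rewrite !inE => xe xf ef; apply: val_inj.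
  by rewrite (edge_opp xe) (edge_opp xf) ef.
rewrite -(card_in_imset inj).
apply: (@leq_trans #|[set y | adj x y]|).
  apply: subset_leq_card; apply/fintype.subsetP => _ /imsetP[e xe ->].
  by rewrite !inE in xe *; exact: adj_opp.
by rewrite /max_degree; apply: (leq_bigmax x).
Qed.

Definition star U x : {set edge G} := [set e : edge G | (x \in val e) && (val e \subset U)].

Lemma star_sub U x : star U x \subset incident x.
Proof. by apply/fintype.subsetP => e; rewrite !inE => /andP[]. Qed.

Lemma card_star U x : (#|star U x| <= max_degree G)%N.
Proof. exact: leq_trans (subset_leq_card (star_sub U x)) (card_incident x). Qed.

Lemma star_setT x : star [set: G] x = incident x.
Proof. by apply/setP => e; rewrite !inE finset.subsetT andbT. Qed.

Lemma star_opp_in U x e : e \in star U x -> opp e x \in U :\ x.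
Proof.
rewrite inE => /andP[xe eU]; rewrite !inE opp_neq //=.
by apply: (fintype.subsetP eU); exact: opp_in.
Qed.

Lemma setD_edge U x e : x \in val e -> U :\: val e = (U :\ x) :\ opp e x.
Proof.
by move=> xe; apply/setP => v; rewrite (edge_opp xe) !inE negb_or andbA [_ && (v != x)]andbC.
Qed.

Fixpoint near k x : {set G} :=
  if k is k'.+1 then x |: \bigcup_(y | adj x y) near k' y else [set x].

Lemma near_refl k x : x \in near k x.
Proof. by case: k => [|k] /=; rewrite !inE ?eqxx. Qed.

Lemma nearS k x y : adj x y -> near k y \subset near k.+1 x.
Proof.
by move=> xy; apply: subsetU; apply/orP; right; apply: finset.bigcup_sup.
Qed.

Lemma nearP k x y : y \in near k x ->
  exists p : seq G, [/\ path (@adj G) x p, last x p = y & (size p <= k)%N].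
Proof.
elim: k x => [|k IH] x /=; first by rewrite inE => /eqP ->; exists [::].
rewrite !inE => /orP[/eqP ->|]; first by exists [::].
case/bigcupP => u xu /IH[p [pp pl ps]].
by exists (u :: p); split => //=; rewrite xu.
Qed.

Lemma is_matchingP M : reflect
  (forall e f, e \in M -> f \in M -> e != f -> [disjoint (val e : {set G}) & (val f : {set G})]%B)
  (is_matching M).
Proof.
apply: (iffP forallP) => [H e f eM fM ef|H e].
  by have /implyP/(_ eM)/forallP/(_ f)/implyP/(_ fM)/implyP/(_ ef) := H e.
apply/implyP => eM; apply/forallP => f; apply/implyP => fM; apply/implyP => ef.
exact: H.
Qed.

Lemma unmatchedP M x : reflect (forall e, e \in M -> x \notin val e) (unmatched M x).
Proof.
apply: (iffP forallP) => [H e eM|H e]; first by have /implyP/(_ eM) := H e.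
by apply/implyP/H.
Qed.

Definition matching_in U M := is_matching M && [forall e in M, val e \subset U].

Lemma matching_inP U M : reflect
  (is_matching M /\ forall e, e \in M -> val e \subset U) (matching_in U M).
Proof.
by apply: (iffP andP) => -[mM /forall_inP sM]; split.
Qed.

Lemma matching_in_add U e M : val e \subset U ->
  (matching_in U (e |: M) && ((e |: M) :\ e == M)) = matching_in (U :\: val e) M.
Proof.
move=> eU; apply/andP/matching_inP => [[/matching_inP[/is_matchingP mM sM] /eqP eM]|[/is_matchingP mM sM]].
  have eNM f : f \in M -> f != e by rewrite -eM !inE => /andP[].
  split.
    by apply/is_matchingP => f g fM gM; apply: mM; rewrite !inE ?fM ?gM orbT.
  move=> f fM; rewrite finset.subsetD sM ?inE ?fM ?orbT //=.
  by apply: mM; rewrite ?eNM // !inE ?eqxx ?fM ?orbT.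
have dis f : f \in M -> [disjoint (val f : {set G}) & (val e : {set G})]%B.
  by move=> /sM; rewrite finset.subsetD => /andP[].
have eNM : e \notin M.
  apply/negP => /dis; have [x xe] := edge_anchor_ex e.
  by move=> /disjoint_setI0/setP/(_ x); rewrite !inE xe.
split; last by rewrite finset.setU1K.
apply/matching_inP; split.
  apply/is_matchingP => f g; rewrite !inE => /orP[/eqP->|fM] /orP[/eqP->|gM].
  - by rewrite eqxx.
  - by move=> _; rewrite disjoint_sym; exact: dis.
  - by move=> _; exact: dis.
  - exact: mM.
move=> f; rewrite !inE => /orP[/eqP-> //|/sM].
by rewrite finset.subsetD => /andP[].
Qed.

Section Weights.
Context {R : realType}.
Implicit Types z : edge G + G -> R.

Definition sub_weight U M z : R :=
  expR (\sum_(e in M) z (inl e) + \sum_(v in U | unmatched M v) z (inr v)).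

Definition Zin U z : R := \sum_(M | matching_in U M) sub_weight U M z.

Definition logZ z : R := free_energy (fun e => z (inl e)) (fun v => z (inr v)).

Lemma Zin_setT z : partition_function (fun e => z (inl e)) (fun v => z (inr v)) = Zin [set: G] z.
Proof.
rewrite /partition_function /Zin; apply: eq_big => [M|M _].
  by apply/idP/matching_inP => [mM|[]//]; split.
by rewrite /gibbs_weight /sub_weight; congr expR; congr (_ + _); apply: eq_bigl => v; rewrite inE.
Qed.

Lemma logZE z : logZ z = ln (Zin [set: G] z).
Proof. by rewrite /logZ /free_energy Zin_setT. Qed.

Lemma Zin_gt0 U z : 0 < Zin U z.
Proof.
rewrite /Zin (bigD1 finset.set0) /=; last first.
  apply/matching_inP; split; last by move=> e; rewrite inE.
  by apply/is_matchingP => e f; rewrite inE.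
by rewrite ltr_wpDr ?expR_gt0 // sumr_ge0 // => M _; exact: expR_ge0.
Qed.

Definition coords_in U (c : edge G + G) : bool :=
  match c with inl e => val e \subset U | inr v => v \in U end.

Lemma Zin_local U z z' : (forall c, coords_in U c -> z c = z' c) ->
  Zin U z = Zin U z'.
Proof.
move=> zz'; apply: eq_bigr => M /matching_inP[_ sM].
rewrite /sub_weight; congr expR; congr (_ + _).
  by apply: eq_bigr => e eM; apply: zz' => /=; exact: sM.
by apply: eq_bigr => v /andP[vU _]; exact: zz'.
Qed.

(** A matching of the subgraph induced on U either leaves x unmatched or
    contains exactly one edge at x. *)
Lemma Zin_rec U x z : x \in U ->
  Zin U z = expR (z (inr x)) * Zin (U :\ x) z
            + \sum_(e in star U x) expR (z (inl e)) * Zin (U :\: val e) z.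
Proof.
move=> xU; rewrite {1}/Zin (bigID (fun M => unmatched M x)) /=; congr (_ + _).
  rewrite /Zin mulr_sumr; apply: eq_big => [M|M /andP[mM uM]].
    apply/andP/matching_inP => [[/matching_inP[mM sM] /unmatchedP uM]|[mM sM]].
      by split => // e eM; rewrite finset.subsetD1 sM // uM.
    split; first (apply/matching_inP; split => // e /sM).
      by rewrite finset.subsetD1 => /andP[].
    by apply/unmatchedP => e /sM; rewrite finset.subsetD1 => /andP[].
  rewrite /sub_weight -expRD; congr expR; rewrite addrCA; congr (_ + _).
  rewrite (bigD1 x) /=; last by rewrite xU uM.
  by congr (_ + _); apply: eq_bigl => v; rewrite !inE andbC andbA.
transitivity (\sum_(M | matching_in U M && ~~ unmatched M x)
    \sum_(e in star U x | e \in M) sub_weight U M z).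
  apply: eq_bigr => M /andP[/matching_inP[/is_matchingP mM sM] uM].
  have [e eM xe] : exists2 e, e \in M & x \in val e.
    apply/exists_inP; apply: contraR uM; rewrite negb_exists => /forallP H.
    by apply/unmatchedP => e eM; have := H e; rewrite eM.
  rewrite (big_pred1 e) // => f; rewrite !inE /=.
  apply/idP/eqP => [/andP[/andP[xf _] fM]|->]; last by rewrite xe sM.
  apply/eqP; apply: contraT => fe; have := mM _ _ fM eM fe.
  by move=> /disjoint_setI0/setP/(_ x); rewrite !inE xe xf.
rewrite (exchange_big_dep (fun e => e \in star U x)) /=; last first.
  by move=> M f _ /andP[].
apply: eq_bigr => e; rewrite inE => /andP[xe eU].
rewrite /Zin mulr_sumr (reindex_onto (fun M => e |: M) (fun M => M :\ e)) /=; last first.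
  by move=> M /andP[_ /andP[_ eM]]; rewrite finset.setD1K.
apply: eq_big => [M|M].
  rewrite -(matching_in_add _ eU); case: (matching_in U _) => //=.
  rewrite !inE eqxx xe eU /= andbT andbC; case: eqP => //= _.
  by apply/unmatchedP => /(_ e); rewrite !inE eqxx xe => /(_ isT).
move=> /andP[h1 h2].
have : matching_in (U :\: val e) M.
  by rewrite -(matching_in_add _ eU) h2 andbT; case/andP: h1 => /andP[].
move=> /matching_inP[mM sM].
have eNM : e \notin M by rewrite -(eqP h2) !inE eqxx.
rewrite /sub_weight -expRD; congr expR; rewrite addrA; congr (_ + _).
  by rewrite big_setU1.
apply: eq_bigl => v.
have -> : unmatched (e |: M) v = (v \notin val e) && unmatched M v.
  apply/unmatchedP/andP => [H|[ve /unmatchedP uM] f].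
    split; first by apply: H; rewrite !inE eqxx.
    by apply/unmatchedP => f fM; apply: H; rewrite !inE fM orbT.
  by rewrite !inE => /orP[/eqP-> //|]; exact: uM.
by rewrite !inE andbA [(v \in U) && _]andbC.
Qed.

End Weights.
End Graph.

(** * Logarithms of affine functions of the exponential of a weight *)

Section LogAffine.
Context {R : realType}.
Implicit Types A B t : R.

Lemma is_derive_ln_affine A B (x : R) : 0 <= A -> 0 < B ->
  is_derive x 1 (fun u => ln (A + expR u * B)) (expR x * B / (A + expR x * B)).
Proof.
move=> A0 B0; have pos : 0 < A + expR x * B by rewrite ltr_wpDl // mulr_gt0 ?expR_gt0.
have H2 : is_derive x 1 (fun u : R => A + expR u * B) (expR x * B).
  by apply: is_derive_eq; rewrite /GRing.scale /=; ring.
have := @is_derive1_comp R (@ln R) (fun u => A + expR u * B) x _ _ (is_derive1_ln pos) H2.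
by rewrite mulrC.
Qed.

Lemma ln_affine_lipschitz A B (x y : R) : 0 <= A -> 0 < B ->
  `|ln (A + expR x * B) - ln (A + expR y * B)| <= `|x - y|.
Proof.
move=> A0 B0; rewrite -[leRHS]mul1r.
apply: (@derive_le_lipschitz R _ _ 1 (fun u => is_derive_ln_affine u A0 B0)) => u.
have EB : 0 < expR u * B by rewrite mulr_gt0 ?expR_gt0.
have pos : 0 < A + expR u * B by rewrite ltr_wpDl.
by rewrite ger0_norm ?divr_ge0 ?(ltW EB) ?(ltW pos) // ler_pdivrMr // mul1r lerDr.
Qed.

(** If A / B and A' / B' are close, then so are the derivatives in x of the two
    logarithms, exp(x) B / (A + exp(x) B) and its analogue. *)
Lemma ln_affine_compare A B A' B' t (x y : R) : 0 <= A -> 0 < B -> 0 <= A' -> 0 < B' ->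
  0 <= t -> `|A * B' - A' * B| <= t * (A * B' + A' * B) ->
  `|(ln (A + expR x * B) - ln (A + expR y * B))
    - (ln (A' + expR x * B') - ln (A' + expR y * B'))| <= t * `|x - y|.
Proof.
move=> A0 B0 A'0 B'0 t0 AB.
pose phi u := ln (A + expR u * B) - ln (A' + expR u * B').
rewrite [X in `|X|](_ : _ = phi x - phi y); last by rewrite /phi; ring.
have D (u : R) : is_derive u 1 phi
    (expR u * B / (A + expR u * B) - expR u * B' / (A' + expR u * B')).
  by apply: is_deriveB; exact: is_derive_ln_affine.
apply: (derive_le_lipschitz D) => u.
set E := expR u; have E0 : 0 < E by exact: expR_gt0.
have p1 : 0 < A + E * B by rewrite ltr_wpDl // mulr_gt0.
have p2 : 0 < A' + E * B' by rewrite ltr_wpDl // mulr_gt0.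
have -> : E * B / (A + E * B) - E * B' / (A' + E * B')
    = - (E * (A * B' - A' * B)) / ((A + E * B) * (A' + E * B')).
  by field; rewrite !gt_eqF.
have p3 : 0 < (A + E * B) * (A' + E * B') by rewrite mulr_gt0.
rewrite normrM normrN normrM (gtr0_norm E0) normfV (gtr0_norm p3) ler_pdivrMr //.
apply: (@le_trans _ _ (E * (t * (A * B' + A' * B)))); first by rewrite ler_pM2l.
rewrite mulrCA ler_wpM2l //.
have -> : (A + E * B) * (A' + E * B') = A * A' + E ^+ 2 * (B * B') + E * (A * B' + A' * B).
  by ring.
by rewrite lerDr addr_ge0 // !mulr_ge0 ?sqr_ge0 // ltW.
Qed.

(** By concavity of the logarithm, p h <= ln (1 - p + p e^h); here h = x - y and
    p = B exp(y) / (A + B exp(y)), which is at least 1 / (1 + M exp(l)). *)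
Lemma ln_affine_lower A B M (x y l : R) : 0 <= A -> 0 < B -> A <= M * B ->
  - l <= y -> y <= x ->
  (x - y) / (1 + M * expR l) <= ln (A + expR x * B) - ln (A + expR y * B).
Proof.
move=> A0 B0 AMB ly yx.
have M0 : 0 <= M by rewrite -(pmulr_lge0 _ B0) (le_trans A0).
have [c /andP[yc cx] ->] := mean_value yx (fun u => is_derive_ln_affine u A0 B0).
rewrite mulrC ler_wpM2r ?subr_ge0 //.
have EB : 0 < expR c * B by rewrite mulr_gt0 ?expR_gt0.
have pos : 0 < A + expR c * B by rewrite ltr_wpDl.
have pos2 : 0 < 1 + M * expR l by rewrite ltr_wpDr // mulr_ge0 ?expR_ge0.
rewrite ler_pdivlMr // mulrC ler_pdivrMr // mulrDr mulr1 addrC lerD2l.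
have -> : expR c * B * (M * expR l) = M * B * (expR c * expR l) by ring.
apply: (le_trans AMB); rewrite ler_peMr ?mulr_ge0 ?(ltW B0) //.
rewrite -expRD -expR0 ler_expR.
by move: ly yc; lra.
Qed.

End LogAffine.

Section RatioDistance.
Context {R : realType}.
Implicit Types a b r s t n k : R.

(** This is tanh (|ln a - ln b| / 2): a bounded distance, invariant under scaling
    and inversion, which the recursion [zratio_rec] does not expand. *)
Definition rdist a b := `|a - b| / (a + b).

Lemma rdist_ge0 a b : 0 < a -> 0 < b -> 0 <= rdist a b.
Proof. by move=> a0 b0; rewrite divr_ge0 // addr_ge0 // ltW. Qed.

Lemma rdist_le1 a b : 0 < a -> 0 < b -> rdist a b <= 1.
Proof.
move=> a0 b0; rewrite ler_pdivrMr ?addr_gt0 // mul1r.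
by rewrite ler_norml; apply/andP; split; lra.
Qed.

Lemma rdist_le a b t : 0 < a -> 0 < b -> (rdist a b <= t) = (`|a - b| <= t * (a + b)).
Proof. by move=> a0 b0; rewrite ler_pdivrMr // addr_gt0. Qed.

Lemma sum_div_compare (J : finType) (A : {set J}) (a r s : J -> R) t :
  (forall j, j \in A -> [/\ 0 <= a j, 0 < r j, 0 < s j & rdist (r j) (s j) <= t]) ->
  `|\sum_(j in A) a j / r j - \sum_(j in A) a j / s j|
  <= t * (\sum_(j in A) a j / r j + \sum_(j in A) a j / s j).
Proof.
move=> H; rewrite -sumrB -big_split mulr_sumr /=.
apply: (le_trans (ler_norm_sum _ _ _)); apply: ler_sum => j jA.
have [a0 r0 s0] := H j jA; rewrite rdist_le // => rs.
have -> : a j / r j - a j / s j = a j / (r j * s j) * - (r j - s j).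
  by field; rewrite !gt_eqF.
have -> : a j / r j + a j / s j = a j / (r j * s j) * (r j + s j).
  by field; rewrite !gt_eqF.
have p : 0 <= a j / (r j * s j) by rewrite divr_ge0 // mulr_ge0 // ltW.
by rewrite normrM normrN (ger0_norm p) mulrCA ler_wpM2l.
Qed.

(** Adding n to both numbers contracts the distance by the largest of the shares
    a / (n + a) and b / (n + b). *)
Lemma rdist_add_le n a b t k : 0 < n -> 0 <= a -> 0 <= b -> 0 <= t ->
  `|a - b| <= t * (a + b) -> a <= k * (n + a) -> b <= k * (n + b) ->
  rdist (n + a) (n + b) <= k * t.
Proof.
move=> n0 a0 b0 t0 ab ak bk; rewrite rdist_le ?ltr_wpDr //.
have -> : n + a - (n + b) = a - b by ring.
apply: (le_trans ab); rewrite [k * t]mulrC -mulrA ler_wpM2l //.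
by rewrite mulrDr lerD.
Qed.

Lemma le_ratio_mul a n X : 0 <= X -> a <= X * n -> a <= X / (1 + X) * (n + a).
Proof.
move=> X0 aXn; rewrite mulrAC ler_pdivlMr ?ltr_wpDr //.
by rewrite mulrDr mulrDr mulr1 [a * X]mulrC lerD2r.
Qed.

(** By the addition formula of tanh the distance of the products is at most
    2 t / (1 + t^2). *)
Lemma ratio_mul_compare a a' b b' t : 0 < a -> 0 < a' -> 0 < b -> 0 < b' -> t <= 1 ->
  rdist a a' <= t -> rdist b b' <= t ->
  `|a * b - a' * b'| <= 2 * t * (a * b + a' * b').
Proof.
move=> a0 a'0 b0 b'0 t1; rewrite !rdist_le // !ler_norml => /andP[h1 h2] /andP[h3 h4].
have sa : 0 < a + a' by rewrite addr_gt0.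
have sb : 0 < b + b' by rewrite addr_gt0.
pose u := (a - a') / (a + a'); pose v := (b - b') / (b + b').
have u1 : - t <= u <= t.
  by rewrite /u ler_pdivlMr // ler_pdivrMr // h2 andbT mulNr.
have v1 : - t <= v <= t.
  by rewrite /v ler_pdivlMr // ler_pdivrMr // h4 andbT mulNr.
have -> : a * b - a' * b' = (a + a') * (b + b') / 2 * (u + v).
  by rewrite /u /v; field; rewrite !gt_eqF.
have -> : a * b + a' * b' = (a + a') * (b + b') / 2 * (1 + u * v).
  by rewrite /u /v; field; rewrite !gt_eqF.
have p : 0 <= (a + a') * (b + b') / 2 by rewrite divr_ge0 // mulr_ge0 // ltW.
have main x y : - t <= x <= t -> - t <= y <= t -> x + y <= 2 * t * (1 + x * y).
  wlog xy : x y / x <= y.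
    by move=> W hx hy; case: (leP x y) => [/W|/ltW/W]; [|rewrite addrC [x * y]mulrC]; apply.
  move=> /andP[x1 x2] /andP[y1 y2]; have t0 : 0 <= t by lra.
  have [x0|x0] := leP 0 x.
    have : 0 <= t * (x * y) by rewrite !mulr_ge0 // (le_trans x0).
    by lra.
  have [y0|y0] := leP y 0.
    have : 0 <= t * (x * y) by rewrite mulr_ge0 // mulr_le0 // ltW.
    by lra.
  have ty : t * y <= 1 by rewrite mulr_ile1 ?(ltW y0) // (le_trans y2).
  have : 0 <= - x * (1 - t * y) by rewrite mulr_ge0 ?subr_ge0 // oppr_ge0 ltW.
  by lra.
rewrite -ler_norml normrM (ger0_norm p) mulrCA ler_wpM2l //.
rewrite ler_norml; apply/andP; split; last exact: main.
have uN : - t <= - u <= t by move: u1 => /andP[]; rewrite lerN2 lerNl => -> ->.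
have vN : - t <= - v <= t by move: v1 => /andP[]; rewrite lerN2 lerNl => -> ->.
by have := main _ _ uN vN; rewrite mulrNN; lra.
Qed.

End RatioDistance.

(** * Decay of correlations along self-avoiding paths *)

Section CorrelationDecay.
Variable G : sgraph.
Context {R : realType}.
Implicit Types (x y v : G) (e f : edge G) (U : {set G}) (c : edge G + G).
Implicit Types z : edge G + G -> R.
Local Open Scope set_scope.

(** The inverse of the Gibbs probability that x is unmatched in the subgraph
    induced on U, times exp (nu x). *)
Definition zratio z U x : R := Zin U z / Zin (U :\ x) z.

Lemma zratio_gt0 z U x : 0 < zratio z U x.
Proof. by rewrite divr_gt0 ?Zin_gt0. Qed.

Lemma zratio_rec z U x : x \in U -> zratio z U x =
  expR (z (inr x)) + \sum_(e in star U x) expR (z (inl e)) / zratio z (U :\ x) (opp e x).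
Proof.
move=> xU; have Z0 W : Zin W z != 0 by rewrite gt_eqF ?Zin_gt0.
rewrite {1}/zratio (Zin_rec _ xU) mulrDl mulfK //; congr (_ + _).
rewrite mulr_suml; apply: eq_bigr => e; rewrite inE => /andP[xe eU].
rewrite /zratio (setD_edge _ xe); field.
by rewrite !Z0.
Qed.

Lemma zratio_ge z U x : x \in U -> expR (z (inr x)) <= zratio z U x.
Proof.
move=> xU; rewrite zratio_rec // lerDl sumr_ge0 // => e _.
by rewrite divr_ge0 ?expR_ge0 // ltW ?zratio_gt0.
Qed.

Lemma coords_in_sub (U W : {set G}) c : U \subset W -> coords_in U c -> coords_in W c.
Proof.
move=> UW; case: c => [e|v] /=; first by move=> /fintype.subset_trans; apply.
exact: (fintype.subsetP UW).
Qed.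

Lemma near_opp k x e : e \in incident x -> near k (opp e x) \subset near k.+1 x.
Proof. by rewrite inE => /adj_opp; exact: nearS. Qed.

Lemma incident_near k x e : e \in incident x -> coords_in (near k.+1 x) (inl e).
Proof.
move=> ex; have := ex; rewrite inE /= -/(near k.+1 x) => /edge_opp ->.
apply/fintype.subsetP => v; rewrite !inE => /orP[/eqP->|/eqP->].
  by have := near_refl k.+1 x; rewrite /= !inE.
by have /fintype.subsetP/(_ _ (near_refl k _)) := near_opp k ex; rewrite /= !inE.
Qed.

Lemma prod_ege1 (J : finType) (A : pred J) (F : J -> R) :
  (forall j, A j -> 1 <= F j) -> 1 <= \prod_(j | A j) F j.
Proof. by move=> F1; elim/big_ind: _ => // x y x1 y1; exact: mulr_ege1. Qed.

Section Penalty.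
Variables (l eps : R) (m : nat).

(** An upper bound for the odds that x is matched, when the weights at x, at its
    edges and at its neighbours are at most l in absolute value. *)
Definition damping : R := (max_degree G)%:R * expR (3 * l).

Hypothesis eps_gt0 : 0 < eps.
Hypothesis eps_le1 : eps <= 1.
Hypothesis m_gt0 : (0 < m)%N.
Hypothesis theta_eps : (damping / (1 + damping)) ^+ m <= eps.

(** A weight larger than l spoils the contraction at the vertices next to it; the
    penalty compensates for the factor eps expected there. *)
Definition wpen (r : R) : R := if `|r| <= l then 1 else eps^-1.

Lemma wpen_ge1 r : 1 <= wpen r.
Proof. by rewrite /wpen; case: ifP => // _; rewrite invf_ge1. Qed.

Lemma wpen_gt0 r : 0 < wpen r.
Proof. exact: lt_le_trans ltr01 (wpen_ge1 r). Qed.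

Definition pen U x z : R :=
  wpen (z (inr x)) * \prod_(e in star U x) (wpen (z (inl e)) * wpen (z (inr (opp e x)))).

Lemma pen_gt0 U x z : 0 < pen U x z.
Proof.
by rewrite mulr_gt0 ?wpen_gt0 // prodr_gt0 // => e _; rewrite mulr_gt0 ?wpen_gt0.
Qed.

(** Sum over the self-avoiding paths of length k in U that start at x: the
    recursion leaves the visited vertices out of U. *)
Fixpoint path_sum k U x z : R :=
  if k is k'.+1 then
    eps * pen U x z * \sum_(e in star U x) path_sum k' (U :\ x) (opp e x) z
  else 1.

Lemma path_sum_ge0 k U x z : 0 <= path_sum k U x z.
Proof.
elim: k U x => [|k IH] U x /=; first exact: ler01.
apply: mulr_ge0; last by apply: sumr_ge0.
by apply: mulr_ge0; rewrite ltW // pen_gt0.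
Qed.

Lemma pen_dichotomy U x z :
  (`|z (inr x)| <= l /\
   forall e, e \in star U x -> `|z (inl e)| <= l /\ `|z (inr (opp e x))| <= l)
  \/ 1 <= eps * pen U x z.
Proof.
have [zx|zx] := boolP (`|z (inr x)| <= l); last first.
  right; rewrite /pen /wpen (negbTE zx) mulrA divff ?gt_eqF // mul1r.
  by apply: prod_ege1 => e _; rewrite mulr_ege1 ?wpen_ge1.
have [/forall_inP H|] := boolP [forall e in star U x, (`|z (inl e)| <= l) && (`|z (inr (opp e x))| <= l)].
  by left; split => // e /H/andP.
rewrite negb_forall_in => /exists_inP[e es ebad]; right.
rewrite /pen (bigD1 e) //=.
have h1 : 1 <= wpen (z (inr x)) by exact: wpen_ge1.
have h2 : 1 <= \prod_(i in star U x | i != e) (wpen (z (inl i)) * wpen (z (inr (opp i x)))).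
  by apply: prod_ege1 => i _; rewrite mulr_ege1 ?wpen_ge1.
have h3 : eps^-1 <= wpen (z (inl e)) * wpen (z (inr (opp e x))).
  move: ebad; rewrite negb_and => /orP[] /negbTE b.
    by rewrite {1}/wpen b ler_peMr ?wpen_ge1 // invr_ge0 ltW.
  by rewrite {2}/wpen b ler_peMl ?wpen_ge1 // invr_ge0 ltW.
rewrite mulrCA mulr_ege1 // mulrA mulr_ege1 //.
by rewrite -ler_pdivrMl // mulr1.
Qed.

Lemma damping_ge0 : 0 <= damping.
Proof. by rewrite mulr_ge0 ?expR_ge0. Qed.

Let sum_star_le z U x : x \in U -> `|z (inr x)| <= l ->
  (forall e, e \in star U x -> `|z (inl e)| <= l /\ `|z (inr (opp e x))| <= l) ->
  \sum_(e in star U x) expR (z (inl e)) / zratio z (U :\ x) (opp e x)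
  <= damping * expR (z (inr x)).
Proof.
move=> xU zx H.
apply: (@le_trans _ _ (\sum_(e in star U x) expR (2 * l))).
  apply: ler_sum => e es; have [ze zy] := H e es.
  rewrite ler_pdivrMr ?zratio_gt0 //.
  apply: (@le_trans _ _ (expR (2 * l) * expR (z (inr (opp e x))))); last first.
    by rewrite ler_pM2l ?expR_gt0 // zratio_ge // star_opp_in.
  rewrite -expRD ler_expR.
  by move: ze zy; rewrite !ler_norml => /andP[_ ?] /andP[? _]; lra.
rewrite sumr_const -[leLHS]mulr_natl /damping -mulrA.
apply: ler_pM; rewrite ?expR_ge0 ?ler_nat ?card_star //.
rewrite -expRD ler_expR.
by move: zx; rewrite !ler_norml => /andP[? _]; lra.
Qed.

(** At each step the m-th power of the distance is multiplied by at most eps times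
    the penalty at x: by [pen_dichotomy], either the surrounding weights are moderate
    and the contraction factor to the power m is at most eps, or this product is at
    least 1 and it suffices that the recursion does not increase the distance.  The
    worst neighbour is then bounded by the sum over all neighbours. *)
Lemma zratio_decay k U x z z' : x \in U ->
  (forall c, coords_in (near k x) c -> z c = z' c) ->
  rdist (zratio z U x) (zratio z' U x) ^+ m <= path_sum k U x z.
Proof.
elim: k U x => [|k IH] U x xU zz' /=.
  apply: exprn_ile1; first by rewrite rdist_ge0 ?zratio_gt0.
  by rewrite rdist_le1 ?zratio_gt0.
have zx : z (inr x) = z' (inr x) by apply: zz' => /=; exact: (near_refl k.+1).
have inc e : e \in star U x -> e \in incident x by exact: (fintype.subsetP (star_sub U x)).
have zy e : e \in star U x -> z (inr (opp e x)) = z' (inr (opp e x)).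
  move=> /inc xe; apply: zz' => /=; apply: (fintype.subsetP (near_opp k xe)).
  exact: near_refl.
have ze e : e \in star U x -> z (inl e) = z' (inl e).
  by move=> /inc xe; apply: zz'; exact: incident_near.
pose d e := rdist (zratio z (U :\ x) (opp e x)) (zratio z' (U :\ x) (opp e x)).
pose t := \big[Num.max/0]_(e in star U x) d e.
pose Q := \sum_(e in star U x) path_sum k (U :\ x) (opp e x) z.
have Q0 : 0 <= Q by apply: sumr_ge0 => e _; exact: path_sum_ge0.
have [t0 tQ] : 0 <= t /\ t ^+ m <= Q.
  rewrite /t; elim/big_ind: _ => [|a b [a0 aQ] [b0 bQ]|e es].
  - by split => //; rewrite expr0n gtn_eqF.
  - by rewrite /Num.max; case: ifP.
  - split; first by rewrite rdist_ge0 ?zratio_gt0.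
    apply: (@le_trans _ _ (path_sum k (U :\ x) (opp e x) z)).
      apply: IH; first exact: star_opp_in.
      by move=> c ck; apply: zz'; apply: coords_in_sub ck; exact: near_opp (inc _ es).
    by rewrite /Q (bigD1 e) //= lerDl sumr_ge0 // => i _; exact: path_sum_ge0.
set S := fun z => \sum_(e in star U x) expR (z (inl e)) / zratio z (U :\ x) (opp e x).
have S0 z0 : 0 <= S z0.
  by apply: sumr_ge0 => e _; rewrite divr_ge0 ?expR_ge0 // ltW ?zratio_gt0.
have SS : `|S z - S z'| <= t * (S z + S z').
  have -> : S z' = \sum_(e in star U x) expR (z (inl e)) / zratio z' (U :\ x) (opp e x).
    by apply: eq_bigr => e es; rewrite ze.
  apply: sum_div_compare => e es; split; rewrite ?expR_ge0 ?zratio_gt0 //.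
  exact: (le_bigmax_cond _ d).
have step kap : S z <= kap * (expR (z (inr x)) + S z) ->
    S z' <= kap * (expR (z (inr x)) + S z') -> kap ^+ m <= eps * pen U x z -> 0 <= kap ->
    rdist (zratio z U x) (zratio z' U x) ^+ m <= eps * pen U x z * Q.
  move=> h1 h2 h3 kap0; rewrite !zratio_rec // -zx -/(S z) -/(S z').
  apply: (@le_trans _ _ ((kap * t) ^+ m)).
    rewrite lerXn2r ?nnegrE ?rdist_ge0 ?mulr_ge0 ?ltr_wpDr ?expR_gt0 //.
    by apply: rdist_add_le => //; exact: expR_gt0.
  by rewrite exprMn ler_pM ?exprn_ge0.
have [[gx ge]|bad] := pen_dichotomy U x z.
  apply: (step (damping / (1 + damping))).
  - by apply: le_ratio_mul; [exact: damping_ge0|exact: sum_star_le].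
  - apply: le_ratio_mul; first exact: damping_ge0.
    rewrite zx; apply: sum_star_le => //; first by rewrite -zx.
    by move=> e es; rewrite -ze // -zy //; exact: ge.
  - apply: (le_trans theta_eps); rewrite ler_peMr ?(ltW eps_gt0) //.
    rewrite /pen mulr_ege1 ?wpen_ge1 //.
    by apply: prod_ege1 => e _; rewrite mulr_ege1 ?wpen_ge1.
  - by rewrite divr_ge0 ?addr_ge0 ?damping_ge0.
by apply: (step 1); rewrite ?mul1r ?lerDr ?expR_ge0 ?expr1n.
Qed.

Definition anchor c : G :=
  match c with inl e => xchoose (edge_anchor_ex e) | inr v => v end.

Lemma anchor_edge e : anchor (inl e) \in val e.
Proof. exact: (xchooseP (edge_anchor_ex e)). Qed.

Local Notation minus x := ([set: G] :\ x).

Definition lin_coef c z : R :=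
  match c with
  | inl e => Zin (minus (anchor (inl e)) :\ opp e (anchor (inl e))) z
  | inr v => Zin (minus v) z
  end.

Definition cst_coef c z : R :=
  match c with
  | inl e => let x := anchor (inl e) in
      expR (z (inr x)) * Zin (minus x) z
      + \sum_(f in incident x | f != e) expR (z (inl f)) * Zin (minus x :\ opp f x) z
  | inr v => \sum_(f in incident v) expR (z (inl f)) * Zin (minus v :\ opp f v) z
  end.

Lemma lin_coef_gt0 c z : 0 < lin_coef c z.
Proof. by case: c => [e|v]; exact: Zin_gt0. Qed.

Lemma cst_coef_ge0 c z : 0 <= cst_coef c z.
Proof.
have nn f U : 0 <= expR (z (inl f)) * Zin U z by rewrite mulr_ge0 ?expR_ge0 ?ltW ?Zin_gt0.
case: c => [e|v] /=; last by apply: sumr_ge0.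
by apply: addr_ge0; [rewrite mulr_ge0 ?expR_ge0 ?ltW ?Zin_gt0|apply: sumr_ge0].
Qed.

Let Zin_setT_rec x z : Zin [set: G] z = expR (z (inr x)) * Zin (minus x) z
  + \sum_(f in incident x) expR (z (inl f)) * Zin (minus x :\ opp f x) z.
Proof.
rewrite (@Zin_rec _ _ _ x) ?inE // star_setT; congr (_ + _).
by apply: eq_bigr => f; rewrite inE => xf; rewrite (setD_edge _ xf).
Qed.

(** A matching uses the edge c or not, and leaves the vertex c unmatched or not. *)
Lemma Zin_affine c z : Zin [set: G] z = cst_coef c z + expR (z c) * lin_coef c z.
Proof.
case: c => [e|v] /=; last by rewrite (Zin_setT_rec v) addrC.
rewrite (Zin_setT_rec (anchor (inl e))) (bigD1 e) /= ?inE ?anchor_edge //.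
by rewrite addrA addrAC.
Qed.

Lemma coef_eq c z z' : (forall c', c' != c -> z c' = z' c') ->
  cst_coef c z = cst_coef c z' /\ lin_coef c z = lin_coef c z'.
Proof.
case: c => [e|v] /= zz'.
  have ZE U : U \subset minus (anchor (inl e)) -> Zin U z = Zin U z'.
    move=> Ux; apply: Zin_local => c cU; apply: zz'; apply: contraTneq cU => -> /=.
    apply/negP => /fintype.subsetP/(_ _ (anchor_edge e))/(fintype.subsetP Ux).
    by rewrite !inE eqxx.
  split; last by rewrite ZE ?finset.subsetDl.
  congr (_ * _ + _); [by rewrite zz'|exact: ZE|].
  apply: eq_bigr => f /andP[_ fe]; congr (expR _ * _); last by rewrite ZE ?finset.subsetDl.
  by apply: zz'; apply: contra fe => /eqP[->].
have ZE U : U \subset minus v -> Zin U z = Zin U z'.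
  move=> Ux; apply: Zin_local => c cU; apply: zz'; apply: contraTneq cU => -> /=.
  by apply/negP => /(fintype.subsetP Ux); rewrite !inE eqxx.
split; last by rewrite ZE.
apply: eq_bigr => f _; congr (expR _ * _); last by rewrite ZE ?finset.subsetDl.
by apply: zz'.
Qed.

Lemma logZ_lipschitz c z z1 : (forall c', c' != c -> z c' = z1 c') ->
  `|logZ z - logZ z1| <= `|z c - z1 c|.
Proof.
move=> zz1; have [AE BE] := coef_eq zz1.
rewrite !logZE !(Zin_affine c) -AE -BE.
by apply: ln_affine_lipschitz; [exact: cst_coef_ge0|exact: lin_coef_gt0].
Qed.

Definition root_sum k x z : R :=
  \sum_(e in incident x) path_sum k (minus x) (opp e x) z.

Lemma root_sum_ge0 k x z : 0 <= root_sum k x z.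
Proof. by apply: sumr_ge0 => e _; exact: path_sum_ge0. Qed.

Let opp_minus x e : e \in incident x -> opp e x \in minus x.
Proof. by rewrite !inE => xe; rewrite opp_neq. Qed.

Let cst_coef_vertex v z : cst_coef (inr v) z
  = (\sum_(f in incident v) expR (z (inl f)) / zratio z (minus v) (opp f v)) * Zin (minus v) z.
Proof.
rewrite /= mulr_suml; apply: eq_bigr => f _; rewrite /zratio.
by field; rewrite !gt_eqF ?Zin_gt0.
Qed.

Let edge_ratio e x z : R := expR (z (inr x))
  + \sum_(f in incident x | f != e) expR (z (inl f)) / zratio z (minus x) (opp f x).

Let cst_coef_edge e z : cst_coef (inl e) z = edge_ratio e (anchor (inl e)) z
    * zratio z (minus (anchor (inl e))) (opp e (anchor (inl e))) * lin_coef (inl e) z.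
Proof.
rewrite /= /zratio /edge_ratio -mulrA divfK ?gt_eqF ?Zin_gt0 // mulrDl; congr (_ + _).
rewrite mulr_suml; apply: eq_bigr => f _; rewrite /zratio.
by field; rewrite !gt_eqF ?Zin_gt0.
Qed.

Let edge_ratio_gt0 e x z : 0 < edge_ratio e x z.
Proof.
rewrite ltr_wpDr ?expR_gt0 // sumr_ge0 // => f _.
by rewrite divr_ge0 ?expR_ge0 // ltW // zratio_gt0.
Qed.

(** For a vertex the quotient of the coefficients is the sum in the recursion at
    that vertex, so it inherits the decay.  For an edge it is the product of two
    such ratios, at the two ends of the edge, hence the factor 2. *)
Lemma coef_decay k c z z' :
  (forall c', coords_in (near k.+1 (anchor c)) c' -> z c' = z' c') ->
  exists t, [/\ 0 <= t, t <= 1, t ^+ m <= root_sum k (anchor c) z &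
    `|cst_coef c z * lin_coef c z' - cst_coef c z' * lin_coef c z|
    <= 2 * t * (cst_coef c z * lin_coef c z' + cst_coef c z' * lin_coef c z)].
Proof.
set x := anchor c => zz'.
pose d e := rdist (zratio z (minus x) (opp e x)) (zratio z' (minus x) (opp e x)).
pose t := \big[Num.max/0]_(e in incident x) d e.
have [t0 t1 tQ] : [/\ 0 <= t, t <= 1 & t ^+ m <= root_sum k x z].
  rewrite /t; elim/big_ind: _ => [|a b [a0 a1 aQ] [b0 b1 bQ]|e es].
  - by split => //; rewrite expr0n gtn_eqF // root_sum_ge0.
  - by rewrite /Num.max; case: ifP.
  - split; rewrite ?rdist_ge0 ?rdist_le1 ?zratio_gt0 //.
    apply: (@le_trans _ _ (path_sum k (minus x) (opp e x) z)).
      apply: zratio_decay; first exact: opp_minus.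
      by move=> c' ck; apply: zz'; apply: coords_in_sub ck; exact: near_opp.
    by rewrite /root_sum (bigD1 e) //= lerDl sumr_ge0 // => i _; exact: path_sum_ge0.
exists t; split => //.
have ze e : e \in incident x -> z (inl e) = z' (inl e).
  by move=> xe; apply: zz'; exact: incident_near.
have td e : e \in incident x ->
    rdist (zratio z (minus x) (opp e x)) (zratio z' (minus x) (opp e x)) <= t.
  by move=> xe; exact: (le_bigmax_cond _ d).
have xE : anchor c = x by [].
clearbody t; clear tQ d; clearbody x; case: c xE => [e|v] xE.
  have xe : e \in incident x by rewrite inE -xE anchor_edge.
  have zx : z (inr x) = z' (inr x) by apply: zz' => /=; exact: (near_refl k.+1).
  pose B := lin_coef (inl e) z; pose B' := lin_coef (inl e) z'.
  rewrite !cst_coef_edge xE -/B -/B'.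
  set s := edge_ratio e x z; set s' := edge_ratio e x z'.
  set r := zratio z _ _; set r' := zratio z' _ _.
  have BB : 0 <= B * B' by rewrite mulr_ge0 // ltW // lin_coef_gt0.
  have -> : s * r * B * B' - s' * r' * B' * B = B * B' * (s * r - s' * r') by ring.
  have -> : s * r * B * B' + s' * r' * B' * B = B * B' * (s * r + s' * r') by ring.
  rewrite normrM (ger0_norm BB) [leRHS]mulrCA ler_wpM2l //.
  apply: ratio_mul_compare; rewrite ?edge_ratio_gt0 ?zratio_gt0 //; last exact: td.
  rewrite /s /s' /edge_ratio -zx -[leRHS]mul1r.
  have nn z0 : 0 <= \sum_(f in incident x | f != e) expR (z0 (inl f)) / zratio z0 (minus x) (opp f x).
    by apply: sumr_ge0 => f _; rewrite divr_ge0 ?expR_ge0 // ltW ?zratio_gt0.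
  apply: rdist_add_le; rewrite ?expR_gt0 ?mul1r ?lerDr ?expR_ge0 //.
  rewrite [X in `|_ - X|](_ : _ = \sum_(f in incident x | f != e)
      expR (z (inl f)) / zratio z' (minus x) (opp f x)); last first.
    by apply: eq_bigr => f /andP[xf _]; rewrite ze.
  rewrite [X in t * (_ + X)](_ : _ = \sum_(f in incident x | f != e)
      expR (z (inl f)) / zratio z' (minus x) (opp f x)); last first.
    by apply: eq_bigr => f /andP[xf _]; rewrite ze.
  have setE F : \sum_(f in incident x | f != e) F f = \sum_(f in incident x :\ e) F f :> R.
    by apply: eq_bigl => f; rewrite !inE andbC.
  rewrite !setE; apply: sum_div_compare => f; rewrite finset.in_setD1 => /andP[_ xf].
  by split; rewrite ?expR_ge0 ?zratio_gt0 //; exact: td.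
rewrite !cst_coef_vertex (_ : v = x) //.
pose B := Zin (minus x) z; pose B' := Zin (minus x) z'; rewrite /= -/B -/B'.
have -> : \sum_(f in incident x) expR (z' (inl f)) / zratio z' (minus x) (opp f x)
    = \sum_(f in incident x) expR (z (inl f)) / zratio z' (minus x) (opp f x).
  by apply: eq_bigr => f xf; rewrite ze.
have := @sum_div_compare R _ (incident x) (fun f => expR (z (inl f)))
  (fun f => zratio z (minus x) (opp f x)) (fun f => zratio z' (minus x) (opp f x)) t.
set s := \sum_(f in _) _; set s' := \sum_(f in _) _ => H.
have BB : 0 <= B * B' by rewrite mulr_ge0 // ltW // Zin_gt0.
have -> : s * B * B' - s' * B' * B = B * B' * (s - s') by ring.
have -> : s * B * B' + s' * B' * B = B * B' * (s + s') by ring.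
rewrite normrM (ger0_norm BB) [leRHS]mulrCA ler_wpM2l //.
have ss0 : 0 <= s + s'.
  by rewrite addr_ge0 // sumr_ge0 // => f _; rewrite divr_ge0 ?expR_ge0 // ltW ?zratio_gt0.
apply: (le_trans (H _)); last by rewrite ler_wpM2r // ler_peMl //; lra.
by move=> f xf; split; rewrite ?expR_ge0 ?zratio_gt0 //; exact: td.
Qed.

(** The effect on logZ of changing the weight c depends on the other weights only
    through the quotient of the coefficients of exp (z c). *)
Lemma logZ_increment_decay k c z z1 z' z1' :
  (forall c', c' != c -> z c' = z1 c') -> (forall c', c' != c -> z' c' = z1' c') ->
  z c = z' c -> z1 c = z1' c ->
  (forall c', coords_in (near k.+1 (anchor c)) c' -> z c' = z' c') ->
  exists t, [/\ 0 <= t, t <= 1, t ^+ m <= root_sum k (anchor c) z &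
    `|(logZ z - logZ z1) - (logZ z' - logZ z1')| <= 2 * t * `|z c - z1 c|].
Proof.
move=> zz1 zz1' zc z1c zz'.
have [t [t0 t1 tm AB]] := coef_decay zz'.
exists t; split => //.
have [AE BE] := coef_eq zz1; have [AE' BE'] := coef_eq zz1'.
rewrite !logZE !(Zin_affine c) -AE -BE -AE' -BE' -zc -z1c.
apply: ln_affine_compare; rewrite ?cst_coef_ge0 ?lin_coef_gt0 //.
by rewrite mulr_ge0.
Qed.

(** The weights that bound from below the probability that e is in the matching:
    those at the ends of e, at the other edges there and at all neighbours. *)
Definition edge_surround e : {set edge G + G} :=
  let x := anchor (inl e) in let y := opp e x in
  [set inr x; inr y]
  :|: ([set (inl f : edge G + G) | f in (incident x :|: incident y) :\ e]
  :|: ([set (inr (opp f x) : edge G + G) | f in incident x]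
  :|: [set (inr (opp f y) : edge G + G) | f in incident y])).

Lemma notin_edge_surround e : inl e \notin edge_surround e.
Proof.
rewrite !finset.in_setU !negb_or; apply/andP; split; first by rewrite !inE.
apply/andP; split; [|apply/andP; split].
- by apply/imsetP => -[f]; rewrite !inE => /andP[/eqP fe _] [ef]; apply: fe.
- by apply/imsetP => -[].
- by apply/imsetP => -[].
Qed.

Lemma card_edge_surround e : (#|edge_surround e| <= 2 + 4 * max_degree G)%N.
Proof.
rewrite /edge_surround; set x := anchor _; set y := opp e x.
have cU (A B : {set edge G + G}) : (#|A :|: B| <= #|A| + #|B|)%N.
  by rewrite cardsU leq_subr.
apply: (leq_trans (cU _ _)); apply: leq_add; first by rewrite cards2; case: eqP.
apply: (leq_trans (cU _ _)).
have -> : (4 * max_degree G = 2 * max_degree G + 2 * max_degree G)%N by rewrite -mulnDl.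
apply: leq_add.
  apply: (leq_trans (leq_imset_card _ _)).
  apply: (leq_trans (subset_leq_card (finset.subsetDl _ _))).
  rewrite cardsU (leq_trans (leq_subr _ _)) // mul2n -addnn leq_add ?card_incident //.
apply: (leq_trans (cU _ _)); rewrite mul2n -addnn leq_add //.
  exact: leq_trans (leq_imset_card _ _) (card_incident _).
exact: leq_trans (leq_imset_card _ _) (card_incident _).
Qed.

Definition surround_bound : R :=
  (expR l + (max_degree G)%:R * expR (2 * l)) ^+ 2.

(** The quotient of the coefficients is a product of two sums of the form
    exp (nu x) + sum over the edges at x of exp (w f) / zratio, one at each end of e;
    moderate weights bound each of them by exp l + D exp (2 l). *)
Lemma edge_coef_ratio e z : (forall c, c \in edge_surround e -> `|z c| <= l) ->
  cst_coef (inl e) z <= surround_bound * lin_coef (inl e) z.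
Proof.
rewrite cst_coef_edge /edge_surround; set x := anchor _; set y := opp e x => H.
have ax f : f \in incident x -> f != e -> `|z (inl f)| <= l.
  move=> xf fe; apply: H; rewrite finset.in_setU; apply/orP; right.
  by rewrite finset.in_setU; apply/orP; left; apply: imset_f; rewrite finset.in_setD1 fe finset.in_setU xf.
have ay f : f \in incident y -> f != e -> `|z (inl f)| <= l.
  move=> xf fe; apply: H; rewrite finset.in_setU; apply/orP; right.
  by rewrite finset.in_setU; apply/orP; left; apply: imset_f; rewrite finset.in_setD1 fe finset.in_setU xf orbT.
have bx f : f \in incident x -> `|z (inr (opp f x))| <= l.
  by move=> xf; apply: H; rewrite !finset.in_setU; apply/orP; right; apply/orP; right;
    apply/orP; left; apply/imsetP; exists f.
have by_ f : f \in incident y -> `|z (inr (opp f y))| <= l.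
  by move=> xf; apply: H; rewrite !finset.in_setU; apply/orP; right; apply/orP; right;
    apply/orP; right; apply/imsetP; exists f.
have zx : `|z (inr x)| <= l by apply: H; rewrite !inE eqxx.
have zy : `|z (inr y)| <= l by apply: H; rewrite !inE eqxx orbT.
have xe : e \in incident x by rewrite inE anchor_edge.
have bound (u : G) (U : {set G}) (A : {set edge G}) : A \subset incident u ->
    (forall f, f \in A -> opp f u \in U) ->
    (forall f, f \in A -> `|z (inl f)| <= l) ->
    (forall f, f \in A -> `|z (inr (opp f u))| <= l) -> `|z (inr u)| <= l ->
    expR (z (inr u)) + \sum_(f in A) expR (z (inl f)) / zratio z U (opp f u)
    <= expR l + (max_degree G)%:R * expR (2 * l).
  move=> Au AU a1 a2 a3; apply: lerD.
    by rewrite ler_expR (le_trans (ler_norm _)).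
  apply: (@le_trans _ _ (\sum_(f in A) expR (2 * l))).
    apply: ler_sum => f fA; rewrite ler_pdivrMr ?zratio_gt0 //.
    apply: (@le_trans _ _ (expR (2 * l) * expR (z (inr (opp f u))))); last first.
      by rewrite ler_pM2l ?expR_gt0 // zratio_ge // AU.
    rewrite -expRD ler_expR.
    by move: (a1 f fA) (a2 f fA); rewrite !ler_norml => /andP[_ ?] /andP[? _]; lra.
  rewrite sumr_const -[leLHS]mulr_natl ler_wpM2r ?expR_ge0 // ler_nat.
  exact: leq_trans (subset_leq_card Au) (card_incident u).
rewrite ler_pM2r ?lin_coef_gt0 // /surround_bound expr2.
apply: ler_pM; rewrite ?(ltW (edge_ratio_gt0 _ _ _)) ?(ltW (zratio_gt0 _ _ _)) //.
  rewrite /edge_ratio; have -> : \sum_(f in incident x | f != e) expR (z (inl f)) / zratio z (minus x) (opp f x)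
      = \sum_(f in incident x :\ e) expR (z (inl f)) / zratio z (minus x) (opp f x).
    by apply: eq_bigl => f; rewrite finset.in_setD1 andbC.
  apply: bound => //; first exact: finset.subsetDl.
  - by move=> f; rewrite finset.in_setD1 => /andP[_ /opp_minus].
  - by move=> f; rewrite finset.in_setD1 => /andP[fe xf]; exact: ax.
  - by move=> f; rewrite finset.in_setD1 => /andP[fe xf]; exact: bx.
rewrite zratio_rec; last exact: opp_minus.
have sy : star (minus x) y \subset incident y by exact: star_sub.
apply: bound => //.
- by move=> f; exact: star_opp_in.
- move=> f fs; apply: ay; first exact: (fintype.subsetP sy).
  apply: contraTneq fs => ->; rewrite inE negb_and; apply/orP; right.
  by apply/negP => /fintype.subsetP/(_ x); rewrite !inE eqxx anchor_edge => /(_ isT).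
- by move=> f fs; apply: by_; exact: (fintype.subsetP sy).
Qed.

End Penalty.
End CorrelationDecay.

(** * The expected sum over self-avoiding paths *)

Section PathSumExpectation.
Variable G : sgraph.
Context {R : realType} {T : finType}.
Variables (p : edge G + G -> T -> R) (vl : T -> R).
Hypothesis p0 : forall i t, 0 <= p i t.
Hypothesis p1 : forall i, \sum_t p i t = 1.
Variables (l eps : R).
Hypothesis eps_gt0 : 0 < eps.
Hypothesis eps_le1 : eps <= 1.
Local Notation D := (max_degree G).
Hypothesis tail : forall i, \sum_(t | l < `|vl t|) p i t <= eps ^+ D.+1.
Implicit Types (x y v : G) (e f : edge G) (U : {set G}) (c : edge G + G).
Implicit Types a b : {ffun edge G + G -> T}.
Local Open Scope set_scope.

Definition weights a : edge G + G -> R := fun c => vl (a c).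

Local Notation wpen := (wpen l eps).
Local Notation path_sum := (@path_sum G R l eps).
Local Notation minus x := ([set: G] :\ x).

(** A vertex is involved in at most D + 1 penalty factors: its own and one for each
    of its edges.  The tail assumption makes the corresponding moment bounded. *)
Lemma moment_wpen i n : (n <= D.+1)%N -> \sum_t p i t * wpen (vl t) ^+ n <= 2.
Proof.
move=> nD; rewrite (bigID (fun t => l < `|vl t|)) /= -[2%R]/(1 + 1)%R.
apply: lerD.
  apply: (@le_trans _ _ ((\sum_(t | l < `|vl t|) p i t) * eps^-1 ^+ n)).
    rewrite mulr_suml; apply: ler_sum => t tl.
    by rewrite /wpen (lt_geF tl).
  have en : 0 < eps^-1 ^+ n by rewrite exprn_gt0 // invr_gt0.
  apply: (le_trans (_ : _ <= eps ^+ D.+1 * eps^-1 ^+ n)); first by rewrite ler_pM2r.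
  rewrite exprVn ler_pdivrMr ?exprn_gt0 // mul1r.
  by rewrite ler_wiXn2l // ltW.
rewrite -(p1 i) [leRHS](bigID (fun t => l < `|vl t|)) /= ler_wpDl ?sumr_ge0 //.
by apply: ler_sum => t; rewrite -leNgt /wpen => ->; rewrite expr1n mulr1.
Qed.

Lemma moment_prod_wpen (n : edge G + G -> nat) : (forall i, (n i <= D.+1)%N) ->
  Ex p (fun a => \prod_i wpen (weights a i) ^+ n i) <= 2 ^+ #|[set i | (0 < n i)%N]|.
Proof.
move=> nD; rewrite (Ex_prod p (fun i t => wpen (vl t) ^+ n i)).
rewrite -prodr_const [leRHS]big_mkcond /=; apply: ler_prod => i _; apply/andP; split.
  by apply: sumr_ge0 => t _; rewrite mulr_ge0 ?exprn_ge0 // ltW ?wpen_gt0.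
rewrite inE; case: ltnP => ni; first exact: moment_wpen.
move: ni; rewrite leqn0 => /eqP ->; under eq_bigr do rewrite expr0 mulr1.
by rewrite p1.
Qed.

Lemma path_sum_local k U x z z' : x \in U ->
  (forall c, coords_in U c -> z c = z' c) -> path_sum k U x z = path_sum k U x z'.
Proof.
elim: k U x => [//|k IH] U x xU zz' /=.
have eU e : e \in star U x -> coords_in U (inl e) by rewrite inE => /andP[].
have yU e : e \in star U x -> coords_in U (inr (opp e x)).
  by move/star_opp_in; rewrite finset.in_setD1 => /andP[].
congr (_ * _ * _).
  rewrite /pen; congr (wpen _ * _); first exact: zz'.
  by apply: eq_bigr => e es; rewrite (zz' _ (eU e es)) (zz' _ (yU e es)).
apply: eq_bigr => e es; apply: IH; first exact: star_opp_in.
by move=> c cU; apply: zz'; apply: coords_in_sub cU; exact: finset.subsetDl.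
Qed.

(** Number of edges at v that leave U.  In the course of the recursion each of them
    may have contributed a penalty for v. *)
Definition out_degree U v : nat := #|incident v :\: star U v|.

(** The penalties already paid for vertices that the path may still visit; they are
    what prevents the steps of a path from being independent. *)
Definition paid_penalty U (z : edge G + G -> R) : R := \prod_(v in U) wpen (z (inr v)) ^+ out_degree U v.

Definition boundary U : {set G} := [set v in U | (0 < out_degree U v)%N].

Lemma out_degree_le U v : (out_degree U v <= D)%N.
Proof.
exact: leq_trans (subset_leq_card (finset.subsetDl _ _)) (card_incident v).
Qed.

Lemma out_degree_minus U x v : x \in U -> v \in U :\ x ->
  out_degree (U :\ x) v = (out_degree U v + #|[set e in star U x | opp e x == v]|)%N.
Proof.
move=> xU; rewrite !inE => /andP[vx vU]; rewrite /out_degree.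
set A := incident v :\: star U v; set B := [set e in star U x | opp e x == v].
have AB : A :&: B = finset.set0.
  apply/setP => e; rewrite !inE; apply/negP => /andP[/andP[h1 h2] /andP[/andP[h3 h4] h5]].
  by rewrite h2 h4 in h1.
have -> : incident v :\: star (U :\ x) v = A :|: B.
  apply/setP => e; rewrite !inE finset.subsetD1.
  case: (boolP (v \in val e)) => [ve|vNe]; last first.
    rewrite !andbF orFb; symmetry; apply/negbTE/negP => /andP[/andP[xe _] /eqP ev].
    by move: vNe; rewrite -ev opp_in.
  rewrite !andTb !andbT; case: (boolP (val e \subset U)) => [eU|_]; last by rewrite !andFb.
  rewrite andTb andbT negbK; apply/idP/idP => [xe|/andP[]//].
  rewrite xe /=; have := ve; rewrite (edge_opp xe) !inE => /orP[/eqP vx'|/eqP -> //].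
  by rewrite vx' eqxx in vx.
by rewrite cardsU AB cards0 subn0.
Qed.

Lemma paid_penalty_minus U x z : x \in U ->
  paid_penalty (U :\ x) z =
  \prod_(e in star U x) wpen (z (inr (opp e x))) * \prod_(v in U :\ x) wpen (z (inr v)) ^+ out_degree U v.
Proof.
move=> xU; rewrite (partition_big (fun e : edge G => opp e x) (fun v => v \in U :\ x)) /=; last first.
  by move=> e; exact: star_opp_in.
rewrite -big_split /=; apply: eq_bigr => v vU.
rewrite (out_degree_minus xU vU) exprD mulrC; congr (_ * _).
rewrite (eq_bigr (fun=> wpen (z (inr v)))); last by move=> e /andP[_ /eqP ->].
rewrite -prodr_const; apply: eq_bigl => e; by rewrite [LHS]inE.
Qed.

Lemma boundary_minus U x : x \in U -> (#|boundary (U :\ x)| <= #|boundary U| + D)%N.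
Proof.
move=> xU; apply: (@leq_trans #|boundary U :|: [set opp e x | e in star U x]|).
  apply: subset_leq_card; apply/fintype.subsetP => v; rewrite inE => /andP[vU].
  rewrite (out_degree_minus xU vU) addn_gt0 => /orP[ov|].
    by move: vU; rewrite !inE ov => /andP[_ ->].
  move=> /card_gt0P[e]; rewrite inE => /andP[es /eqP ev].
  by rewrite finset.in_setU -ev; apply/orP; right; apply: imset_f.
rewrite cardsU (leq_trans (leq_subr _ _)) // leq_add2l.
exact: leq_trans (leq_imset_card _ _) (card_star U x).
Qed.

Definition growth_rate : R := eps * (2 ^+ (1 + 2 * D) * D%:R).

(** The penalties already paid are part of the induction hypothesis.  When x is
    removed from U, the penalties of x itself and of its edges split off as a factor
    independent of the rest, while those of its neighbours join
    [paid_penalty]. *)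
Lemma Ex_path_sum k U x : x \in U ->
  Ex p (fun a => path_sum k U x (weights a) * paid_penalty U (weights a))
  <= growth_rate ^+ k * 2 ^+ #|boundary U|.
Proof.
elim: k U x => [|k IH] U x xU.
  rewrite expr0 mul1r.
  pose n (i : edge G + G) := if i is inr v then if v \in U then out_degree U v else 0%N else 0%N.
  have nD i : (n i <= D.+1)%N.
    by case: i => [e|v] //=; case: ifP => // _; apply: leqW; exact: out_degree_le.
  have := moment_prod_wpen nD.
  rewrite (_ : #|_| = #|boundary U|); last first.
    rewrite -(card_imset _ (@inr_inj (edge G) G)); apply: eq_card => -[e|v].
      by rewrite !inE /=; symmetry; apply/imsetP => -[].
    rewrite inE mem_imset; last exact: inr_inj.
    by rewrite inE /n; case: ifP => //; rewrite ltnn.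
  apply: le_trans; rewrite le_eqVlt; apply/orP; left; apply/eqP; apply: eq_fexp => a /=.
  rewrite mul1r big_sumType /= big1 ?mul1r; last by move=> e _; rewrite expr0.
  rewrite /paid_penalty big_mkcond; apply: eq_bigr => v _.
  by case: ifP => // _; rewrite expr0.
(* The exponents of the factor that splits off: x occurs once by itself and
   once for each edge by which it was seen from outside U. *)
pose n (i : edge G + G) := match i with
  | inr v => if v == x then (out_degree U x).+1 else 0%N
  | inl e => (e \in star U x : nat) end.
have nD i : (n i <= D.+1)%N.
  by case: i => [e|v] /=; [case: (_ \in _)|case: ifP => // _; rewrite ltnS out_degree_le].
pose P a := \prod_i wpen (weights a i) ^+ n i.
have PE a : P a = wpen (weights a (inr x)) ^+ (out_degree U x).+1
                  * \prod_(e in star U x) wpen (weights a (inl e)).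
  rewrite /P big_sumType /= mulrC; congr (_ * _).
    rewrite (bigD1 x) //= eqxx big1 ?mulr1 // => v vx.
    by rewrite (negbTE vx) expr0.
  rewrite [RHS]big_mkcond; apply: eq_bigr => e _.
  by case: (e \in star U x); rewrite ?expr1 ?expr0.
have step a : path_sum k.+1 U x (weights a) * paid_penalty U (weights a)
    = \sum_(e in star U x) eps * (P a *
        (path_sum k (U :\ x) (opp e x) (weights a) * paid_penalty (U :\ x) (weights a))).
  rewrite /= mulrAC mulr_sumr; apply: eq_bigr => e _.
  rewrite PE (paid_penalty_minus _ xU) /pen /paid_penalty (big_setD1 x) //= big_split /= exprS.
  set P1 := \prod_(i in star U x) wpen (weights a (inl i)).
  set P2 := \prod_(i in star U x) wpen (weights a (inr (opp i x))).
  set P3 := \prod_(i in U :\ x) _; set w := wpen _; set q := path_sum _ _ _ _.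
  set wn := w ^+ _; clearbody P1 P2 P3 wn w q; ring.
have -> : Ex p (fun a => path_sum k.+1 U x (weights a) * paid_penalty U (weights a))
    = \sum_(e in star U x) eps * (Ex p P * Ex p (fun a =>
        path_sum k (U :\ x) (opp e x) (weights a) * paid_penalty (U :\ x) (weights a))).
  rewrite /Ex (eq_fexp _ step) fexp_sum; apply: eq_bigr => e es.
  rewrite fexpZ; congr (_ * _).
  apply: (@Ex_indep _ _ _ p p1 (inr x |: [set inl f | f in star U x])
    [set c | coords_in (U :\ x) c]).
  - move=> a b ab; rewrite !PE; congr (wpen _ ^+ _ * _).
      by rewrite /weights ab // !inE eqxx.
    apply: eq_bigr => f fs; rewrite /weights ab // finset.in_setU.
    by apply/orP; right; apply: imset_f.
  - move=> a b ab; congr (_ * _).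
      apply: path_sum_local; first exact: star_opp_in.
      by move=> c cU; rewrite /weights ab // inE.
    by apply: eq_bigr => v vU; rewrite /weights ab // inE.
  - apply/pred0P => c; rewrite /= !inE; apply/negP => /andP[/orP[/eqP->|/imsetP[f fs ->]] /=].
      by rewrite !inE eqxx.
    by move: fs; rewrite finset.subsetD1 inE => /andP[-> _]; rewrite andbF.
have P2 : Ex p P <= 2 ^+ D.+1.
  apply: (le_trans (moment_prod_wpen nD)); rewrite ler_weXn2l ?ler1n //.
  apply: (@leq_trans #|inr x |: [set (inl f : edge G + G) | f in star U x]|).
    apply: subset_leq_card; apply/fintype.subsetP => -[f|v]; rewrite !inE /=.
      by rewrite lt0b => fs; apply: imset_f.
    by have [->|//] := eqVneq v x; rewrite eqxx.
  rewrite cardsU1 (leq_trans (leq_add (leq_b1 _) (leq_imset_card _ _))) // add1n ltnS.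
  exact: card_star.
have P0 : 0 <= Ex p P.
  apply: fexp_ge0; first exact: cweight_ge0.
  by move=> a; apply: prodr_ge0 => i _; rewrite exprn_ge0 // ltW // wpen_gt0.
apply: (@le_trans _ _ (\sum_(e in star U x)
    eps * (2 ^+ D.+1 * (growth_rate ^+ k * 2 ^+ (#|boundary U| + D))))).
  apply: ler_sum => e es; rewrite ler_pM2l //.
  have E0 : 0 <= Ex p (fun a => path_sum k (U :\ x) (opp e x) (weights a) * paid_penalty (U :\ x) (weights a)).
    apply: fexp_ge0; first exact: cweight_ge0.
    move=> a; rewrite mulr_ge0 ?path_sum_ge0 //.
    by apply: prodr_ge0 => i _; rewrite exprn_ge0 // ltW // wpen_gt0.
  apply: ler_pM => //.
  apply: (le_trans (IH _ _ (star_opp_in es))).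
  rewrite ler_wpM2l ?exprn_ge0 ?mulr_ge0 ?exprn_ge0 ?(ltW eps_gt0) //.
  by rewrite ler_weXn2l ?ler1n ?boundary_minus.
rewrite sumr_const -[leLHS]mulr_natl.
have -> : growth_rate ^+ k.+1 * 2 ^+ #|boundary U|
   = D%:R * (eps * (2 ^+ D.+1 * (growth_rate ^+ k * 2 ^+ (#|boundary U| + D)))).
  rewrite exprS exprD /growth_rate (_ : 1 + 2 * D = D.+1 + D)%N ?exprD; last by lia.
  move: (2 ^+ D.+1 : R) (2 ^+ D : R) (D%:R : R) (2 ^+ #|boundary U| : R) => c1 c2 c3 c4.
  by move: ((eps * (c1 * c2 * c3)) ^+ k) => c5; ring.
rewrite ler_wpM2r ?ler_nat ?card_star // !mulr_ge0 ?exprn_ge0 ?mulr_ge0 ?exprn_ge0 ?(ltW eps_gt0) //.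
Qed.

Lemma Ex_root_sum k x :
  Ex p (fun a => root_sum l eps k x (weights a)) <= (D%:R * 2 ^+ D) * growth_rate ^+ k.
Proof.
rewrite /root_sum /Ex fexp_sum.
apply: (@le_trans _ _ (\sum_(e in incident x) growth_rate ^+ k * 2 ^+ D)); last first.
  rewrite sumr_const -[leLHS]mulr_natl -mulrA [2 ^+ D * _]mulrC.
  rewrite ler_wpM2r ?ler_nat ?card_incident //.
  by rewrite !mulr_ge0 ?exprn_ge0 ?mulr_ge0 ?exprn_ge0 ?(ltW eps_gt0).
apply: ler_sum => e xe.
have yx : opp e x \in minus x by move: xe; rewrite !inE => xe; rewrite opp_neq.
apply: (@le_trans _ _ (Ex p (fun a => path_sum k (minus x) (opp e x) (weights a)
    * paid_penalty (minus x) (weights a)))).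
  apply: le_fexp; first exact: cweight_ge0.
  move=> a; rewrite ler_peMr ?path_sum_ge0 //.
  by apply: prod_ege1 => v _; rewrite exprn_ege1 // wpen_ge1.
apply: (le_trans (Ex_path_sum _ yx)).
rewrite ler_wpM2l ?exprn_ge0 ?mulr_ge0 ?exprn_ge0 ?(ltW eps_gt0) //.
rewrite ler_weXn2l ?ler1n //.
apply: (leq_trans (boundary_minus (finset.in_setT x))).
rewrite (_ : boundary _ = finset.set0) ?cards0 //.
by apply/setP => v; rewrite !inE /out_degree star_setT finset.setDv cards0.
Qed.

Lemma root_sum_local k x z z' : (forall c, coords_in (minus x) c -> z c = z' c) ->
  root_sum l eps k x z = root_sum l eps k x z'.
Proof.
move=> zz'; apply: eq_bigr => e; rewrite inE => xe.
by apply: path_sum_local => //; rewrite !inE opp_neq.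
Qed.

End PathSumExpectation.

(** * Orthogonal projections and covariances *)

Section Projections.
Context {R : realType} {I T : finType}.
Variable p : I -> T -> R.
Hypothesis p0 : forall i t, 0 <= p i t.
Hypothesis p1 : forall i, \sum_t p i t = 1.
Local Notation config := {ffun I -> T}.
Implicit Types (a b : config) (i j : I) (f : config -> R).

Lemma Ex2_swap (f2 : config -> config -> R) : Ex2 p f2 = Ex2 p (fun b a => f2 a b).
Proof.
rewrite /Ex2 /Ex /fexp; under eq_bigr do rewrite mulr_sumr.
rewrite exchange_big; apply: eq_bigr => b _; rewrite mulr_sumr.
by apply: eq_bigr => a _; rewrite mulrCA.
Qed.

Lemma Ex2_coord i (psi : T -> T -> R) :
  Ex2 p (fun a b => psi (a i) (b i)) = \sum_s \sum_t p i s * p i t * psi s t.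
Proof.
rewrite /Ex2; transitivity (Ex p (fun a => \sum_t p i t * psi (a i) t)).
  by apply: eq_fexp => a; exact: (Ex_coord p1).
rewrite (Ex_coord p1 i (fun s => \sum_t p i t * psi s t)).
by apply: eq_bigr => s _; rewrite mulr_sumr; apply: eq_bigr => t _; rewrite mulrA.
Qed.

Lemma Ex2_sqr_diff (u : config -> R) : Ex p u = 0 ->
  Ex2 p (fun a b => (u a - u b) ^+ 2) = 2 * Ex p (fun a => u a ^+ 2).
Proof.
move=> u0.
transitivity (Ex2 p (fun a b => (u a ^+ 2 + u b ^+ 2) - 2 * (u a * u b))).
  by apply: eq_Ex2 => a b; ring.
rewrite Ex2B Ex2D Ex2Z Ex2_fst // Ex2_snd //.
have -> : Ex2 p (fun a b => u a * u b) = 0.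
  rewrite /Ex2 /Ex; transitivity (fexp (cweight p) (fun a => u a * Ex p u)).
    by apply: eq_fexp => a; rewrite fexpZ.
  by rewrite u0 fexpZr mulr0.
by rewrite mulr0 subr0 mulr_natl mulr2n.
Qed.

(** The conditional expectation of f - E f given the i-th coordinate. *)
Definition proj f i a : R := Ex p (fun b => f (mix [set i]%SET b a)) - Ex p f.

Lemma proj_depends f i : depends_on [set i]%SET (proj f i).
Proof.
move=> a b ab; rewrite /proj; congr (_ - _); apply: eq_fexp => c; congr f.
apply/ffunP => j; rewrite !ffunE; case: ifP => // ji; exact: ab.
Qed.

Lemma Ex_mul_proj f i (psi : config -> R) : depends_on [set i]%SET psi ->
  Ex p (fun a => f a * psi a) = Ex p (fun a => psi a * Ex p (fun b => f (mix [set i]%SET b a))).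
Proof.
move=> psii.
transitivity (Ex2 p (fun b a => f (mix [set i]%SET b a) * psi a)).
  rewrite -(Ex2_fst p1) -(Ex2_mix p [set i]%SET); apply: eq_Ex2 => b a; congr (_ * _).
  by apply: psii => j; rewrite ffunE => ->.
rewrite Ex2_swap; apply: eq_fexp => a; rewrite /Ex -fexpZ.
by apply: eq_fexp => b; rewrite mulrC.
Qed.

Lemma Ex_proj f i : Ex p (proj f i) = 0.
Proof.
rewrite /proj /Ex fexpB fexp_cst; last exact: sum_cweight.
have := Ex_mul_proj f (psi := fun=> 1) (fun (a b : config) (_ : agree [set i]%SET a b) => erefl).
rewrite /Ex; under eq_fexp do rewrite mulr1.
by under [in X in _ = X -> _]eq_fexp do rewrite mul1r; move=> <-; rewrite subrr.
Qed.

(** Bessel's inequality: projections on different coordinates are centred and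
    independent, hence orthogonal. *)
Lemma fvar_ge_sum_proj f (A : {set I}) :
  \sum_(i in A) Ex p (fun a => proj f i a ^+ 2) <= fvar (cweight p) f.
Proof.
set m := fexp (cweight p) f.
have c1 : \sum_a cweight p a = 1 by exact: sum_cweight.
have cross i j : Ex p (fun a => proj f i a * proj f j a)
    = if i == j then Ex p (fun a => proj f i a ^+ 2) else 0.
  case: eqVneq => [->|ij]; first by apply: eq_fexp => a; rewrite expr2.
  rewrite (Ex_indep p1 (proj_depends f (i := i)) (proj_depends f (i := j))).
    by rewrite Ex_proj mul0r.
  by rewrite disjoints1 inE.
have inner i : Ex p (fun a => (f a - m) * proj f i a) = Ex p (fun a => proj f i a ^+ 2).
  transitivity (Ex p (fun a => f a * proj f i a) - m * Ex p (proj f i)).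
    by rewrite /Ex -fexpZ -fexpB; apply: eq_fexp => a; rewrite mulrBl.
  rewrite (Ex_mul_proj f (proj_depends f (i := i))) Ex_proj mulr0 subr0.
  transitivity (Ex p (fun a => proj f i a ^+ 2 + m * proj f i a)).
    by apply: eq_fexp => a; rewrite /proj -[Ex p f]/m; ring.
  by rewrite /Ex fexpD fexpZ -/(Ex p (proj f i)) Ex_proj mulr0 addr0.
pose s a := \sum_(i in A) proj f i a.
have : 0 <= Ex p (fun a => ((f a - m) - s a) ^+ 2).
  by apply: fexp_ge0 => a; rewrite ?cweight_ge0 ?sqr_ge0.
have -> : Ex p (fun a => ((f a - m) - s a) ^+ 2) = fvar (cweight p) f
    - 2 * Ex p (fun a => (f a - m) * s a) + Ex p (fun a => s a ^+ 2).
  by rewrite /fvar -/m /Ex -fexpZ -fexpB -fexpD; apply: eq_fexp => a; ring.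
have -> : Ex p (fun a => (f a - m) * s a) = \sum_(i in A) Ex p (fun a => proj f i a ^+ 2).
  under eq_bigr do rewrite -inner.
  by rewrite -fexp_sum; apply: eq_fexp => a; rewrite /s mulr_sumr.
have -> : Ex p (fun a => s a ^+ 2) = \sum_(i in A) Ex p (fun a => proj f i a ^+ 2).
  transitivity (\sum_(i in A) \sum_(j in A) Ex p (fun a => proj f i a * proj f j a)).
    under eq_bigr do rewrite -fexp_sum.
    rewrite -fexp_sum; apply: eq_fexp => a; rewrite expr2 /s mulr_suml.
    by apply: eq_bigr => i _; rewrite mulr_sumr.
  apply: eq_bigr => i iA; rewrite (bigD1 i) //= cross eqxx big1 ?addr0 // => j /andP[_ ji].
  by rewrite cross eq_sym (negbTE ji).
by lra.
Qed.

Definition Ex2_cov (X Y : config -> config -> R) : R :=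
  Ex2 p (fun a b => X a b * Y a b) - Ex2 p X * Ex2 p Y.

Lemma Ex2_cov_le X Y q N : 0 < q -> 0 <= N ->
  Ex2 p (fun a b => X a b ^+ 2) <= q ^+ 2 * N -> Ex2 p (fun a b => Y a b ^+ 2) <= N ->
  `|Ex2_cov X Y| <= 2 * q * N.
Proof.
move=> q0 N0 XN YN; apply: (le_trans (ler_normB _ _)).
have h1 := Ex2_mul_le p0 q0 XN YN.
have h2 : `|Ex2 p X * Ex2 p Y| <= q * N.
  rewrite -ler_sqr ?nnegrE ?mulr_ge0 ?(ltW q0) // real_normK ?num_real // exprMn.
  have -> : (q * N) ^+ 2 = q ^+ 2 * N * N by ring.
  apply: ler_pM; rewrite ?sqr_ge0 //.
    by apply: le_trans XN; exact: Ex2_sqr_le.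
  by apply: le_trans YN; exact: Ex2_sqr_le.
by lra.
Qed.

(** If X' and Y' are uncorrelated, the covariance of X and Y comes from the errors
    X - X' and Y - Y' only. *)
Lemma Ex2_cov_split X Y X' Y' :
  Ex2 p (fun a b => X' a b * Y' a b) = Ex2 p X' * Ex2 p Y' ->
  Ex2_cov X Y = Ex2_cov (fun a b => X a b - X' a b) Y + Ex2_cov (fun a b => Y a b - Y' a b) X'.
Proof.
move=> XY; rewrite /Ex2_cov.
have -> : Ex2 p (fun a b => (X a b - X' a b) * Y a b)
    = Ex2 p (fun a b => X a b * Y a b) - Ex2 p (fun a b => X' a b * Y a b).
  by rewrite -Ex2B; apply: eq_Ex2 => a b; rewrite mulrBl.
have -> : Ex2 p (fun a b => (Y a b - Y' a b) * X' a b)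
    = Ex2 p (fun a b => X' a b * Y a b) - Ex2 p (fun a b => X' a b * Y' a b).
  by rewrite -Ex2B; apply: eq_Ex2 => a b; rewrite mulrC mulrBr.
by rewrite XY !Ex2B; ring.
Qed.

End Projections.

(** * Lower bound on the variance of the free energy *)

Section VarianceLowerBound.
Variable G : sgraph.
Context {R : realType} {T : finType}.
Variables (p : edge G + G -> T -> R) (vl : T -> R).
Hypothesis p0 : forall i t, 0 <= p i t.
Hypothesis p1 : forall i, \sum_t p i t = 1.
Variables (K1 K2 l : R).
Hypothesis K2_gt0 : 0 < K2.
Hypothesis l_gt0 : 0 < l.
Hypothesis second_moment : forall i, \sum_t p i t * vl t ^+ 2 <= K1.
Hypothesis abs_diff : forall e : edge G,
  K2 <= \sum_s \sum_t p (inl e) s * p (inl e) t * `|vl s - vl t|.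
Local Notation D := (max_degree G).
Hypothesis l_large1 : (2 + 4 * D)%:R * K1 <= l ^+ 2 / 2.
Hypothesis l_large2 : 8 * K1 <= K2 * l.
Implicit Types a b : {ffun edge G + G -> T}.

Definition logZ_of a : R := logZ (weights vl a).

Let delta : R := (1 + surround_bound G l * expR l)^-1.

Let delta_gt0 : 0 < delta.
Proof. by rewrite invr_gt0 ltr_wpDr // mulr_ge0 ?expR_ge0 // sqr_ge0. Qed.

Let good e a : bool := [forall c in edge_surround e, `|vl (a c)| <= l].

Lemma markov_weight i : \sum_(t | l < `|vl t|) p i t <= K1 / l ^+ 2.
Proof.
rewrite ler_pdivlMr ?exprn_gt0 // mulr_suml (le_trans _ (second_moment i)) //.
rewrite [leRHS](bigID (fun t => l < `|vl t|)) /= ler_wpDr ?sumr_ge0 //.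
  by move=> t _; rewrite mulr_ge0 // sqr_ge0.
apply: ler_sum => t lt; rewrite ler_wpM2l // -[vl t ^+ 2]real_normK ?num_real //.
by rewrite lerXn2r ?nnegrE ?(ltW l_gt0) // ltW.
Qed.

Let prob_good e : 2^-1 <= Ex p (fun a => (good e a)%:R).
Proof.
have : 1 - \sum_(c in edge_surround e) Ex p (fun a => (l < `|vl (a c)|)%R%:R)
    <= Ex p (fun a => (good e a)%:R).
  rewrite lerBlDr -[leLHS](fexp_cst (sum_cweight p1)).
  have -> : \sum_(c in edge_surround e) Ex p (fun a => (l < `|vl (a c)|)%R%:R) =
      Ex p (fun a => \sum_(c in edge_surround e) (l < `|vl (a c)|)%R%:R).
    by rewrite /Ex fexp_sum.
  rewrite /Ex -fexpD; apply: le_fexp => [a|a]; first exact: cweight_ge0.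
  rewrite /good; case: forall_inP => [_|/forall_inP].
    by rewrite lerDl sumr_ge0.
  rewrite negb_forall_in => /exists_inP[c cs]; rewrite -ltNge => cl.
  by rewrite add0r (bigD1 c) //= cl lerDl sumr_ge0.
apply: le_trans; rewrite lerBrDr.
apply: (@le_trans _ _ (2^-1 + \sum_(c in edge_surround e) K1 / l ^+ 2)).
  rewrite lerD2l; apply: ler_sum => c _; rewrite (Ex_coord p1 c (fun t => (l < `|vl t|)%R%:R)).
  apply: le_trans (markov_weight c); rewrite [leRHS]big_mkcond; apply: ler_sum => t _.
  by case: ifP; rewrite ?mulr1 ?mulr0.
rewrite sumr_const -[X in _ + X]mulr_natl mulrA.
have K1_ge0 : 0 <= K1.
  by apply: le_trans (second_moment (inl e)); apply: sumr_ge0 => t _; rewrite mulr_ge0 ?sqr_ge0.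
have : (#|edge_surround e|%:R * K1) / l ^+ 2 <= 2^-1.
  rewrite ler_pdivrMr ?exprn_gt0 // [leRHS]mulrC; apply: le_trans l_large1.
  by rewrite ler_wpM2r // ler_nat card_edge_surround.
by lra.
Qed.

Let mix1_off e a b c : c != inl e -> (mix [set (inl e : edge G + G)]%SET a b) c = a c.
Proof. by move=> ce; rewrite ffunE inE (negbTE ce). Qed.

Let mix1_on e a b : (mix [set (inl e : edge G + G)]%SET a b) (inl e) = b (inl e).
Proof. by rewrite ffunE inE eqxx. Qed.

(** The derivative of logZ in the weight of an edge is the Gibbs probability that
    the edge is used, bounded below through [edge_coef_ratio]. *)
Let logZ_edge e (c a b : {ffun edge G + G -> T}) : vl (b (inl e)) <= vl (a (inl e)) ->
  0 <= logZ_of (mix [set inl e]%SET c a) - logZ_of (mix [set inl e]%SET c b) /\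
  (good e c -> - l <= vl (b (inl e)) ->
   delta * (vl (a (inl e)) - vl (b (inl e)))
   <= logZ_of (mix [set inl e]%SET c a) - logZ_of (mix [set inl e]%SET c b)).
Proof.
move=> ba; rewrite /logZ_of !logZE !(Zin_affine (inl e)).
have offE (u v : {ffun edge G + G -> T}) (c' : edge G + G) : c' != inl e ->
    weights vl (mix [set inl e]%SET c u) c' = weights vl (mix [set inl e]%SET c v) c'.
  by move=> c'e; rewrite /weights !mix1_off.
have [-> ->] := coef_eq (offE a b); rewrite /weights !mix1_on.
set A := cst_coef _ _; set B := lin_coef _ _.
have A0 : 0 <= A by exact: cst_coef_ge0.
have B0 : 0 < B by exact: lin_coef_gt0.
split.
  have AB0 : 0 <= A / B by rewrite divr_ge0 // ltW.
  apply: le_trans (ln_affine_lower (M := A / B) (l := - vl (b (inl e))) A0 B0 _ _ ba).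
  - by rewrite divr_ge0 ?subr_ge0 // addr_ge0 // mulr_ge0 ?expR_ge0.
  - by rewrite divfK // gt_eqF.
  - by rewrite opprK.
move=> /forall_inP gc lb; rewrite /delta mulrC.
apply: ln_affine_lower => //; apply: edge_coef_ratio => c' c's.
have c'e : c' != inl e by apply: contraTneq c's => ->; exact: notin_edge_surround.
by rewrite mix1_off // gc.
Qed.

(** Removing the values larger than l from |x - y| costs only second moments
    divided by l. *)
Let trunc_diff (x y : R) :
  `|x - y| - 2 * (x ^+ 2 + y ^+ 2) / l <= `|x - y| * ((`|x| <= l) && (`|y| <= l))%:R.
Proof.
have P : 0 <= 2 * (x ^+ 2 + y ^+ 2) / l.
  by rewrite divr_ge0 ?(ltW l_gt0) // mulr_ge0 // addr_ge0 ?sqr_ge0.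
case: (boolP (_ && _)) => [_|]; first by rewrite mulr1 gerBl.
rewrite mulr0 subr_le0 ler_pdivlMr // negb_and -!ltNge => h.
have n1 := normr_ge0 x; have n2 := normr_ge0 y.
have ml : l <= `|x| + `|y| by case/orP: h => /ltW h; lra.
apply: (@le_trans _ _ ((`|x| + `|y|) * (`|x| + `|y|))).
  by apply: ler_pM => //; [exact: ltW|exact: ler_normB].
rewrite -[x ^+ 2]real_normK ?num_real // -[y ^+ 2]real_normK ?num_real //.
by have := sqr_ge0 (`|x| - `|y|); lra.
Qed.

Let proj_diff e a b : delta / 2 * (`|vl (a (inl e)) - vl (b (inl e))|
    * ((`|vl (a (inl e))| <= l) && (`|vl (b (inl e))| <= l))%:R)
  <= `|proj p logZ_of (inl e) a - proj p logZ_of (inl e) b|.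
Proof.
wlog ba : a b / vl (b (inl e)) <= vl (a (inl e)).
  move=> W; case: (leP (vl (b (inl e))) (vl (a (inl e)))) => [|/ltW] /W //.
  by rewrite distrC andbC [leRHS]distrC.
have -> : proj p logZ_of (inl e) a - proj p logZ_of (inl e) b = Ex p (fun c =>
    logZ_of (mix [set inl e]%SET c a) - logZ_of (mix [set inl e]%SET c b)).
  by rewrite /proj /Ex fexpB; ring.
rewrite [leRHS]ger0_norm; last first.
  by apply: fexp_ge0 => [c|c]; [exact: cweight_ge0|have [] := logZ_edge c ba].
rewrite ger0_norm ?subr_ge0 //.
case: (boolP (_ && _)) => [/andP[al bl]|_]; last first.
  rewrite !mulr0; apply: fexp_ge0 => [c|c]; first exact: cweight_ge0.
  by have [] := logZ_edge c ba.
rewrite mulr1 mulrAC.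
apply: (@le_trans _ _ (Ex p (fun c => (delta * (vl (a (inl e)) - vl (b (inl e)))) * (good e c)%:R))).
  by rewrite /Ex fexpZ ler_wpM2l ?prob_good // mulr_ge0 ?subr_ge0 // ltW.
apply: le_fexp => c; first exact: cweight_ge0.
have [h1 h2] := logZ_edge c ba.
case: (boolP (good e c)) => gc; last by rewrite mulr0.
by rewrite mulr1; apply: h2 => //; move: bl; rewrite ler_norml => /andP[].
Qed.

Definition variance_rate : R := (delta * K2 / 4) ^+ 2 / 2.

(** The projection on the weight of e is a function of that weight which separates
    two values x and y at most l in absolute value by at least delta |x - y| / 2, since
    the surrounding weights are moderate with probability at least 1/2.  Its variance
    is half the mean square of its increments. *)
Lemma variance_lower : #|edge G|%:R * variance_rate <= fvar (cweight p) logZ_of.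
Proof.
apply: le_trans (fvar_ge_sum_proj p0 p1 logZ_of [set (inl e : edge G + G) | e in [set: edge G]]%SET).
rewrite big_imset /=; last by move=> e f _ _ [].
rewrite mulr_natl -sumr_const (eq_bigl predT) /=; last by move=> e; rewrite inE.
rewrite [leLHS](eq_bigl predT) //.
apply: ler_sum => e _.
rewrite /variance_rate ler_pdivrMr // [leRHS]mulrC.
rewrite -(Ex2_sqr_diff p1 (u := proj p logZ_of (inl e))) ?Ex_proj //.
set X := fun a b => proj p logZ_of (inl e) a - proj p logZ_of (inl e) b.
apply: (@le_trans _ _ ((Ex2 p (fun a b => `|X a b|)) ^+ 2)); last first.
  apply: (le_trans (Ex2_sqr_le p0 p1 _)); apply: le_Ex2 => // a b.
  by rewrite real_normK ?num_real.
rewrite lerXn2r ?nnegrE //.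
- by rewrite divr_ge0 // mulr_ge0 // ltW.
- by apply: Ex2_ge0.
apply: (@le_trans _ _ (Ex2 p (fun a b => delta / 2 * (`|vl (a (inl e)) - vl (b (inl e))|
    - 2 * (vl (a (inl e)) ^+ 2 + vl (b (inl e)) ^+ 2) / l)))); last first.
  apply: le_Ex2 => // a b; apply: le_trans (proj_diff e a b).
  by rewrite ler_wpM2l ?divr_ge0 ?(ltW delta_gt0) // trunc_diff.
rewrite Ex2Z Ex2B.
have m2 : Ex p (fun a => vl (a (inl e)) ^+ 2) <= K1.
  by rewrite (Ex_coord p1 (inl e) (fun t => vl t ^+ 2)).
have -> : Ex2 p (fun a b => 2 * (vl (a (inl e)) ^+ 2 + vl (b (inl e)) ^+ 2) / l)
    = 4 / l * Ex p (fun a => vl (a (inl e)) ^+ 2).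
  transitivity (Ex2 p (fun a b => 2 / l * (vl (a (inl e)) ^+ 2 + vl (b (inl e)) ^+ 2))).
    by apply: eq_Ex2 => a b; rewrite mulrAC.
  rewrite Ex2Z Ex2D (Ex2_fst p1 (fun a => vl (a (inl e)) ^+ 2)).
  by rewrite (Ex2_snd p1 (fun a => vl (a (inl e)) ^+ 2)); ring.
have h1 : K2 <= Ex2 p (fun a b => `|vl (a (inl e)) - vl (b (inl e))|).
  by rewrite (Ex2_coord p1 (inl e) (fun s t => `|vl s - vl t|)).
have h2 : 4 / l * Ex p (fun a => vl (a (inl e)) ^+ 2) <= K2 / 2.
  apply: (@le_trans _ _ (4 / l * K1)); first by rewrite ler_wpM2l // divr_ge0 // ltW.
  by rewrite mulrAC ler_pdivrMr //; move: l_large2; lra.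
have -> : delta * K2 / 4 = delta / 2 * (K2 / 2) by field.
rewrite ler_wpM2l ?divr_ge0 ?(ltW delta_gt0) //.
by move: h1 h2; lra.
Qed.

End VarianceLowerBound.

(** * Concentration of the carre du champ *)

Section CarreDuChampVariance.
Variable G : sgraph.
Context {R : realType} {T : finType}.
Variables (p : edge G + G -> T -> R) (vl : T -> R) (t0 : T).
Hypothesis p0 : forall i t, 0 <= p i t.
Hypothesis p1 : forall i, \sum_t p i t = 1.
Variables (l eps M4 : R) (m : nat).
Hypothesis eps_gt0 : 0 < eps.
Hypothesis eps_le1 : eps <= 1.
Hypothesis m_gt0 : (0 < m)%N.
Local Notation D := (max_degree G).
Hypothesis tail : forall i, \sum_(t | l < `|vl t|) p i t <= eps ^+ D.+1.
Hypothesis theta_eps : (damping G l / (1 + damping G l)) ^+ m <= eps.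
Hypothesis fourth_moment : forall i, \sum_t p i t * vl t ^+ 4 <= M4.
Implicit Types a b : {ffun edge G + G -> T}.
Implicit Types i j c : edge G + G.

Local Notation F := (logZ_of vl).
Local Notation Ti := (increment_product F).
Local Notation minus x := ([set: G]%SET :\ x).

Let dv i a b : R := `|vl (a i) - vl (b i)|.

Let dif_le i a b : `|dif F i a b| <= dv i a b.
Proof.
rewrite /dif /logZ_of; set b' := mix _ _ _.
have := @logZ_lipschitz G R i (weights vl a) (weights vl b').
have -> : weights vl b' i = vl (b i) by rewrite /weights /b' ffunE inE eqxx.
apply => c ci; by rewrite /weights /b' ffunE inE (negbTE ci).
Qed.

Let dv_mix i a b : dv i (mix (preds i) a b) b = dv i a b.
Proof. by rewrite /dv ffunE (negbTE (notin_preds i)). Qed.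

Let Ti_le i a b : `|Ti i a b| <= dv i a b ^+ 2.
Proof.
have h1 := dif_le i a b; have h2 := dif_le i (mix (preds i) a b) b.
by rewrite dv_mix in h2; rewrite /increment_product normrM [leRHS]expr2; exact: ler_pM.
Qed.

Lemma third_increment i a b :
  dif F i a b ^+ 2 * `|dif F i (mix (preds i) a b) b| <= `|vl (a i) - vl (b i)| ^+ 3.
Proof.
have h1 := dif_le i a b; have h2 := dif_le i (mix (preds i) a b) b.
rewrite dv_mix in h2; rewrite [leRHS]exprSr; apply: ler_pM => //; first exact: sqr_ge0.
by rewrite -[dif F i a b ^+ 2]real_normK ?num_real // lerXn2r ?nnegrE // /dv.
Qed.

Let M : R := 16 * M4.

Let dv4 i : Ex2 p (fun a b => dv i a b ^+ 4) <= M.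
Proof.
rewrite (Ex2_coord p1 i (fun s t => `|vl s - vl t| ^+ 4)).
apply: (@le_trans _ _ (\sum_s \sum_t p i s * p i t * (8 * vl s ^+ 4 + 8 * vl t ^+ 4))).
  apply: ler_sum => s _; apply: ler_sum => t _; rewrite ler_wpM2l ?mulr_ge0 //.
  rewrite (_ : `|_| ^+ 4 = (vl s - vl t) ^+ 4); last by rewrite -normrX ger0_norm // exprn_even_ge0.
  have h : (vl s - vl t) ^+ 4 <= (2 * (vl s ^+ 2 + vl t ^+ 2)) ^+ 2.
    rewrite -[4%N]/(2 * 2)%N exprM lerXn2r ?nnegrE ?sqr_ge0 ?mulr_ge0 ?addr_ge0 ?sqr_ge0 //.
    by have := sqr_ge0 (vl s + vl t); lra.
  apply: (le_trans h).
  by have := sqr_ge0 (vl s ^+ 2 - vl t ^+ 2); lra.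
rewrite -(Ex2_coord p1 i (fun s t => 8 * vl s ^+ 4 + 8 * vl t ^+ 4)).
rewrite Ex2D !Ex2Z (Ex2_fst p1 (fun a => vl (a i) ^+ 4)) (Ex2_snd p1 (fun a => vl (a i) ^+ 4)).
by rewrite (Ex_coord p1 i (fun t => vl t ^+ 4)) /M; have := fourth_moment i; lra.
Qed.

Let M_ge0 : 0 <= M \/ forall i : edge G + G, False.
Proof.
have [i _|none] := pickP (fun _ : edge G + G => true).
  by left; apply: le_trans (dv4 i); apply: Ex2_ge0 => // a b; rewrite exprn_ge0 /dv.
by right => i; have := none i.
Qed.

Let Ti_sqr i : Ex2 p (fun a b => Ti i a b ^+ 2) <= M.
Proof.
apply: le_trans (dv4 i); apply: le_Ex2 => // a b.
rewrite -[Ti i a b ^+ 2]real_normK ?num_real //.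
by rewrite -[4%N]/(2 * 2)%N exprM lerXn2r ?nnegrE ?exprn_ge0 ?Ti_le // /dv.
Qed.

Section Radius.
Variable k : nat.

Definition window i : {set edge G + G} := [set c | coords_in (near k.+1 (anchor i)) c]%SET.

Lemma in_window i : i \in window i.
Proof.
rewrite inE; case: i => [e|v] /=; last exact: (near_refl k.+1).
by apply: (@incident_near G k); rewrite inE anchor_edge.
Qed.

Definition freeze i a : {ffun edge G + G -> T} := [ffun c => if c \in window i then a c else t0].

Lemma freeze_mix i J a b : mix J (freeze i a) (freeze i b) = freeze i (mix J a b).
Proof. by apply/ffunP => c; rewrite !ffunE; case: (c \in J); case: (c \in window i). Qed.

(** The product of increments computed with all weights outside the window frozen
    at an arbitrary value, a local approximation. *)
Definition local_product i a b : R := Ti i (freeze i a) (freeze i b).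

Lemma local_product_depends i : depends_on2 (window i) (local_product i).
Proof.
move=> a a' b b' aa' bb'; rewrite /local_product; congr (Ti i _ _);
  by apply/ffunP => c; rewrite !ffunE; case: ifP => // cw; rewrite ?aa' ?bb'.
Qed.

Let dv_freeze i a b : dv i (freeze i a) (freeze i b) = dv i a b.
Proof. by rewrite /dv !ffunE in_window. Qed.

Let local_sqr i : Ex2 p (fun a b => local_product i a b ^+ 2) <= M.
Proof.
apply: le_trans (dv4 i); apply: le_Ex2 => // a b.
rewrite -[local_product i a b ^+ 2]real_normK ?num_real //.
rewrite -[4%N]/(2 * 2)%N exprM lerXn2r ?nnegrE ?exprn_ge0 //; first by rewrite /dv.
by rewrite -(dv_freeze i a b) Ti_le.
Qed.

Variable lam : R.
Hypothesis lam_gt0 : 0 < lam.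

(** A bound for the squares of the errors: the distance t at the anchor is either at
    most lam, or its m-th power is at least lam^m and Markov's inequality applies. *)
Let tau i a : R := lam ^+ 2 + (lam ^+ m)^-1 * root_sum l eps k (anchor i) (weights vl a).

Let tau_ge0 i a : 0 <= tau i a.
Proof.
rewrite addr_ge0 ?sqr_ge0 // mulr_ge0 ?root_sum_ge0 //.
by rewrite invr_ge0 exprn_ge0 // ltW.
Qed.

Let dif_freeze i a b : exists t, [/\ 0 <= t, t ^+ 2 <= tau i a &
  `|dif F i a b - dif F i (freeze i a) (freeze i b)| <= 2 * t * dv i a b].
Proof.
rewrite /dif freeze_mix.
have [] := @logZ_increment_decay G R l eps m eps_gt0 eps_le1 m_gt0 theta_eps k i
  (weights vl a) (weights vl (mix [set i]%SET a b))
  (weights vl (freeze i a)) (weights vl (freeze i (mix [set i]%SET a b))).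
- by move=> c ci; rewrite /weights !ffunE inE (negbTE ci).
- by move=> c ci; rewrite /weights !ffunE inE (negbTE ci).
- by rewrite /weights !ffunE in_window.
- by rewrite /weights !ffunE in_window inE eqxx.
- by move=> c cw; rewrite /weights ffunE inE cw.
move=> t [tt0 t1 tm td]; exists t; split => //.
  have lm : 0 < lam ^+ m by rewrite exprn_gt0.
  have rs := @root_sum_ge0 G R l eps eps_gt0 eps_le1 k (anchor i) (weights vl a).
  have [tl|lt] := leP t lam.
    rewrite /tau (@le_trans _ _ (lam ^+ 2)) ?lerXn2r ?nnegrE // ?(ltW lam_gt0) //.
    by rewrite lerDl mulr_ge0 ?invr_ge0 // ltW.
  apply: (@le_trans _ _ 1); first by rewrite expr_le1.
  rewrite /tau ler_wpDl ?sqr_ge0 // ler_pdivlMl // mulr1.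
  by apply: le_trans tm; rewrite lerXn2r ?nnegrE // ltW.
by apply: (le_trans td); rewrite /weights /dv !ffunE inE eqxx.
Qed.

Definition decay_bound : R :=
  lam ^+ 2 + (lam ^+ m)^-1 * ((D%:R * 2 ^+ D) * growth_rate G eps ^+ k).

Let Ex_tau i : Ex p (tau i) <= decay_bound.
Proof.
rewrite /tau /Ex fexpD fexp_cst; last exact: sum_cweight.
rewrite fexpZ lerD2l; apply: ler_wpM2l.
  by rewrite invr_ge0 exprn_ge0 // ltW.
exact: (Ex_root_sum p0 p1 eps_gt0 eps_le1 tail).
Qed.

Let dv4_tau i : Ex2 p (fun a b => dv i a b ^+ 4 * tau i a) <= M * decay_bound /\
  Ex2 p (fun a b => dv i a b ^+ 4 * tau i (mix (preds i) a b)) <= M * decay_bound.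
Proof.
pose W := [set c | coords_in (minus (anchor i)) c]%SET.
have iW : [disjoint [set i]%SET & W]%B.
  rewrite disjoints1 inE; case: (i) => [e|v]; last by rewrite /= !inE eqxx.
  apply/negP => /= /fintype.subsetP/(_ _ (anchor_edge e)).
  by rewrite !inE eqxx.
have d4 : depends_on2 [set i]%SET (fun a b => dv i a b ^+ 4).
  by move=> a a' b b' aa' bb'; rewrite /dv aa' ?bb' // inE.
have dt a a' : agree W a a' -> tau i a = tau i a'.
  move=> aa'; rewrite /tau; congr (_ + _ * _); apply: root_sum_local => c cW.
  by rewrite /weights aa' // inE.
have dv0 : 0 <= Ex2 p (fun a b => dv i a b ^+ 4).
  by apply: Ex2_ge0 => // a b; rewrite exprn_ge0 /dv.
have tau0 : 0 <= Ex p (tau i) by apply: fexp_ge0 => // a; exact: cweight_ge0.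
split.
  rewrite (@Ex2_indep _ _ _ p p1 [set i]%SET W) //; last by move=> a a' b b' aa' _; exact: dt.
  by rewrite (Ex2_fst p1 (tau i)); apply: ler_pM.
rewrite (@Ex2_indep _ _ _ p p1 [set i]%SET W) //.
  by rewrite (Ex2_mix_fst p1 (preds i) (tau i)); apply: ler_pM.
move=> a a' b b' aa' bb'; apply: dt => c cW.
by rewrite !ffunE; case: ifP => _; [exact: bb'|exact: aa'].
Qed.

(** The bound on the relative error only involves weights other than the i-th one, by
    self-avoidance, and so it is independent of the factor dv. *)
Lemma product_freeze i :
  Ex2 p (fun a b => (Ti i a b - local_product i a b) ^+ 2) <= 16 * (M * decay_bound).
Proof.
have [h1 h2] := dv4_tau i.
apply: (@le_trans _ _ (Ex2 p (fun a b => 8 * (dv i a b ^+ 4 * tau i a)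
    + 8 * (dv i a b ^+ 4 * tau i (mix (preds i) a b))))); last first.
  by rewrite Ex2D !Ex2Z; lra.
apply: le_Ex2 => // a b.
have [t [tt0 tt d1]] := dif_freeze i a b.
have [s [s0 ss d2]] := dif_freeze i (mix (preds i) a b) b.
rewrite dv_mix in d2.
have dv0 : 0 <= dv i a b by rewrite /dv.
have b1 : `|Ti i a b - local_product i a b| <= 2 * (t + s) * dv i a b ^+ 2.
  rewrite /local_product /increment_product freeze_mix.
  set A := dif F i a b in d1 *; set B := dif F i (mix _ a b) b in d2 *.
  set A' := dif F i (freeze i a) _ in d1 *; set B' := dif F i (freeze i (mix _ _ _)) _ in d2 *.
  have -> : A * B - A' * B' = (A - A') * B + A' * (B - B') by ring.
  have hB : `|B| <= dv i a b by rewrite -dv_mix dif_le.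
  have hA' : `|A'| <= dv i a b by rewrite -(dv_freeze i a b) dif_le.
  apply: (le_trans (ler_normD _ _)); rewrite !normrM.
  have -> : 2 * (t + s) * dv i a b ^+ 2 = 2 * t * dv i a b * dv i a b + dv i a b * (2 * s * dv i a b).
    by ring.
  by apply: lerD; apply: ler_pM.
rewrite -[(_ - _) ^+ 2]real_normK ?num_real //.
apply: (@le_trans _ _ ((2 * (t + s) * dv i a b ^+ 2) ^+ 2)).
  by rewrite lerXn2r ?nnegrE // ?mulr_ge0 ?addr_ge0 ?sqr_ge0.
have -> : (2 * (t + s) * dv i a b ^+ 2) ^+ 2 = dv i a b ^+ 4 * (4 * (t + s) ^+ 2) by ring.
rewrite [X in _ <= X + _]mulrCA [X in _ <= _ + X]mulrCA -mulrDr ler_wpM2l ?exprn_ge0 //.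
by have := sqr_ge0 (t - s); lra.
Qed.

Let q : R := 4 * Num.sqrt decay_bound.

Let decay_bound_gt0 : 0 < decay_bound.
Proof.
rewrite ltr_wpDr ?exprn_gt0 //.
have gr : 0 <= growth_rate G eps by rewrite /growth_rate !mulr_ge0 ?exprn_ge0 // ltW.
by rewrite mulr_ge0 ?invr_ge0 ?exprn_ge0 ?(ltW lam_gt0) // !mulr_ge0 ?exprn_ge0.
Qed.

Let q_gt0 : 0 < q. Proof. by rewrite mulr_gt0 // sqrtr_gt0. Qed.

Let q_sqr : q ^+ 2 * M = 16 * (M * decay_bound).
Proof. by rewrite /q exprMn sqr_sqrtr ?(ltW decay_bound_gt0) //; ring. Qed.

(** The local products of disjoint windows are independent, and their errors are
    controlled by [product_freeze]. *)
Lemma cov_far i j : [disjoint window i & window j]%B -> `|Ex2_cov p (Ti i) (Ti j)| <= 4 * q * M.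
Proof.
move=> ij; have M0 : 0 <= M by case: M_ge0 => // /(_ i).
have IL : Ex2 p (fun a b => local_product i a b * local_product j a b)
    = Ex2 p (local_product i) * Ex2 p (local_product j).
  by apply: (Ex2_indep p1 _ _ ij); exact: local_product_depends.
have E := Ex2_cov_split (Ti i) (Ti j) IL; rewrite {}E.
have h1 : `|Ex2_cov p (fun a b => Ti i a b - local_product i a b) (Ti j)| <= 2 * q * M.
  by apply: (Ex2_cov_le p0 p1) => //; rewrite q_sqr; exact: product_freeze.
have h2 : `|Ex2_cov p (fun a b => Ti j a b - local_product j a b) (local_product i)| <= 2 * q * M.
  by apply: (Ex2_cov_le p0 p1) => //; rewrite q_sqr; exact: product_freeze.
apply: (le_trans (ler_normD _ _)); apply: (le_trans (lerD h1 h2)).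
by rewrite -!mulrDl -natrD.
Qed.

Lemma cov_near i j : `|Ex2_cov p (Ti i) (Ti j)| <= 2 * M.
Proof.
have M0 : 0 <= M by case: M_ge0 => // /(_ i).
by rewrite -[2]mulr1; apply: (Ex2_cov_le p0 p1); rewrite ?expr1n ?mul1r.
Qed.

Variable V : R.
Hypothesis V_mean : Ex2 p (carre_du_champ F) = V.

Lemma carre_du_champ_var : Ex2 p (fun a b => (carre_du_champ F a b - V) ^+ 2)
  = 4^-1 * \sum_i \sum_j Ex2_cov p (Ti i) (Ti j).
Proof.
transitivity (Ex2 p (fun a b => carre_du_champ F a b ^+ 2) - V ^+ 2).
  transitivity (Ex2 p (fun a b => carre_du_champ F a b ^+ 2 - 2 * V * carre_du_champ F a b + V ^+ 2)).
    by apply: eq_Ex2 => a b; ring.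
  by rewrite Ex2D Ex2B Ex2Z Ex2_cst // V_mean; ring.
have -> : Ex2 p (fun a b => carre_du_champ F a b ^+ 2)
    = 4^-1 * \sum_i \sum_j Ex2 p (fun a b => Ti i a b * Ti j a b).
  under eq_bigr do rewrite -Ex2_sum.
  rewrite -Ex2_sum -Ex2Z; apply: eq_Ex2 => a b; rewrite /carre_du_champ.
  rewrite exprMn (_ : (2^-1) ^+ 2 = 4^-1 :> R); last by field.
  by rewrite expr2 mulr_suml; congr (_ * _); apply: eq_bigr => i _; rewrite mulr_sumr.
have -> : V ^+ 2 = 4^-1 * \sum_i \sum_j Ex2 p (Ti i) * Ex2 p (Ti j).
  rewrite -V_mean /carre_du_champ Ex2Z Ex2_sum exprMn (_ : (2^-1) ^+ 2 = 4^-1 :> R); last by field.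
  by rewrite expr2 mulr_suml; congr (_ * _); apply: eq_bigr => i _; rewrite mulr_sumr.
rewrite -mulrBr -sumrB; congr (_ * _); apply: eq_bigr => i _.
by rewrite -sumrB.
Qed.

Lemma card_anchor (S : {set G}) : (#|[set j | anchor j \in S]%SET| <= D.+1 * #|S|)%N.
Proof.
rewrite -sum1_card (partition_big (@anchor G) (fun v => v \in S)) /=; last first.
  by move=> j; rewrite inE.
rewrite mulnC -sum_nat_const; apply: leq_sum => v _; rewrite sum1dep_card.
apply: (@leq_trans #|(inr v |: [set (inl e : edge G + G) | e in incident v])%SET|).
  apply: subset_leq_card; apply/fintype.subsetP => c; rewrite !inE => /andP[_ /eqP <-].
  case: c => [e|u]; last by rewrite /= eqxx.
  apply/orP; right; apply: imset_f; by rewrite inE anchor_edge.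
rewrite cardsU1 (leq_trans (leq_add (leq_b1 _) (leq_imset_card _ _))) // add1n ltnS.
exact: card_incident.
Qed.

Lemma card_coords : (#|{: edge G + G}| <= D.+1 * #|G|)%N.
Proof.
have := card_anchor [set: G]%SET; rewrite cardsT; apply: leq_trans.
by rewrite -cardsT; apply: subset_leq_card; apply/fintype.subsetP => c; rewrite !inE.
Qed.

Lemma near_ball (rad : R) (x y v : G) : (2 * k.+1)%:R <= rad ->
  v \in near k.+1 x -> v \in near k.+1 y -> y \in ball_vertices x rad.
Proof.
move=> krad /nearP[s [xs sv sk]] /nearP[s' [ys s'v s'k]]; rewrite inE.
have rp : path (@adj G) v (rev (belast y s'))
  by rewrite -s'v rev_path (eq_path (e' := @adj G)) // => a b; exact: adj_sym.
have rl : last v (rev (belast y s')) = y.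
  by case: s' s'v {ys s'k rp} => [|u s'] //= uv; rewrite rev_cons last_rcons.
rewrite /gdist; apply: (@le_trans _ _ ((size (s ++ rev (belast y s')))%:R)%:E).
  apply: ereal_inf_lbound; exists (s ++ rev (belast y s')) => //.
  by split; rewrite ?cat_path ?last_cat sv ?xs.
rewrite lee_fin; apply: le_trans krad; rewrite ler_nat size_cat size_rev size_belast.
by rewrite mul2n -addnn leq_add.
Qed.

(** Windows of radius k + 1 around vertices at distance more than 2 (k + 1) are
    disjoint, so all but |V| vol pairs, up to a factor, are controlled by [cov_far]. *)
Lemma carre_du_champ_var_le (rad : R) : (2 * k.+1)%:R <= rad ->
  Ex2 p (fun a b => (carre_du_champ F a b - V) ^+ 2) <=
  D.+1%:R ^+ 2 * (16 * M4) * (#|G|%:R * (volume_growth G rad)%:R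
                    + 4 * Num.sqrt decay_bound * #|G|%:R ^+ 2).
Proof.
move=> krad; rewrite carre_du_champ_var -/M -/q; have q0 : 0 <= q by exact: ltW.
have [M0|none] := M_ge0; last first.
  rewrite big1 ?mulr0; last by move=> i; have := none i.
  have [v _|noG] := pickP (fun _ : G => true); first by have := none (inr v).
  by rewrite (eq_card0 noG) mul0r add0r expr0n /= mulr0 mulr0.
set n : R := #|G|%:R; set B : R := (volume_growth G rad)%:R.
have covij i j : Ex2_cov p (Ti i) (Ti j)
    <= 2 * M * (anchor j \in ball_vertices (anchor i) rad)%:R + 4 * q * M.
  apply: (le_trans (ler_norm _)); have qM : 0 <= 4 * q * M by rewrite mulr_ge0 // mulr_ge0.
  have [ij|] := boolP [disjoint window i & window j]%B.
    by apply: (le_trans (cov_far ij)); rewrite lerDr mulr_ge0 // mulr_ge0.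
  rewrite disjoint_subset => /subsetPn[c ci]; rewrite inE negbK => cj.
  rewrite (_ : anchor j \in _).
    by rewrite mulr1; apply: (le_trans (cov_near i j)); rewrite lerDl.
  rewrite inE in ci; rewrite inE in cj; case: c ci cj => [e|v] /=; last exact: near_ball.
  have [x xe] := edge_anchor_ex e.
  by move=> /fintype.subsetP/(_ _ xe) h1 /fintype.subsetP/(_ _ xe); apply: near_ball h1.
have rowi i : \sum_j Ex2_cov p (Ti i) (Ti j) <= D.+1%:R * (2 * M * B + 4 * q * M * n).
  apply: (@le_trans _ _ (\sum_j (2 * M * (anchor j \in ball_vertices (anchor i) rad)%:R + 4 * q * M))).
    by apply: ler_sum => j _; exact: covij.
  rewrite big_split /= -mulr_sumr sumr_const -[X in _ + X]mulr_natl.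
  rewrite -natr_sum -big_mkcond /= sum1dep_card.
  have h1 : (#|[set j | anchor j \in ball_vertices (anchor i) rad]%SET|)%:R <= D.+1%:R * B.
    rewrite -natrM ler_nat (leq_trans (card_anchor _)) // leq_mul2l.
    by apply/orP; right; apply: (leq_bigmax (anchor i)).
  have h2 : #|{: edge G + G}|%:R <= D.+1%:R * n :> R.
    by rewrite -natrM ler_nat card_coords.
  rewrite mulrDr; apply: lerD.
    by rewrite [leRHS]mulrCA; apply: ler_wpM2l => //; rewrite mulr_ge0.
  rewrite [X in _ <= _ * X]mulrC [leRHS]mulrA; apply: ler_wpM2r => //.
  by rewrite mulr_ge0 // mulr_ge0.
have n0 : 0 <= n by []. have B0 : 0 <= B by [].
have row0 : 0 <= D.+1%:R * (2 * M * B + 4 * q * M * n).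
  apply: mulr_ge0 => //; apply: addr_ge0; first by rewrite mulr_ge0 // mulr_ge0.
  by rewrite mulr_ge0 // mulr_ge0 // mulr_ge0.
apply: (@le_trans _ _ (4^-1 * (D.+1%:R * n * (D.+1%:R * (2 * M * B + 4 * q * M * n))))).
  rewrite ler_wpM2l ?invr_ge0 //.
  apply: (@le_trans _ _ (\sum_(i : edge G + G) D.+1%:R * (2 * M * B + 4 * q * M * n))).
    by apply: ler_sum => i _; exact: rowi.
  rewrite sumr_const -[leLHS]mulr_natl ler_wpM2r //.
  by rewrite -natrM ler_nat card_coords.
have -> : D.+1%:R ^+ 2 * M * (n * B + q * n ^+ 2)
  = D.+1%:R ^+ 2 * M * n * B + D.+1%:R ^+ 2 * M * n ^+ 2 * q by ring.
have -> : 4^-1 * (D.+1%:R * n * (D.+1%:R * (2 * M * B + 4 * q * M * n)))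
  = 2^-1 * (D.+1%:R ^+ 2 * M * n * B) + D.+1%:R ^+ 2 * M * n ^+ 2 * q by field.
rewrite lerD2r ler_piMl ?invf_le1 ?ler1n //.
by rewrite mulr_ge0 // mulr_ge0 // mulr_ge0 // sqr_ge0.
Qed.

End Radius.
End CarreDuChampVariance.

(** * Normal approximation for ramp functions *)

Section NormalApproximation.
Context {R : realType} {I T : finType}.
Variable p : I -> T -> R.
Hypothesis p0 : forall i t, 0 <= p i t.
Hypothesis p1 : forall i, \sum_t p i t = 1.
Local Notation config := {ffun I -> T}.
Variable f : config -> R.
Local Notation V := (fvar (cweight p) f).
Hypothesis V_gt0 : 0 < V.

(** Stein's equation turns the difference of the two means into
    E (g' (W) - W g (W)), to which [stein_product_bound] applies after rescaling by the
    standard deviation. *)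
Lemma normal_approximation (s e : R) : 0 < e -> e <= 1 ->
  `|Ex p (fun a => ramp s e ((f a - Ex p f) / Num.sqrt V)) - gauss_mean (ramp s e)|
  <= 2 / V * Num.sqrt (Ex2 p (fun a b => (carre_du_champ f a b - V) ^+ 2))
     + 7 / e / (V * Num.sqrt V) *
       \sum_i Ex2 p (fun a b => dif f i a b ^+ 2 * `|dif f i (mix (preds i) a b) b|).
Proof.
move=> e0 e1; have [g [dg [gE dg2 gT]]] := stein_ramp s e0 e1.
set sg := Num.sqrt V; set mu := Ex p f.
have sg0 : 0 < sg by rewrite sqrtr_gt0.
have sgV : sg ^+ 2 = V by rewrite sqr_sqrtr // ltW.
pose W x := (x - mu) / sg.
have tB : forall x y, `|g (W y) - g (W x) - dg (W x) / sg * (y - x)| <= (14 / e / V) * (y - x) ^+ 2.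
  move=> x y; have := gT (W x) (W y).
  have -> : W y - W x = (y - x) / sg by rewrite /W; field; rewrite gt_eqF.
  have -> : dg (W x) * ((y - x) / sg) = dg (W x) / sg * (y - x) by rewrite mulrAC mulrA.
  have -> // : 14 / e * ((y - x) / sg) ^+ 2 = 14 / e / V * (y - x) ^+ 2.
  by rewrite -sgV; field; rewrite !gt_eqF.
have tA x : `|dg (W x) / sg| <= 2 / sg.
  by rewrite normrM normfV (gtr0_norm sg0) ler_pM2r ?invr_gt0.
have := @stein_product_bound R I T p p0 p1 f (fun x => g (W x)) (fun x => dg (W x) / sg) _ _ tA tB.
rewrite -/mu => H.
have LHS : Ex p (fun a => ramp s e ((f a - mu) / sg)) - gauss_mean (ramp s e)
    = - sg^-1 * (Ex p (fun a => g (W (f a)) * (f a - mu)) - V * Ex p (fun a => dg (W (f a)) / sg)).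
  have c1 : \sum_a cweight p a = 1 by exact: sum_cweight.
  rewrite -[X in _ - X](fexp_cst c1) -fexpB mulNr mulrBr opprB /Ex -!fexpZ -fexpB.
  apply: eq_fexp => a; rewrite -gE -/(W (f a)) -sgV.
  have -> : f a - mu = sg * W (f a) by rewrite /W; field; rewrite gt_eqF.
  by field; rewrite gt_eqF.
rewrite LHS normrM normrN normfV (gtr0_norm sg0) ler_pdivrMl //; apply: (le_trans H).
rewrite mulrDr; apply: lerD.
  rewrite mulrA ler_wpM2r ?sqrtr_ge0 // -sgV le_eqVlt; apply/orP; left; apply/eqP.
  by field; rewrite gt_eqF.
set S3 := \sum_i _; have S30 : 0 <= S3.
  by apply: sumr_ge0 => i _; apply: Ex2_ge0 => // a b; rewrite mulr_ge0 ?sqr_ge0.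
rewrite mulrA ler_wpM2r // le_eqVlt; apply/orP; left; apply/eqP.
by rewrite -sgV; field; rewrite !gt_eqF.
Qed.

End NormalApproximation.

Section DiscreteBound.
Context {R : realType}.

Lemma bernoulli_pow (y : R) (n : nat) : 0 <= y -> 1 + n%:R * y <= (1 + y) ^+ n.
Proof.
move=> y0; elim: n => [|n IH]; first by rewrite mul0r addr0 expr0.
rewrite exprS; apply: (@le_trans _ _ ((1 + y) * (1 + n%:R * y))).
  have : 0 <= n%:R * y * y by rewrite !mulr_ge0.
  by rewrite -natr1; lra.
by rewrite ler_pM2l // ltr_wpDr.
Qed.

Lemma ratio_pow_small (X eps : R) : 0 <= X -> 0 < eps ->
  exists2 m : nat, (0 < m)%N & (X / (1 + X)) ^+ m <= eps.
Proof.
rewrite le_eqVlt => /predU1P[<- e0|X0 e0].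
  by exists 1%N; rewrite // mul0r expr1 ltW.
pose m := (Num.truncn (X / eps)).+1; exists m => //.
have X1 : 0 < 1 + X by rewrite ltr_wpDl.
have -> : X / (1 + X) = (1 + X^-1)^-1.
  have -> : 1 + X^-1 = (1 + X) / X by rewrite mulrDl mul1r mulfV ?gt_eqF // addrC.
  by rewrite invf_div.
have Y : 0 < 1 + X^-1 by rewrite ltr_wpDr // invr_ge0 ltW.
rewrite exprVn invf_ple ?posrE ?exprn_gt0 //.
apply: le_trans (bernoulli_pow m _); last by rewrite invr_ge0 ltW.
apply: (@le_trans _ _ (m%:R * X^-1)); last by rewrite lerDr.
rewrite ler_pdivlMr // mulrC; apply: ltW; exact: truncnS_gt.
Qed.

(** Only fourth moments are bounded by assumption; with s^4 = 1 + M4 Young's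
    inequality makes third moments at most s^3. *)
Lemma cube_le_young (x s : R) : 0 < s -> `|x| ^+ 3 <= 3 / 4 * (x ^+ 4 / s) + s ^+ 3 / 4.
Proof.
move=> s0; have -> : x ^+ 4 = `|x| ^+ 4 by rewrite -normrX ger0_norm // exprn_even_ge0.
have := normr_ge0 x; move: `|x| => y y0.
rewrite -subr_ge0.
have -> : 3 / 4 * (y ^+ 4 / s) + s ^+ 3 / 4 - y ^+ 3
    = (y - s) ^+ 2 * (3 * y ^+ 2 + 2 * y * s + s ^+ 2) / (4 * s).
  by field; rewrite gt_eqF.
have s1 := ltW s0; apply: divr_ge0; last exact: mulr_ge0.
apply: mulr_ge0; first exact: sqr_ge0.
by rewrite !addr_ge0 ?mulr_ge0 ?sqr_ge0.
Qed.

Lemma cube_diff_le (x y : R) : `|x - y| ^+ 3 <= 4 * (`|x| ^+ 3 + `|y| ^+ 3).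
Proof.
apply: (@le_trans _ _ ((`|x| + `|y|) ^+ 3)).
  by rewrite lerXn2r ?nnegrE ?addr_ge0 // ler_normB.
have := normr_ge0 x; have := normr_ge0 y; move: `|x| `|y| => u v v0 u0.
rewrite -subr_ge0; have -> : 4 * (u ^+ 3 + v ^+ 3) - (u + v) ^+ 3 = 3 * (u + v) * (u - v) ^+ 2.
  by ring.
apply: mulr_ge0; last exact: sqr_ge0.
by rewrite mulr_ge0 ?addr_ge0.
Qed.

Lemma sqrtrD_le (x y : R) : 0 <= x -> 0 <= y -> Num.sqrt (x + y) <= Num.sqrt x + Num.sqrt y.
Proof.
move=> x0 y0; rewrite -ler_sqr ?nnegrE ?addr_ge0 ?sqrtr_ge0 //.
rewrite sqr_sqrtr ?addr_ge0 // sqrrD !sqr_sqrtr // -addrA lerD2l.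
by rewrite lerDr mulrn_wge0 // mulr_ge0 ?sqrtr_ge0.
Qed.

Lemma sqrt_variance_le (G2 d M4 s3 nB sd kap h n : R) :
  0 <= d -> 0 <= M4 -> 0 <= s3 -> M4 <= s3 ^+ 2 -> 0 <= nB -> 1 <= kap -> 0 <= h -> 0 <= n ->
  sd <= kap * h ^+ 2 -> G2 <= d ^+ 2 * (16 * M4) * (nB + 4 * sd * n ^+ 2) ->
  Num.sqrt G2 <= 4 * d * s3 * (Num.sqrt nB + 2 * kap * h * n).
Proof.
move=> d0 M40 s30 Ms nB0 k1 h0 n0 sdk GG; have k0 : 0 <= kap by exact: le_trans k1.
have q0 := sqrtr_ge0 nB; have qE : Num.sqrt nB ^+ 2 = nB by exact: sqr_sqrtr.
have X0 : 0 <= 4 * d * s3 * (Num.sqrt nB + 2 * kap * h * n) by rewrite !mulr_ge0 ?addr_ge0 ?mulr_ge0.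
rewrite -[leRHS]ger0_norm // -sqrtr_sqr ler_wsqrtr //; apply: (le_trans GG).
apply: (@le_trans _ _ (d ^+ 2 * (16 * s3 ^+ 2) * (nB + 4 * (kap * h ^+ 2) * n ^+ 2))).
  apply: (@le_trans _ _ (d ^+ 2 * (16 * M4) * (nB + 4 * (kap * h ^+ 2) * n ^+ 2))).
    rewrite ler_wpM2l ?mulr_ge0 ?sqr_ge0 // lerD2l ler_wpM2r ?sqr_ge0 //.
    by rewrite ler_pM2l.
  rewrite ler_wpM2r //; last by rewrite ler_wpM2l ?sqr_ge0 // ler_pM2l.
  by rewrite addr_ge0 ?mulr_ge0 ?sqr_ge0.
move: (Num.sqrt nB) q0 qE => q q0 <-.
have -> : (4 * d * s3 * (q + 2 * kap * h * n)) ^+ 2 =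
  d ^+ 2 * (16 * s3 ^+ 2) * (q ^+ 2 + 4 * (kap * kap * h ^+ 2) * n ^+ 2 + 4 * q * kap * h * n).
  by ring.
rewrite ler_wpM2l ?mulr_ge0 ?sqr_ge0 // -addrA lerD2l ler_wpDr ?mulr_ge0 //.
rewrite ler_wpM2r ?sqr_ge0 // ler_pM2l // ler_wpM2r ?sqr_ge0 //.
by rewrite ler_peMl.
Qed.

(** The arithmetic that combines the bounds for [normal_approximation], with q the
    square root of the volume term, S the third moments, sG the standard deviation of
    the carre du champ and h the decay factor. *)
Lemma rate_collect (X V E v0 d s3 q kap h ec hr n S sG e : R) :
  0 < E -> 0 < v0 -> 0 < d -> 0 <= s3 -> 0 <= q -> 0 <= kap -> 0 <= hr -> 0 <= n -> 0 <= ec ->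
  0 < e -> e <= 1 -> E * v0 <= V -> h <= ec * hr ->
  sG <= 4 * d * s3 * (q + 2 * kap * h * n) -> S <= d * n * (8 * s3) -> 0 <= S ->
  X <= 2 / V * sG + 7 / e / (V * Num.sqrt V) * S ->
  X <= (8 * d / v0 + 16 * d * kap * ec / v0 + 56 * d / (v0 * Num.sqrt v0)) * s3
       * (q / E + n * hr / E + n / (E * Num.sqrt E)) / e.
Proof.
move=> E0 v00 d0 s30 q0 k0 hr0 n0 ec0 e0 e1 EV hh hG hS S0 hX.
have Ev0 : 0 < E * v0 by exact: mulr_gt0.
have V0 : 0 < V by exact: lt_le_trans EV.
set sE := Num.sqrt E; set sv := Num.sqrt v0.
have sE0 : 0 < sE by rewrite sqrtr_gt0.
have sv0 : 0 < sv by rewrite sqrtr_gt0.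
have sEV : sE * sv <= Num.sqrt V by rewrite /sE /sv -sqrtrM ?(ltW E0) // ler_wsqrtr.
have sV0 : 0 < Num.sqrt V by rewrite sqrtr_gt0.
have h1 : 2 / V * sG <= 2 / (E * v0) * (4 * d * s3 * (q + 2 * kap * (ec * hr) * n)).
  apply: (@le_trans _ _ (2 / V * (4 * d * s3 * (q + 2 * kap * (ec * hr) * n)))).
    rewrite ler_wpM2l ?divr_ge0 ?(ltW V0) //; apply: (le_trans hG).
    rewrite ler_wpM2l ?mulr_ge0 ?(ltW d0) // lerD2l ler_wpM2r // ler_wpM2l // mulr_ge0 //.
  rewrite ler_wpM2r //; last by rewrite ler_pM2l // lef_pV2.
  by rewrite !mulr_ge0 ?(ltW d0) // addr_ge0 // !mulr_ge0.
have h2 : 7 / e / (V * Num.sqrt V) * S <= 7 / e / (E * v0 * (sE * sv)) * (d * n * (8 * s3)).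
  apply: ler_pM => //.
    by rewrite !divr_ge0 ?mulr_ge0 ?ltW.
  rewrite ler_pM2l ?divr_gt0 // lef_pV2 ?posrE ?mulr_gt0 //.
  by apply: ler_pM => //; rewrite ?mulr_ge0 ?ltW.
apply: (le_trans hX); apply: (le_trans (lerD h1 h2)).
clear hX h1 h2 hG hS hh sEV EV hX.
apply: (@le_trans _ _ (2 / (E * v0) * (4 * d * s3 * (q + 2 * kap * (ec * hr) * n)) / e
   + 7 / e / (E * v0 * (sE * sv)) * (d * n * (8 * s3)))).
  rewrite lerD2r ler_pdivlMr // ler_piMr //.
  by rewrite !mulr_ge0 ?invr_ge0 ?addr_ge0 ?mulr_ge0 ?(ltW E0) ?(ltW v00) ?(ltW d0).
have E1 := ltW E0; have v01 := ltW v00; have d1 := ltW d0; have e2 := ltW e0.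
have sE1 := ltW sE0; have sv1 := ltW sv0.
pose a1 := 8 * d / v0; pose a2 := 16 * d * kap * ec / v0; pose a3 := 56 * d / (v0 * sv).
pose b1 := q / E; pose b2 := n * hr / E; pose b3 := n / (E * sE).
have -> : 2 / (E * v0) * (4 * d * s3 * (q + 2 * kap * (ec * hr) * n)) / e
   + 7 / e / (E * v0 * (sE * sv)) * (d * n * (8 * s3))
   = (a1 * b1 + a2 * b2 + a3 * b3) * s3 / e.
  by rewrite /a1 /a2 /a3 /b1 /b2 /b3; field; rewrite !gt_eqF.
rewrite -/a1 -/a2 -/a3 -/b1 -/b2 -/b3 ler_pM2r ?invr_gt0 // [leRHS]mulrAC ler_wpM2r //.
have a10 : 0 <= a1 by rewrite !mulr_ge0 ?invr_ge0.
have a20 : 0 <= a2 by rewrite !mulr_ge0 ?invr_ge0.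
have a30 : 0 <= a3 by rewrite !mulr_ge0 ?invr_ge0 ?mulr_ge0.
have b10 : 0 <= b1 by rewrite !mulr_ge0 ?invr_ge0.
have b20 : 0 <= b2 by rewrite !mulr_ge0 ?invr_ge0.
have b30 : 0 <= b3 by rewrite !mulr_ge0 ?invr_ge0 ?mulr_ge0.
rewrite !mulrDl !mulrDr.
have ab x y : 0 <= x -> 0 <= y -> 0 <= x * y :> R by exact: mulr_ge0.
have [u1 u2 u3] := And3 (ab _ _ a10 b20) (ab _ _ a10 b30) (ab _ _ a20 b10).
have [u4 u5 u6] := And3 (ab _ _ a20 b30) (ab _ _ a30 b10) (ab _ _ a30 b20).
move: (a1 * b1) (a1 * b2) (a1 * b3) (a2 * b1) (a2 * b2) (a2 * b3) (a3 * b1) (a3 * b2) (a3 * b3) u1 u2 u3 u4 u5 u6.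
by clear; move=> *; lra.
Qed.

Lemma third_moment_le (G : sgraph) (T : finType) (p : edge G + G -> T -> R) (vl : T -> R)
  (M4 s : R) i : (forall i t, 0 <= p i t) -> (forall i, \sum_t p i t = 1) ->
  0 < s -> \sum_t p i t * vl t ^+ 4 <= M4 -> M4 <= s ^+ 4 ->
  Ex2 p (fun a b => `|vl (a i) - vl (b i)| ^+ 3) <= 8 * s ^+ 3.
Proof.
move=> p0 p1 s0 mom Ms.
have h : \sum_t p i t * `|vl t| ^+ 3 <= s ^+ 3.
  apply: (@le_trans _ _ (\sum_t p i t * (3 / 4 * (vl t ^+ 4 / s) + s ^+ 3 / 4))).
    by apply: ler_sum => t _; rewrite ler_wpM2l // cube_le_young.
  under eq_bigr do rewrite mulrDr; rewrite big_split /= -mulr_suml p1 mul1r.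
  under eq_bigr => t _ do rewrite mulrCA.
  rewrite -mulr_sumr; under eq_bigr do rewrite mulrA.
  rewrite -mulr_suml; move: (\sum_t _) mom => M mom.
  have := le_trans mom Ms; rewrite -(ler_pM2r (x := s^-1)) ?invr_gt0 // exprSr mulfK ?gt_eqF //.
  by move: (M / s) (s ^+ 3); clear; move=> x y; lra.
apply: (@le_trans _ _ (Ex2 p (fun a b => 4 * (`|vl (a i)| ^+ 3 + `|vl (b i)| ^+ 3)))).
  by apply: le_Ex2 => // a b; exact: cube_diff_le.
rewrite Ex2Z Ex2D (Ex2_fst p1) (Ex2_snd p1) (Ex_coord p1 i (fun t => `|vl t| ^+ 3)).
by move: (\sum_t _) h; clear; move=> x; lra.
Qed.

Lemma truncn_radius (r : R) : 1 <= r ->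
  (2 * (Num.truncn (3 * r / 2)).-1.+1)%:R <= 3 * r
  /\ 3 * r / 2 - 2 <= ((Num.truncn (3 * r / 2)).-1)%:R.
Proof.
move=> r1; have tr : (0 < Num.truncn (3 * r / 2))%N by rewrite truncn_gt_nat; lra.
have r20 : 0 <= 3 * r / 2 by lra.
have := truncn_le (3 * r / 2); have := truncnS_gt (3 * r / 2).
rewrite r20 -(prednK tr) /=; move: (_.-1) => k h1 h2; split; first by rewrite natrM; lra.
by move: h1; rewrite -[k.+2]addn2 natrD; lra.
Qed.

Lemma decay_rate (c k r : R) : 0 < c -> 3 * r / 2 - 2 <= k ->
  expR (- (c * k / 2)) <= expR c * expR (- (3 / 4 * c * r)).
Proof. by move=> c0 kr; rewrite -expRD ler_expR; nra. Qed.

(** The rate for ramp functions of unit width.  The square roots of its terms are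
    the terms of [clt_rate], with c halved. *)
Definition wasserstein_rate (G : sgraph) (c r : R) : R :=
  let V : R := #|G|%:R in let E : R := #|edge_set G|%:R in
  Num.sqrt (V * (volume_growth G (3 * r))%:R) / E + V * expR (- (c * r)) / E
  + V / (E * Num.sqrt E).

Lemma card_edge (G : sgraph) : #|edge G| = #|edge_set G|.
Proof. exact: card_sig. Qed.

Section Constants.
Variables (D : nat) (K1 K2 : R).
Hypotheses (K1_gt0 : 0 < K1) (K2_gt0 : 0 < K2).

(** With this value the growth rate of the sum over paths is at most 1/2. *)
Let eps : R := (D.+1%:R * 2 ^+ (2 + 2 * D))^-1.

Let eps_gt0 : 0 < eps.
Proof. by rewrite invr_gt0 mulr_gt0 ?exprn_gt0 // ltr0n. Qed.

Let eps_le1 : eps <= 1.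
Proof.
have w1 : 1 <= 2 ^+ (2 + 2 * D) :> R by rewrite exprn_ege1 ?ler1n.
have d1 : 1 <= D.+1%:R :> R by rewrite ler1n.
rewrite /eps; move: (2 ^+ _) (D.+1%:R) w1 d1 => w d w1 d1.
by rewrite invf_le1 ?mulr_ege1 // mulr_gt0 // (lt_le_trans ltr01).
Qed.

Let eps_growth : eps * (2 ^+ (1 + 2 * D) * D%:R) <= 2^-1.
Proof.
have w0 : 0 < 2 ^+ (1 + 2 * D) :> R by apply: exprn_gt0.
have d0 : 0 < D.+1%:R :> R by rewrite ltr0n.
have dd : D%:R <= D.+1%:R :> R by rewrite ler_nat.
rewrite /eps (_ : 2 + 2 * D = (1 + 2 * D).+1)%N // exprS.
move: (2 ^+ (1 + 2 * D)) (D%:R : R) (D.+1%:R : R) w0 d0 dd => w x y w0 y0 xy.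
rewrite mulrC ler_pdivrMr ?mulr_gt0 //.
have -> : 2^-1 * (y * (2 * w)) = w * y by field.
by rewrite ler_pM2l.
Qed.

Let threshold : exists l : R, [/\ 0 < l, (2 + 4 * D)%:R * K1 <= l ^+ 2 / 2,
  8 * K1 <= K2 * l & K1 / l ^+ 2 <= eps ^+ D.+1].
Proof.
pose A : R := 2 * (2 + 4 * D)%:R * K1; pose B : R := 8 * K1 / K2.
pose C : R := K1 / eps ^+ D.+1.
have A0 : 0 <= A by rewrite !mulr_ge0 // ltW.
have B0 : 0 <= B by rewrite divr_ge0 ?mulr_ge0 // ltW.
have C0 : 0 <= C by rewrite divr_ge0 ?exprn_ge0 // ltW.
pose l : R := 1 + A + B + C.
have l1 : 1 <= l by rewrite /l; lra.
have ll : l <= l ^+ 2 by rewrite expr2 ler_peMr //; lra.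
exists l; split; first lra.
- by rewrite ler_pdivlMr // mulrC mulrA; apply: le_trans ll; rewrite -/A /l; lra.
- have -> : 8 * K1 = K2 * B by rewrite /B mulrCA divff ?mulr1 // gt_eqF.
  by rewrite ler_pM2l // /l; lra.
- rewrite ler_pdivrMr; last by rewrite exprn_gt0 //; lra.
  rewrite mulrC -ler_pdivrMr ?exprn_gt0 // -/C.
  by apply: le_trans ll; rewrite /l; lra.
Qed.

(** The threshold l is chosen so large that weights above it are rare, m so that m
    contractions are worth the factor eps, and lam = 2^(- k / (m + 2)) balances the
    two terms of [decay_bound].  The radius k is the largest one for which two windows
    that meet have anchors at distance at most 3 r. *)
Lemma discrete_clt : exists c C v0 : R, [/\ 0 < c, 0 < C, 0 < v0 &
  forall (G : sgraph), max_degree G = D -> edge_set G != finset.set0 ->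
  forall (T : finType) (t0 : T) (p : edge G + G -> T -> R) (vl : T -> R) (M4 : R),
    (forall i t, 0 <= p i t) -> (forall i, \sum_t p i t = 1) ->
    (forall i, \sum_t p i t * vl t ^+ 2 <= K1) ->
    (forall e : edge G, K2 <= \sum_s \sum_t p (inl e) s * p (inl e) t * `|vl s - vl t|) ->
    (forall i, \sum_t p i t * vl t ^+ 4 <= M4) ->
  #|edge_set G|%:R * v0 <= fvar (cweight p) (logZ_of vl) /\
  forall r s e : R, 1 <= r -> 0 < e -> e <= 1 ->
    `|Ex p (fun a => ramp s e ((logZ_of vl a - Ex p (logZ_of vl))
                               / Num.sqrt (fvar (cweight p) (logZ_of vl))))
      - gauss_mean (ramp s e)|
    <= C * (1 + M4) `^ (3 / 4) * wasserstein_rate G c r / e].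
Proof.
have [l [l0 l1 l2 l3]] := threshold.
have X0 : 0 <= D%:R * expR (3 * l) by rewrite mulr_ge0 ?expR_ge0.
have [m m0 thm] := ratio_pow_small X0 eps_gt0.
pose c0 : R := ln 2 / m.+2%:R.
have c0_gt0 : 0 < c0 by rewrite divr_gt0 ?ln_gt0 ?ltr0n ?ltr1n.
pose v0 : R := ((1 + (expR l + D%:R * expR (2 * l)) ^+ 2 * expR l)^-1 * K2 / 4) ^+ 2 / 2.
have v0_gt0 : 0 < v0.
  rewrite divr_gt0 // exprn_gt0 // divr_gt0 // mulr_gt0 // invr_gt0 ltr_wpDr // mulr_ge0 ?sqr_ge0 ?expR_ge0.
pose d : R := D.+1%:R.
pose kap : R := 1 + D%:R * 2 ^+ D.
have d0 : 0 < d by rewrite ltr0n.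
have kap1 : 1 <= kap by rewrite lerDl mulr_ge0.
have kap0 : 0 < kap by exact: lt_le_trans kap1.
pose C1 : R := 8 * d / v0; pose C2 : R := 16 * d * kap * expR c0 / v0.
pose C3 : R := 56 * d / (v0 * Num.sqrt v0).
have sv0 : 0 < Num.sqrt v0 by rewrite sqrtr_gt0.
have C1_gt0 : 0 < C1 by rewrite divr_gt0 ?mulr_gt0.
have C2_gt0 : 0 < C2 by rewrite divr_gt0 ?mulr_gt0 ?expR_gt0.
have C3_gt0 : 0 < C3 by rewrite divr_gt0 ?mulr_gt0.
exists (3 / 4 * c0), (C1 + C2 + C3), v0; split => //.
- by rewrite mulr_gt0.
- by rewrite !addr_gt0.
move=> G GD Gne T t0 p vl M4 p0 p1 mom2 adiff mom4.
set F := logZ_of vl; set V := fvar _ F.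
have VE : #|edge_set G|%:R * v0 <= V.
  have := @variance_lower G R T p vl p0 p1 K1 K2 l K2_gt0 l0 mom2 adiff.
  rewrite GD card_edge => /(_ l1 l2).
  by rewrite /variance_rate /surround_bound GD.
split => // r s e r1 e0 e1.
set n : R := #|G|%:R; set E : R := #|edge_set G|%:R in VE *.
set B : R := (volume_growth G (3 * r))%:R.
have E0 : 0 < E by rewrite ltr0n card_gt0.
have V0 : 0 < V by apply: lt_le_trans VE; rewrite mulr_gt0.
have [x0 _|noG] := pickP (fun _ : G => true); last first.
  have /set0Pn[ed edP] := Gne.
  by case/imsetP: edP => -[x y]; have := noG x.
have M40 : 0 <= M4.
  by apply: le_trans (mom4 (inr x0)); apply: sumr_ge0 => t _; rewrite mulr_ge0 // exprn_even_ge0.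
pose s4 : R := (1 + M4) `^ (1 / 4).
have N0 : 0 < 1 + M4 by rewrite ltr_wpDr.
have s40 : 0 < s4 by rewrite powR_gt0.
have s4E : s4 ^+ 4 = 1 + M4.
  by rewrite -powR_mulrn ?ltW // -powRrM mul1r mulVf // powRr1 // ltW.
have s3E : (1 + M4) `^ (3 / 4) = s4 ^+ 3.
  by rewrite -powR_mulrn ?ltW // -powRrM; congr (_ `^ _); field.
have s41 : 1 <= s4.
  rewrite leNgt; apply/negP => s1; have : s4 ^+ 4 < 1 by rewrite exprn_ilt1 // ltW.
  by rewrite s4E; lra.
have M4s : M4 <= (s4 ^+ 3) ^+ 2.
  apply: (@le_trans _ _ (s4 ^+ 4)); first by rewrite s4E; lra.
  by rewrite -exprM ler_weXn2l.
pose k := (Num.truncn (3 * r / 2)).-1.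
have [kr kr2] := truncn_radius r1; rewrite -/k in kr kr2.
pose lam : R := expR (- (c0 * k%:R)).
have lam0 : 0 < lam by exact: expR_gt0.
have tail i : \sum_(t | l < `|vl t|) p i t <= eps ^+ (max_degree G).+1.
  by rewrite GD; apply: le_trans l3; exact: (markov_weight p0 l0 mom2).
have theta : (damping G l / (1 + damping G l)) ^+ m <= eps by rewrite /damping GD.
have := carre_du_champ_var_le t0 p0 p1 eps_gt0 eps_le1 m0 tail theta mom4 lam0
   (Ex2_carre_du_champ p1 F) kr.
rewrite GD -/n -/B -/V -/d => hvar.
have db : Num.sqrt (decay_bound G eps m k lam) <= kap * lam.
  rewrite -[leRHS]ger0_norm ?mulr_ge0 ?(ltW kap0) ?(ltW lam0) // -sqrtr_sqr ler_wsqrtr //.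
  apply: (@le_trans _ _ (kap * lam ^+ 2)); last first.
    by rewrite exprMn ler_wpM2r ?sqr_ge0 // expr2 ler_peMr // ltW.
  rewrite /decay_bound GD /kap mulrDl mul1r lerD2l mulrCA ler_wpM2l ?mulr_ge0 //.
  rewrite ler_pdivrMl ?exprn_gt0 // -exprD.
  have -> : lam ^+ (m + 2) = 2^-1 ^+ k.
    rewrite /lam -expRM_natl addn2 /c0 -{2}(@lnK _ 2) ?posrE // -expRN -expRM_natl.
    by congr expR; field.
  rewrite lerXn2r ?nnegrE // /growth_rate GD.
    by rewrite !mulr_ge0 ?exprn_ge0 // ltW.
  exact: eps_growth.
pose h : R := expR (- (c0 * k%:R / 2)).
have lamE : lam = h ^+ 2 by rewrite /lam /h -expRM_natl; congr expR; field.
pose hr : R := expR (- (3 / 4 * c0 * r)).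
have hh : h <= expR c0 * hr by exact: decay_rate.
have S0 : 0 <= \sum_i Ex2 p (fun a b => dif F i a b ^+ 2 * `|dif F i (mix (preds i) a b) b|).
  by apply: sumr_ge0 => i _; apply: Ex2_ge0 => // a b; rewrite mulr_ge0 ?sqr_ge0.
have hS : \sum_i Ex2 p (fun a b => dif F i a b ^+ 2 * `|dif F i (mix (preds i) a b) b|)
    <= d * n * (8 * s4 ^+ 3).
  apply: (@le_trans _ _ (\sum_(i : edge G + G) 8 * s4 ^+ 3)).
    apply: ler_sum => i _; apply: le_trans (third_moment_le p0 p1 s40 (mom4 i) _).
      by apply: le_Ex2 => // a b; exact: third_increment.
    by rewrite s4E lerDr.
  rewrite sumr_const -[leLHS]mulr_natl ler_wpM2r ?mulr_ge0 ?exprn_ge0 ?(ltW s40) //.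
  by rewrite /d /n -natrM ler_nat -GD; exact: card_coords.
have hG := sqrt_variance_le (ltW d0) M40 (exprn_ge0 3 (ltW s40)) M4s _ kap1 (expR_ge0 _) (ler0n _ _) _ hvar.
rewrite s3E /wasserstein_rate -/n -/E -/B.
apply: (rate_collect E0 v0_gt0 d0 _ _ _ _ _ _ e0 e1 VE hh _ hS S0
  (normal_approximation p0 p1 V0 s e0 e1)); rewrite ?expR_ge0 ?exprn_ge0 ?sqrtr_ge0 ?(ltW s40) ?(ltW kap0) ?ler0n //.
by apply: hG; rewrite ?mulr_ge0 ?ler0n // -lamE.
Qed.

End Constants.
End DiscreteBound.

(** * Integrals of functions with finite range, and rounding to a grid *)

Section FiniteRange.
Context d (Y : measurableType d) (R : realType) (mu : probability Y R) (S : finType).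
Variable h : Y -> S.
Hypothesis mh : forall s, measurable (h @^-1` [set s]).
Implicit Type f : S -> R.

Lemma finite_range_indic f y : f (h y) = \sum_s f s * \1_(h @^-1` [set s]) y.
Proof.
rewrite (bigD1 (h y)) //= big1 => [|s ns].
  by rewrite addr0 indicE mem_set // mulr1.
by rewrite indicE memNset ?mulr0 //= => hs; rewrite hs eqxx in ns.
Qed.

Lemma measurable_finite_range f : measurable_fun setT (fun y => f (h y)).
Proof.
under eq_fun do rewrite finite_range_indic.
apply: measurable_sum => s; apply: measurable_funM; first exact: measurable_cst.
exact: measurable_indic.
Qed.

Let int_indic f s : mu.-integrable setT (fun y => (f s * \1_(h @^-1` [set s]) y)%:E).
Proof.
under eq_fun do rewrite EFinM.
by apply: integrableZl => //; exact: integrable_indic.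
Qed.

Lemma integrable_finite_range f : mu.-integrable setT (EFin \o (fun y => f (h y))).
Proof.
rewrite (_ : EFin \o _ = fun y => \sum_s (f s * \1_(h @^-1` [set s]) y)%:E)%E.
  by apply: integrable_sum => // s _; exact: int_indic.
by apply/funext => y; rewrite /= sumEFin -finite_range_indic.
Qed.

Lemma Rintegral_finite_range f :
  \int[mu]_y f (h y) = \sum_s fine (mu (h @^-1` [set s])) * f s.
Proof.
rewrite /Rintegral; under eq_integral do rewrite finite_range_indic -sumEFin.
rewrite integral_sum //.
have term s : (\int[mu]_y (f s * \1_(h @^-1` [set s]) y)%:E
               = (fine (mu (h @^-1` [set s])) * f s)%:E)%E.
  under eq_integral do rewrite EFinM.
  rewrite integralZl //; last exact: integrable_indic.
  rewrite integral_indic // setIT mulrC EFinM fineK //; exact: fin_num_measure.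
by under eq_bigr do rewrite term; rewrite sumEFin.
Qed.

Lemma sum_finite_range : \sum_s fine (mu (h @^-1` [set s])) = 1.
Proof.
have := Rintegral_finite_range (fun=> 1); under eq_bigr do rewrite mulr1.
move=> <-; have -> := Rintegral_cst mu measurableT 1.
by have /= -> := probability_setT mu; rewrite mul1r.
Qed.

End FiniteRange.

Section DominatedConvergence.
Context d (Y : measurableType d) (R : realType) (mu : probability Y R).

Lemma Rintegral_dominated (f_ : nat -> Y -> R) (f g : Y -> R) :
  (forall n, measurable_fun setT (f_ n)) -> (forall y, f_ n y @[n --> \oo] --> f y) ->
  mu.-integrable setT (EFin \o g) -> (forall n y, `|f_ n y| <= g y) ->
  [/\ measurable_fun setT f, mu.-integrable setT (EFin \o f) &
      (\int[mu]_y f_ n y) @[n --> \oo] --> \int[mu]_y f y].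
Proof.
move=> mf_ ff ig fg.
have mf : measurable_fun setT f by apply: (measurable_fun_cvg mf_) => y _; exact: ff.
have [] := @dominated_convergence _ _ _ mu setT measurableT
  (fun n => EFin \o f_ n) (EFin \o f) (EFin \o g).
- by move=> n; exact/measurable_EFinP.
- exact/measurable_EFinP.
- by apply: aeW => y _; apply: cvg_EFin; [exact: nearW|exact: ff].
- exact: ig.
- by apply: aeW => y n _; rewrite /= lee_fin.
move=> fint _ lim; split=> //.
apply: fine_cvg; rewrite fineK; first exact: lim.
exact: integrable_fin_num.
Qed.

End DominatedConvergence.

Section Discretisation.
Context {R : realType}.
Variable n : nat.
Local Notation N := (n.+1 * n.+1)%N.

Definition grid : finType := (bool * 'I_N.+1)%type.

(** Rounding towards 0 to a multiple of 1 / (n + 1), capped at absolute value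
    n + 1, so that absolute values do not increase. *)
Definition to_grid (x : R) : grid :=
  (x < 0, inord (minn (Num.truncn (n.+1%:R * `|x|)) N)).

Definition grid_value (t : grid) : R := (-1) ^+ t.1 * (t.2%:R / n.+1%:R).

Lemma measurable_to_grid t : measurable (to_grid @^-1` [set t]).
Proof.
case: t => b k; pose step (y : R) : R := (minn (Num.truncn y) N)%:R.
have -> : to_grid @^-1` [set (b, k)] =
    (fun x : R => x < 0) @^-1` [set b] `&` (fun x : R => step (n.+1%:R * `|x|)) @^-1` [set k%:R].
  apply/seteqP; split=> [x [<- <-]|x [/= <- /eqP]].
    by split => //=; rewrite /step inordK // ltnS geq_minr.
  rewrite /step eqr_nat => /eqP kE; congr pair; apply: val_inj.
  by rewrite /= kE inordK // -kE ltnS geq_minr.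
apply: measurableI.
  have mlt : measurable_fun setT (fun x : R => x < 0).
    by apply: measurable_fun_ltr => //; exact: measurable_cst.
  by rewrite -[_ @^-1` _]setTI; apply: mlt.
have mst : measurable_fun setT (fun x : R => step (n.+1%:R * `|x|)).
  apply: (measurableT_comp (f := step)).
    apply: nondecreasing_measurable => // x y xy; rewrite /step ler_nat.
    by rewrite leq_min geq_minr andbT (leq_trans (geq_minl _ _)) // le_truncn.
  apply: measurable_funM; first exact: measurable_cst.
  exact: normr_measurable.
by rewrite -[_ @^-1` _]setTI; apply: mst.
Qed.

Lemma grid_value_spec x : exists s : R, [/\ 0 <= s <= `|x|,
  `|x - grid_value (to_grid x)| = `|x| - s, `|grid_value (to_grid x)| = s &
  `|x| <= n.+1%:R -> `|x| - s <= n.+1%:R^-1].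
Proof.
have n0 : 0 < n.+1%:R :> R by rewrite ltr0n.
set k := minn (Num.truncn (n.+1%:R * `|x|)) N.
have y0 : 0 <= n.+1%:R * `|x| by rewrite mulr_ge0.
have /andP[t1 t2] := truncn_itv y0.
have kx : k%:R / n.+1%:R <= `|x|.
  rewrite ler_pdivrMr // mulrC; apply: le_trans t1.
  by rewrite ler_nat geq_minl.
exists (k%:R / n.+1%:R).
have gE : grid_value (to_grid x) = (-1) ^+ (x < 0)%R * (k%:R / n.+1%:R).
  by rewrite /grid_value /= inordK // ltnS geq_minr.
have xE : x = (-1) ^+ (x < 0)%R * `|x|.
  exact: realEsign (num_real x).
split.
- by rewrite kx divr_ge0.
- by rewrite gE {1}xE -mulrBr normrM normrX normrN1 expr1n mul1r ger0_norm // subr_ge0.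
- by rewrite gE normrM normrX normrN1 expr1n mul1r ger0_norm // divr_ge0.
move=> xn; have -> : k = Num.truncn (n.+1%:R * `|x|).
  apply/minn_idPl; rewrite -(ler_nat R); apply: (le_trans t1).
  by rewrite natrM ler_pM2l.
by rewrite lerBlDr -(ler_pM2l n0) mulrDr mulfV ?gt_eqF // mulrCA mulfV ?gt_eqF // mulr1 [leRHS]addrC natr1 ltW.
Qed.

Lemma grid_value_le x : `|grid_value (to_grid x)| <= `|x|.
Proof. by have [s [/andP[_ sx] _ -> _]] := grid_value_spec x. Qed.

Lemma grid_value_error x : `|x - grid_value (to_grid x)| <= (1 + x ^+ 2) / n.+1%:R.
Proof.
have n0 : 0 < n.+1%:R :> R by rewrite ltr0n.
have [s [/andP[s0 sx] -> _ xn]] := grid_value_spec x.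
have [/xn h|nx] := leP `|x| n.+1%:R.
  by apply: (le_trans h); rewrite -[leLHS]mul1r ler_pM2r ?invr_gt0 // lerDl sqr_ge0.
apply: (@le_trans _ _ `|x|); first by rewrite lerBlDr lerDl.
rewrite ler_pdivlMr // -real_normK ?num_real // expr2.
apply: (@le_trans _ _ (`|x| * `|x|)); last by rewrite lerDr.
by rewrite ler_wpM2l // ltW.
Qed.

End Discretisation.

Lemma near_div_small (R : realType) (B e : R) : 0 < e ->
  \forall n \near \oo, B / n.+1%:R <= e.
Proof.
move=> e0; near=> n; rewrite ler_pdivrMr ?ltr0n // mulrC -ler_pdivrMr //.
apply: (@le_trans _ _ n%:R); last by rewrite ler_nat.
near: n; exact: nbhs_infty_ger.
Unshelve. all: by end_near. Qed.

Lemma cvg_inv_rate (R : realType) (u : nat -> R) (l B : R) :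
  (forall n, `|l - u n| <= B / n.+1%:R) -> u n @[n --> \oo] --> l.
Proof.
move=> h; apply/cvgrPdist_le => e e0; near=> n.
by apply: (le_trans (h n)); near: n; exact: near_div_small.
Unshelve. all: by end_near. Qed.

Lemma cvg_sqr (R : realType) (u : nat -> R) (l : R) :
  u n @[n --> \oo] --> l -> u n ^+ 2 @[n --> \oo] --> l ^+ 2.
Proof. by move=> ul; rewrite expr2; under eq_fun do rewrite expr2; exact: cvgM. Qed.
Lemma integral_probability_cst d (Y : measurableType d) (R : realType) (mu : probability Y R)
  (k : R) : (\int[mu]_y k%:E = k%:E)%E.
Proof. by rewrite integral_cst //; have /= -> := probability_setT mu; rewrite mule1. Qed.

(** * The laws of the rounded weights *)

Section MarginalLaw.
Context {R : realType}.
Implicit Type mu : probability (measurableTypeR R) R.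

Lemma measurable_abs_pow k : measurable_fun setT (fun x : R => `|x| ^+ k).
Proof. by apply: measurable_funX; exact: normr_measurable. Qed.

Lemma emeasurable_abs_pow k :
  measurable_fun [set: measurableTypeR R] (fun x : measurableTypeR R => (`|x : R| ^+ k)%:E).
Proof. have := measurable_abs_pow k => /measurable_EFinP h; exact: h. Qed.

Lemma integrable_abs_pow mu k : (abs_moment mu k < +oo)%E ->
  mu.-integrable setT (EFin \o (fun x : R => `|x| ^+ k)).
Proof.
move=> h; apply/integrableP; split; first exact: emeasurable_abs_pow.
by under eq_integral do rewrite /= ger0_norm ?exprn_ge0 //.
Qed.

Lemma abs_moment_ge0 mu k : (0 <= abs_moment mu k)%E.
Proof. by apply: integral_ge0 => x _; rewrite lee_fin exprn_ge0. Qed.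

Lemma abs_moment2_le mu : (abs_moment mu 2 <= 1 + abs_moment mu 4)%E.
Proof.
have -> : 1%E = (\int[mu]_x (1%:E))%E by rewrite integral_probability_cst.
rewrite /abs_moment -ge0_integralD //; last exact: emeasurable_abs_pow.
apply: ge0_le_integral => //.
- exact: emeasurable_abs_pow.
- apply: emeasurable_funD => //; exact: emeasurable_abs_pow.
move=> x _; rewrite -EFinD lee_fin.
have := sqr_ge0 (`|x| ^+ 2 - 1); rewrite (exprM `|x| 2 2) => h.
have y0 : 0 <= `|x| ^+ 2 by exact: sqr_ge0.
by move: h y0; move: (`|x| ^+ 2) => y; nra.
Qed.

Definition grid_weight mu n (t : grid n) : R := fine (mu (@to_grid R n @^-1` [set t])).

Lemma grid_weight_ge0 mu n (t : grid n) : 0 <= grid_weight mu t.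
Proof. by rewrite fine_ge0. Qed.

Lemma sum_grid_weight mu n : \sum_(t : grid n) grid_weight mu t = 1.
Proof. exact: (sum_finite_range mu (@measurable_to_grid R n)). Qed.

Lemma grid_moment_le mu n k (K : R) : ~~ odd k -> (abs_moment mu k <= K%:E)%E ->
  \sum_(t : grid n) grid_weight mu t * grid_value t ^+ k <= K.
Proof.
move=> ek mK; have mfin : (abs_moment mu k < +oo)%E by rewrite (le_lt_trans mK) ?ltry.
rewrite -(Rintegral_finite_range mu (@measurable_to_grid R n) (fun t => grid_value t ^+ k)).
apply: (@le_trans _ _ (\int[mu]_x (`|x| ^+ k))).
  apply: le_Rintegral => //.
  - exact: (integrable_finite_range mu (@measurable_to_grid R n) (fun t => grid_value t ^+ k)).
  - exact: integrable_abs_pow.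
  move=> x _; rewrite -[leLHS]ger0_norm ?exprn_even_ge0 // normrX.
  by rewrite lerXn2r ?nnegrE // grid_value_le.
rewrite -lee_fin /Rintegral -/(abs_moment mu k) fineK // ge0_fin_numE //.
exact: abs_moment_ge0.
Qed.

(** Rounding moves x by at most (1 + x^2) / (n + 1), so E|X - X'| decreases by at
    most twice the mean of this. *)
Lemma grid_abs_diff mu n (K1 K2 : R) :
  (abs_moment mu 2 <= K1%:E)%E -> (K2%:E <= mean_abs_diff mu)%E ->
  K2 - 2 * ((1 + K1) / n.+1%:R) <=
  \sum_(s : grid n) \sum_(t : grid n)
     grid_weight mu s * grid_weight mu t * `|grid_value s - grid_value t|.
Proof.
move=> m2 md.
pose A (z : R * R) : R := `|grid_value (to_grid n z.1) - grid_value (to_grid n z.2)|.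
pose B (x : R) : R := (1 + `|x| ^+ 2) / n.+1%:R.
have B0 x : 0 <= B x by rewrite divr_ge0 // addr_ge0.
have mB : measurable_fun setT B.
  apply: measurable_funM; last exact: measurable_cst.
  by apply: measurable_funD; [exact: measurable_cst|exact: measurable_abs_pow].
pose h (z : R * R) : grid n * grid n := (to_grid n z.1, to_grid n z.2).
have hX s : h @^-1` [set s] = (@to_grid R n @^-1` [set s.1]) `*` (@to_grid R n @^-1` [set s.2]).
  by case: s => s t; apply/seteqP; split=> [z [<- <-]|z [/= <- <-]].
have mh s : measurable (h @^-1` [set s]).
  by rewrite hX; apply: measurableX; exact: measurable_to_grid.
pose phi (s : grid n * grid n) : R := `|grid_value s.1 - grid_value s.2|.
pose PP : probability _ R := (mu \x mu)%E.
have AE : (\int[mu \x mu]_z (A z)%:E)%E = (\sum_(s : grid n) \sum_(t : grid n)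
     grid_weight mu s * grid_weight mu t * `|grid_value s - grid_value t|)%:E.
  rewrite pair_big /=.
  have := Rintegral_finite_range PP mh phi; rewrite /Rintegral => /(congr1 (@EFin R)).
  rewrite fineK; last exact: integrable_fin_num (integrable_finite_range PP mh phi).
  move=> ->; congr EFin; apply: eq_bigr => -[s t] _ /=; congr (_ * _).
  rewrite hX /= [X in fine X = _]product_measure1E; [|exact: measurable_to_grid|exact: measurable_to_grid].
  by rewrite fineM // fin_num_measure //; exact: measurable_to_grid.
have mA : measurable_fun setT A by exact: (measurable_finite_range mh phi).
have mB1 : measurable_fun setT (fun z : R * R => B z.1) by exact: (measurableT_comp mB).
have mB2 : measurable_fun setT (fun z : R * R => B z.2) by exact: (measurableT_comp mB).
have intB : (\int[mu]_x (B x)%:E <= ((1 + K1) / n.+1%:R)%:E)%E.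
  under eq_integral do rewrite EFinM EFinD.
  rewrite ge0_integralZr //; first last.
  - by move=> x _; rewrite -EFinD lee_fin addr_ge0.
  - by apply: emeasurable_funD => //; exact: emeasurable_abs_pow.
  rewrite ge0_integralD //; first last.
  - exact: emeasurable_abs_pow.
  rewrite integral_probability_cst EFinM EFinD.
  by rewrite lee_wpmul2r ?lee_fin // leeD2l.
have B1E : (\int[mu \x mu]_z (B z.1)%:E = \int[mu]_x (B x)%:E)%E.
  rewrite fubini_tonelli1 //; first last.
  - by move=> x; rewrite lee_fin.
  - exact/measurable_EFinP.
  by apply: eq_integral => x _; rewrite /fubini_F /= integral_probability_cst.
have B2E : (\int[mu \x mu]_z (B z.2)%:E = \int[mu]_x (B x)%:E)%E.
  rewrite fubini_tonelli1 //; first last.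
  - by move=> x; rewrite lee_fin.
  - exact/measurable_EFinP.
  have Bfin : (\int[mu]_x (B x)%:E)%E \is a fin_num.
    rewrite ge0_fin_numE; first by rewrite (le_lt_trans intB) ?ltry.
    by apply: integral_ge0 => x _; rewrite lee_fin.
  by rewrite /fubini_F /= -(fineK Bfin) integral_probability_cst.
rewrite lerBlDr -lee_fin; apply: (le_trans md).
apply: (@le_trans _ _ (\int[mu \x mu]_z ((A z)%:E + ((B z.1)%:E + (B z.2)%:E)))%E).
  apply: ge0_le_integral => //.
  - apply/measurable_EFinP; apply: (measurableT_comp (@normr_measurable R setT)).
    exact: measurable_funB.
  - apply: emeasurable_funD; first exact/measurable_EFinP.
    by apply: emeasurable_funD; exact/measurable_EFinP.
  move=> [x y] _; rewrite -!EFinD lee_fin /A /B /=.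
  have := grid_value_error n x; have := grid_value_error n y.
  rewrite !real_normK ?num_real //.
  move: (grid_value _) (grid_value _) ((1 + x ^+ 2) / _) ((1 + y ^+ 2) / _) => a b p q h1 h2.
  have -> : x - y = (a - b) + ((x - a) - (y - b)) by rewrite opprB; ring.
  apply: (le_trans (ler_normD _ _)); rewrite lerD2l.
  by apply: (le_trans (ler_normB _ _)); exact: lerD.
rewrite ge0_integralD //; first last.
- by apply: emeasurable_funD; exact/measurable_EFinP.
- by move=> z _; rewrite -EFinD lee_fin addr_ge0.
- exact/measurable_EFinP.
- by move=> z _; rewrite lee_fin /A.
rewrite ge0_integralD //; first last.
- exact/measurable_EFinP.
- by move=> z _; rewrite lee_fin.
- exact/measurable_EFinP.
- by move=> z _; rewrite lee_fin.
rewrite AE B1E B2E EFinD leeD2l // mulrDl mul1r EFinD.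
by apply: leeD.
Qed.

End MarginalLaw.

Section JointLaw.
Context {R : realType} (G : sgraph) (d : measure_display) (Omega : measurableType d).
Variables (P : probability Omega R) (mue muv : probability (measurableTypeR R) R).
Variables (w : edge G -> {RV P >-> R}) (nu : G -> {RV P >-> R}).
Hypothesis dw : disordered_weights mue muv w nu.

Definition weight_rv (c : edge G + G) : {RV P >-> R} :=
  match c with inl e => w e | inr x => nu x end.

Definition weight_law (c : edge G + G) : probability (measurableTypeR R) R :=
  match c with inl _ => mue | inr _ => muv end.

Lemma weight_rv_law c A : measurable A -> P (weight_rv c @^-1` A) = weight_law c A.
Proof. by case: dw => h1 h2 _ mA; case: c => [e|x]; [exact: h1|exact: h2]. Qed.

Definition grid_config n (t : Omega) : {ffun edge G + G -> grid n} :=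
  [ffun c => to_grid n (weight_rv c t)].

Lemma grid_config_fibre n a : grid_config n @^-1` [set a] =
  \bigcap_(c in [set` [set: edge G + G]%SET]) weight_rv c @^-1` (@to_grid R n @^-1` [set a c]).
Proof.
apply/seteqP; split=> [t /= <- c _|t h] /=; first by rewrite ffunE.
by apply/ffunP => c; rewrite ffunE; apply: h; rewrite /= inE.
Qed.

Lemma measurable_grid_config n a : measurable (grid_config n @^-1` [set a]).
Proof.
rewrite grid_config_fibre; apply: fin_bigcap_measurable => // c _.
rewrite -[_ @^-1` _]setTI; apply: measurable_funP => //.
exact: measurable_to_grid.
Qed.

Lemma grid_config_prob n a : fine (P (grid_config n @^-1` [set a])) =
  cweight (fun c => @grid_weight R (weight_law c) n) a.
Proof.
rewrite grid_config_fibre; case: dw => _ _ ind.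
have := ind [set: edge G + G]%SET (fun c => @to_grid R n @^-1` [set a c])
  (fun c => measurable_to_grid (a c)).
rewrite -/weight_rv => ->.
rewrite (eq_bigr (fun c => (grid_weight (weight_law c) (a c))%:E)).
  by rewrite prodEFin /= /cweight; apply: eq_bigl => c; rewrite inE.
move=> c _; rewrite (weight_rv_law c (measurable_to_grid (a c))).
by rewrite fineK // fin_num_measure //; exact: measurable_to_grid.
Qed.

Lemma Ex_grid n f : Ex (fun c => @grid_weight R (weight_law c) n) f
  = \int[P]_t f (grid_config n t).
Proof.
rewrite (Rintegral_finite_range P (@measurable_grid_config n) f) /Ex /fexp.
by apply: eq_bigr => a _; rewrite grid_config_prob.
Qed.

(** The laws live on R with the sigma-algebra generated by half-open intervals, the
   random variables take values in R with its Borel structure: the two structures have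
   the same sets, but different displays. *)
Let measurable_borel c : measurable_fun [set: Omega] (weight_rv c : Omega -> measurableTypeR R).
Proof. by have := measurable_funPT (weight_rv c). Qed.

Let borel_rv c : {mfun Omega >-> measurableTypeR R} :=
  HB.pack (weight_rv c : Omega -> measurableTypeR R)
    (isMeasurableFun.Build _ _ Omega (measurableTypeR R) _ (measurable_borel c)).

Lemma weight_moment c k : (\int[P]_t (`|weight_rv c t| ^+ k)%:E = abs_moment (weight_law c) k)%E.
Proof.
have <- := @ge0_integral_distribution _ _ _ _ _ P (borel_rv c) _ (@emeasurable_abs_pow R k).
  exact: (@eq_measure_integral _ (measurableTypeR R) R setT (weight_law c)
    (distribution P (borel_rv c)) _ (fun A mA _ => weight_rv_law c mA)).
by move=> x; rewrite lee_fin exprn_ge0.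
Qed.

End JointLaw.

(** * Passage to general laws *)

Section Approximation.
Context {R : realType}.

Lemma logZ_lipschitz_sum (G : sgraph) (z z' : edge G + G -> R) :
  `|logZ z - logZ z'| <= \sum_c `|z c - z' c|.
Proof.
pose h (s : seq (edge G + G)) c := if c \in s then z' c else z c.
have hs s : `|logZ z - logZ (h s)| <= \sum_(c <- s) `|z c - z' c|.
  elim: s => [|c s IH].
    by rewrite big_nil (_ : h [::] = z) ?subrr ?normr0 //; apply/funext.
  rewrite big_cons [leRHS]addrC -(subrKA (logZ (h s)) (logZ z) (- logZ (h (c :: s)))).
  apply: (le_trans (ler_normD _ _)); apply: lerD => //.
  apply: (@le_trans _ _ `|h s c - h (c :: s) c|).
    by apply: logZ_lipschitz => c' /negPf cc; rewrite /h inE cc.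
  rewrite {2}/h mem_head /h; case: ifP => // _.
  by rewrite subrr normr0.
have := hs (index_enum _); rewrite (_ : h _ = z') //.
by apply/funext => c; rewrite /h mem_index_enum.
Qed.

Lemma sqr_sum_le (I : Type) (s : seq I) (x : I -> R) :
  (\sum_(i <- s) x i) ^+ 2 <= 2 ^+ size s * \sum_(i <- s) x i ^+ 2.
Proof.
elim: s => [|i s IH]; first by rewrite !big_nil mulr0 expr0n.
rewrite !big_cons /= [2 ^+ _.+1]exprS.
set S := \sum_(_ <- s) _ in IH *; set S2 := \sum_(_ <- s) _ in IH *.
have t1 : 1 <= 2 ^+ size s :> R by rewrite exprn_ege1 ?ler1n.
have x2 := sqr_ge0 (x i).
apply: (@le_trans _ _ (2 * x i ^+ 2 + 2 * S ^+ 2)).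
  by have := sqr_ge0 (x i - S); clear; nra.
rewrite -mulrA mulrDr mulrDr; apply: lerD; last by rewrite ler_pM2l.
by rewrite ler_pM2l // ler_peMl.
Qed.

End Approximation.

Section SmoothBound.
Context {R : realType}.

Lemma expectationE d (Omega : measurableType d) (P : probability Omega R) (F : Omega -> R) :
  fine 'E_P[F] = \int[P]_t F t.
Proof. by rewrite unlock. Qed.

Lemma varianceRE d (Omega : measurableType d) (P : probability Omega R) (F : Omega -> R) :
  P.-integrable setT (EFin \o F) -> P.-integrable setT (EFin \o (fun t => F t ^+ 2)) ->
  fine 'V_P[F] = \int[P]_t (F t ^+ 2) - (\int[P]_t F t) ^+ 2.
Proof.
move=> iF iF2; set M := \int[P]_t F t.
have -> : fine 'V_P[F] = \int[P]_t (F t ^+ 2 - 2 * M * F t + M ^+ 2).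
  rewrite /variance covariance.unlock expectationE; apply: eq_Rintegral => t _ /=.
  by rewrite expectationE -/M /= mulrfctE /=; ring.
have iM : P.-integrable setT (EFin \o (fun t => 2 * M * F t)).
  by apply: (integrableZl _ _ iF).
have ic : P.-integrable setT (EFin \o (fun=> M ^+ 2)).
  exact: finite_measure_integrable_cst.
rewrite RintegralD //; last exact: (integrableB _ iF2 iM).
rewrite RintegralB // RintegralZl // Rintegral_cst // -/M.
have /= -> := probability_setT P; rewrite mulr1.
by ring.
Qed.

(** For each n, [discrete_clt] applies to the rounded weights, with constants that do
    not depend on n.  The rounded free energies converge pointwise and, being Lipschitz
    in the weights, are dominated by a square-integrable variable; so their means,
    variances and the means of ramps converge. *)
Lemma smooth_clt (D : nat) (K1 K2 : R) : 0 < K1 -> 0 < K2 ->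
  exists c C : R, [/\ 0 < c, 0 < C &
  forall mue muv : probability (measurableTypeR R) R,
    (abs_moment mue 4 < +oo)%E -> (abs_moment muv 4 < +oo)%E ->
    (abs_moment mue 2 <= K1%:E)%E -> (abs_moment muv 2 <= K1%:E)%E ->
    (K2%:E <= mean_abs_diff mue)%E ->
  forall G : sgraph, max_degree G = D -> edge_set G != finset.set0 ->
  forall (d : measure_display) (Omega : measurableType d) (P : probability Omega R)
    (w : edge G -> {RV P >-> R}) (nu : G -> {RV P >-> R}),
    disordered_weights mue muv w nu ->
  measurable_fun setT (random_free_energy w nu) /\
  forall r s e : R, 1 <= r -> 0 < e -> e <= 1 ->
    `|\int[P]_t ramp s e (standardized P (random_free_energy w nu) t) - gauss_mean (ramp s e)|
    <= C * (1 + (fine (abs_moment mue 4) + fine (abs_moment muv 4))) `^ (3 / 4)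
       * wasserstein_rate G c r / e].
Proof.
move=> K10 K20; have K22 : 0 < K2 / 2 by rewrite divr_gt0.
have [c [C [v0 [c0 C0 v00 dclt]]]] := discrete_clt D K10 K22.
exists c, C; split=> // mue muv e4 v4 e2 v2 md G GD Gne d Omega P w nu dw.
pose X := weight_rv w nu.
pose law := (fun i : edge G + G => weight_law mue muv i).
pose F t := logZ (fun i => X i t).
have FE : random_free_energy w nu = F by [].
pose p n (i : edge G + G) : grid n -> R := @grid_weight R (law i) n.
pose L n := @logZ_of G R (grid n) (@grid_value R n).
pose F_ n t := L n (grid_config w nu n t).
have LE n f : Ex (p n) f = \int[P]_t f (grid_config w nu n t) by exact: Ex_grid.
have p0 n i t : 0 <= p n i t by exact: grid_weight_ge0.
have p1 n i : \sum_t p n i t = 1 by exact: sum_grid_weight.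
have mgrid n (f : _ -> R) : measurable_fun setT (fun t => f (grid_config w nu n t)).
  exact: (measurable_finite_range (@measurable_grid_config _ _ _ _ P w nu n) f).
pose M4 := fine (abs_moment mue 4) + fine (abs_moment muv 4).
have m4 i : (abs_moment (law i) 4 <= M4%:E)%E.
  have ge0 mu : (0 <= fine (abs_moment (R := R) mu 4)) by rewrite fine_ge0 // abs_moment_ge0.
  have e4f : abs_moment mue 4 \is a fin_num by rewrite ge0_fin_numE // abs_moment_ge0.
  have v4f : abs_moment muv 4 \is a fin_num by rewrite ge0_fin_numE // abs_moment_ge0.
  by case: i => [e|v]; rewrite -[leLHS]fineK // lee_fin /M4 ?lerDl ?lerDr.
have m2 i : (abs_moment (law i) 2 <= K1%:E)%E by case: i.
have disc n : 2 * ((1 + K1) / n.+1%:R) <= K2 / 2 ->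
    let V := \int[P]_t F_ n t ^+ 2 - (\int[P]_t F_ n t) ^+ 2 in
    #|edge_set G|%:R * v0 <= V /\
    forall r s e : R, 1 <= r -> 0 < e -> e <= 1 ->
    `|\int[P]_t ramp s e ((F_ n t - \int[P]_t F_ n t) / Num.sqrt V) - gauss_mean (ramp s e)|
    <= C * (1 + M4) `^ (3 / 4) * wasserstein_rate G c r / e.
  move=> nK V.
  have EL : Ex (p n) (L n) = \int[P]_t F_ n t by exact: LE.
  have VL : fvar (cweight (p n)) (L n) = V.
    rewrite fvarE; last exact: sum_cweight.
    by rewrite -/(Ex (p n) (L n)) EL -/(Ex (p n) (fun a => L n a ^+ 2)) LE.
  have m2n i : \sum_t p n i t * grid_value t ^+ 2 <= K1 by exact: grid_moment_le.
  have m4n i : \sum_t p n i t * grid_value t ^+ 4 <= M4 by exact: grid_moment_le.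
  have mdn (e : edge G) : K2 / 2 <= \sum_s \sum_t
      p n (inl e) s * p n (inl e) t * `|grid_value s - grid_value t|.
    have := grid_abs_diff n (m2 (inl e)) md; apply: le_trans.
    by rewrite lerBrDr -lerBrDl; apply: (le_trans nK); move: (K2); clear; move=> k; lra.
  have := dclt G GD Gne (grid n) (false, ord0) (p n) (@grid_value R n) M4
    (@p0 n) (@p1 n) m2n mdn m4n.
  rewrite -/(L n) VL EL => -[h1 h2]; split=> // r s e r1 e0 e1.
  by have := h2 r s e r1 e0 e1; rewrite LE.
pose o (_ : edge G + G) : R := 0.
pose k : R := 2 * 2 ^+ size (index_enum (edge G + G)%type).
pose Q t := 2 * logZ o ^+ 2 + k * \sum_i `|X i t| ^+ 2.
have iX i : P.-integrable setT (EFin \o (fun t => `|X i t| ^+ 2)).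
  apply/integrableP; split.
    apply/measurable_EFinP; apply: measurable_funX.
    by apply: measurableT_comp; [exact: normr_measurable|exact: measurable_funPT].
  under eq_integral do rewrite /= ger0_norm ?exprn_ge0 //.
  by rewrite (weight_moment dw) (le_lt_trans (m2 i)) ?ltry.
have icst b : P.-integrable setT (EFin \o (fun=> b : R)) by exact: finite_measure_integrable_cst.
have iQ : P.-integrable setT (EFin \o Q).
  have iS : P.-integrable setT (EFin \o (fun t => \sum_i `|X i t| ^+ 2)).
    rewrite (_ : EFin \o _ = fun t => \sum_i (`|X i t| ^+ 2)%:E)%E.
      by apply: integrable_sum => // i _; exact: iX.
    by apply/funext => t; rewrite /= sumEFin.
  have iZ : P.-integrable setT (EFin \o (fun t => k * \sum_i `|X i t| ^+ 2)).
    by apply: (integrableZl _ _ iS).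
  exact: (integrableD measurableT (icst (2 * logZ o ^+ 2)) iZ).
have FQ n t : `|F_ n t| ^+ 2 <= Q t.
  have h : `|F_ n t| <= `|logZ o| + \sum_i `|X i t|.
    rewrite -lerBlDl; apply: (le_trans (lerB_dist _ _)).
    apply: (le_trans (logZ_lipschitz_sum _ _)); apply: ler_sum => i _.
    by rewrite subr0 /weights ffunE; exact: grid_value_le.
  have := sqr_sum_le (index_enum (edge G + G)%type) (fun i => `|X i t|).
  have S0 : 0 <= \sum_i `|X i t| by apply: sumr_ge0.
  rewrite /Q /k -mulrA -[logZ _ ^+ 2]real_normK ?num_real //.
  move: h S0 (normr_ge0 (F_ n t)) (normr_ge0 (logZ o)).
  move: `|F_ n t| `|logZ _| (\sum_i `|X i t|) (2 ^+ _ * _) => a b x y ab x0 a0 b0 xy.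
  apply: (@le_trans _ _ ((b + x) ^+ 2)); first by rewrite lerXn2r ?nnegrE ?addr_ge0.
  apply: (@le_trans _ _ (2 * b ^+ 2 + 2 * x ^+ 2)); last by rewrite lerD2l ler_pM2l.
  by have := sqr_ge0 (b - x); clear; nra.
have Fcvg t : F_ n t @[n --> \oo] --> F t.
  apply: (@cvg_inv_rate _ _ _ (\sum_i (1 + X i t ^+ 2))) => n.
  apply: (le_trans (logZ_lipschitz_sum _ _)); rewrite mulr_suml; apply: ler_sum => i _.
  by rewrite /weights ffunE; exact: grid_value_error.
have F1 n t : `|F_ n t| <= 1 + Q t.
  have := FQ n t; move: `|F_ n t| (Q t) (normr_ge0 (F_ n t)) => a b a0 ab.
  by have := sqr_ge0 (a - 1); move: ab a0; clear; nra.
have [mF iF limM] := Rintegral_dominated (fun n => mgrid n (L n)) Fcvg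
  (integrableD measurableT (icst 1) iQ) F1.
have F2cvg t : F_ n t ^+ 2 @[n --> \oo] --> F t ^+ 2.
  by apply: cvg_sqr; exact: Fcvg.
have FQ2 n t : `|F_ n t ^+ 2| <= Q t by rewrite normrX.
have [_ iF2 limS] := Rintegral_dominated (fun n => mgrid n (fun a => L n a ^+ 2)) F2cvg iQ FQ2.
split; first exact: mF.
pose M := \int[P]_t F t; pose V := \int[P]_t (F t ^+ 2) - M ^+ 2.
pose M_ n := \int[P]_t F_ n t; pose V_ n := \int[P]_t (F_ n t ^+ 2) - M_ n ^+ 2.
have limV : V_ n @[n --> \oo] --> V.
  apply: cvgB; first exact: limS.
  by apply: cvg_sqr; exact: limM.
have nlarge : \forall n \near \oo, 2 * ((1 + K1) / n.+1%:R) <= K2 / 2.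
  by apply: filterS (near_div_small (2 * (1 + K1)) K22) => n; rewrite mulrA.
have V0 : 0 < V.
  apply: (@lt_le_trans _ _ (#|edge_set G|%:R * v0)); first by rewrite mulr_gt0 // ltr0n card_gt0.
  apply: (ler_cvg_to (cvg_cst _) limV).
  by apply: filterS nlarge => n /disc[].
move=> r s e r1 e0 e1.
have sV0 : Num.sqrt V != 0 by rewrite gt_eqF // sqrtr_gt0.
have limsV : Num.sqrt (V_ n) @[n --> \oo] --> Num.sqrt V.
  by apply: continuous_cvg limV; exact: sqrt_continuous.
pose W n t := (F_ n t - M_ n) / Num.sqrt (V_ n).
have Wcvg t : ramp s e (W n t) @[n --> \oo] --> ramp s e ((F t - M) / Num.sqrt V).
  apply: continuous_cvg; first exact: ramp_continuous.
  by apply: cvgM; [apply: cvgB; [exact: Fcvg|exact: limM]|exact: cvgV].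
have Wb n t : `|ramp s e (W n t)| <= 1 by have /andP[h1 h2] := ramp_bounds s e (W n t); rewrite ger0_norm.
have [_ _ limR] := Rintegral_dominated
  (fun n => mgrid n (fun a => ramp s e ((L n a - M_ n) / Num.sqrt (V_ n)))) Wcvg (icst 1) Wb.
have -> : standardized P (random_free_energy w nu) = fun t => (F t - M) / Num.sqrt V.
  by apply/funext => t; rewrite /standardized FE expectationE varianceRE.
have limB : `|\int[P]_t ramp s e (W n t) - gauss_mean (ramp s e)| @[n --> \oo]
    --> `|\int[P]_t ramp s e ((F t - M) / Num.sqrt V) - gauss_mean (ramp s e)|.
  apply: cvg_norm; apply: cvgB; [exact: limR|exact: cvg_cst].
apply: (ler_cvg_to limB (cvg_cst _)).
by apply: filterS nlarge => n /disc[_ clt_n]; exact: clt_n.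
Qed.

End SmoothBound.

(** * Positivity of the mean absolute difference *)

Section NonDegenerate.
Context {R : realType}.
Implicit Type mu : probability (measurableTypeR R) R.

Lemma integral_eq0_ae d (Y : measurableType d) (P : probability Y R) (f : Y -> \bar R) :
  measurable_fun setT f -> (forall y, 0 <= f y)%E -> (\int[P]_y f y = 0)%E ->
  exists B, [/\ measurable B, P B = 0%E & forall y, ~ B y -> f y = 0%E].
Proof.
move=> mf f0 If; have : (\int[P]_y `|f y| = 0)%E.
  by under eq_integral do rewrite gee0_abs //.
move/(ae_eq_integral_abs P measurableT mf) => [B [mB B0 sub]].
exists B; split=> // y nB; apply: contrapT => fy; apply: nB; apply: sub => /= h.
exact: fy (h I).
Qed.

Lemma integral_eq0_ex d (Y : measurableType d) (P : probability Y R) (f : Y -> \bar R) :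
  measurable_fun setT f -> (forall y, 0 <= f y)%E -> (\int[P]_y f y = 0)%E ->
  exists y, f y = 0%E.
Proof.
move=> mf f0 /(integral_eq0_ae mf f0)[B [mB B0 Bf]]; apply: contrapT => nf.
have BT : B = setT.
  by apply/seteqP; split=> // y _; apply: contrapT => /Bf fy; apply: nf; exists y.
move: B0; rewrite BT; have /= -> := probability_setT P; move/eqP.
by rewrite onee_eq0.
Qed.

(** By Tonelli's theorem the mean of |a - X| vanishes for some a, and X = a almost
    surely. *)
Lemma mean_abs_diff_eq0 mu : mean_abs_diff mu = 0%E -> point_mass mu.
Proof.
pose f (z : measurableTypeR R * measurableTypeR R) : \bar R := `|z.1 - z.2|%:E.
have mf : measurable_fun setT f.
  apply/measurable_EFinP; apply: (measurableT_comp (@normr_measurable R setT)).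
  exact: measurable_funB.
have f0 z : (0 <= f z)%E by rewrite lee_fin.
rewrite /mean_abs_diff (fubini_tonelli1 f mf f0).
case/integral_eq0_ex => [||a fa]; first exact: measurable_fun_fubini_tonelli_F.
  by move=> x; apply: integral_ge0 => y _; exact: f0.
have mfa : measurable_fun setT (fun y => f (a, y)).
  exact: (measurableT_comp mf (pair1_measurable a)).
have [B [mB B0 Bf]] := integral_eq0_ae mfa (fun y => f0 (a, y)) fa.
have eqa y : ~ B y -> y = a.
  by move=> /Bf[] /eqP; rewrite normr_eq0 subr_eq0 => /eqP.
exists a => A mA; rewrite diracE; case: (boolP (a \in A)) => [|] aA.
  have -> : mu A = (1 - mu (~` A))%E by rewrite -(probability_setC mu) ?setCK //; exact: measurableC.
  suff -> : mu (~` A) = 0%E by rewrite sube0.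
  apply: (subset_measure0 _ mB _ B0); first exact: measurableC.
  move=> y nA; apply: contrapT => /eqa ya; apply: nA; rewrite ya; exact: set_mem.
apply: (subset_measure0 _ mB _ B0) => // y Ay; apply: contrapT => /eqa ya.
by move: aA; rewrite -ya; move/negP; apply; exact: mem_set.
Qed.

Lemma mean_abs_diff_gt0 mu : ~ point_mass mu ->
  exists2 K : R, 0 < K & (K%:E <= mean_abs_diff mu)%E.
Proof.
move=> npm; have d0 : (0 <= mean_abs_diff mu)%E.
  by apply: integral_ge0 => z _; rewrite lee_fin.
have dn0 : mean_abs_diff mu != 0%E.
  by apply/eqP => /mean_abs_diff_eq0.
have [dfin|] := boolP (mean_abs_diff mu \is a fin_num).
  exists (fine (mean_abs_diff mu)); last by rewrite fineK.
  by rewrite fine_gt0 // lt0e dn0 d0 /= ltey_eq dfin.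
rewrite ge0_fin_numE // -leNgt leye_eq => /eqP ->.
by exists 1; rewrite ?ltr01 ?leey.
Qed.

End NonDegenerate.

(** * From ramp functions to the Kolmogorov distance *)

Section Smoothing.
Context {R : realType} (d : measure_display) (Omega : measurableType d).
Variables (P : probability Omega R) (X : Omega -> R).
Hypothesis mX : measurable_fun setT X.

Let mle s : measurable [set t | X t <= s].
Proof.
rewrite -[[set t | _]]setTI.
by apply: measurable_fun_le => //; exact: measurable_cst.
Qed.

Let cdf_indic s : fine (P [set t | X t <= s]) = \int[P]_t \1_[set t | X t <= s] t.
Proof. by rewrite /Rintegral integral_indic // setIT. Qed.

Let iramp s e : 0 < e -> P.-integrable setT (EFin \o (fun t => ramp s e (X t))).
Proof.
move=> e0; have mr : measurable_fun setT (fun t => ramp s e (X t)).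
  apply: (measurableT_comp (f := ramp s e)) => //.
  exact: (continuous_measurable_fun (ramp_continuous e0)).
have ic : P.-integrable setT (EFin \o (fun=> 1 : R)) by exact: finite_measure_integrable_cst.
apply: (le_integrable measurableT _ _ ic).
  exact/measurable_EFinP.
move=> t _; rewrite /= lee_fin; have /andP[h1 h2] := ramp_bounds s e (X t).
by rewrite !ger0_norm.
Qed.

Lemma cdf_le_ramp s e : 0 < e -> fine (P [set t | X t <= s]) <= \int[P]_t ramp s e (X t).
Proof.
move=> e0; rewrite cdf_indic; apply: le_Rintegral => //; first exact: integrable_indic.
  exact: iramp.
move=> t _; rewrite indicE; case: (boolP (t \in _)) => [|_].
  by rewrite inE /= => Xs; rewrite ramp_eq1.
by have /andP[] := ramp_bounds s e (X t).
Qed.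

Lemma ramp_le_cdf s e : 0 < e -> \int[P]_t ramp (s - e) e (X t) <= fine (P [set t | X t <= s]).
Proof.
move=> e0; rewrite cdf_indic; apply: le_Rintegral => //; last first.
- move=> t _; rewrite indicE; case: (boolP (t \in _)) => [_|].
    by have /andP[] := ramp_bounds (s - e) e (X t).
  move/negP; rewrite inE /= => /negP; rewrite -ltNge => sX.
  by rewrite ramp_eq0 // subrK ltW.
- exact: integrable_indic.
- exact: iramp.
Qed.

(** The indicator of X <= s lies between the ramps that start at s - e and at s, and
    the Gaussian distribution function is 1-Lipschitz, so the distance at s is at most
    e + A / e.  The choice e = sqrt A requires A <= 1; for larger A the bound exceeds
    1. *)
Lemma kolmogorov_le_sqrt (A : R) : 0 < A ->
  (forall s e : R, 0 < e -> e <= 1 ->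
     `|\int[P]_t ramp s e (X t) - gauss_mean (ramp s e)| <= A / e) ->
  (kolmogorov_to_gaussian P X <= (2 * Num.sqrt A)%:E)%E.
Proof.
move=> A0 smooth; apply: ge_ereal_sup => _ [s _ <-].
have Pfin : P [set t | X t <= s] \is a fin_num by exact: fin_num_measure.
rewrite -(fineK Pfin) -(fineK (gaussian_cdf_fin s)) -EFinB lee_fin.
set p := fine _; set phi := fine _.
have p01 : 0 <= p <= 1.
  by rewrite fine_ge0 //= -lee_fin fineK // probability_le1.
have f01 : 0 <= phi <= 1.
  rewrite fine_ge0 //= ?measure_ge0 // -lee_fin fineK ?gaussian_cdf_fin //.
  exact: probability_le1.
have sA : 0 < Num.sqrt A by rewrite sqrtr_gt0.
have [A1|A1] := leP 1 A.
  have s1 : 1 <= Num.sqrt A by rewrite -[leLHS]sqrtr1 ler_wsqrtr.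
  move: p01 f01 => /andP[p1 p2] /andP[f1 f2]; rewrite ler_norml; apply/andP.
  by move: s1; clear -p1 p2 f1 f2; move: (Num.sqrt A); split; lra.
have e1 : Num.sqrt A <= 1 by rewrite -[leRHS]sqrtr1 ler_wsqrtr // ltW.
have Ae : A / Num.sqrt A = Num.sqrt A by rewrite -{1}(sqr_sqrtr (ltW A0)) expr2 mulfK // gt_eqF.
have := smooth s _ sA e1; have := smooth (s - Num.sqrt A) _ sA e1; rewrite Ae.
have := cdf_le_ramp s sA; have := ramp_le_cdf s sA.
have /andP[_] := gauss_mean_ramp s sA; have /andP[] := gauss_mean_ramp (s - Num.sqrt A) sA.
have := gaussian_cdf_lipschitz s (ltW sA); have := gaussian_cdf_lipschitz (s - Num.sqrt A) (ltW sA).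
rewrite subrK -/p -/phi !ler_norml.
set u := \int[P]_t _; set v := \int[P]_t _; set q := Num.sqrt A.
set a := gauss_mean _; set b := gauss_mean _; set g := fine _; set h := fine _.
clearbody p phi u v q a b g h.
move=> h1 h2 h3 h4 h5 h6 h7 /andP[h8 h9] /andP[h10 h11].
by apply/andP; split; lra.
Qed.

End Smoothing.

(** * The rate of convergence *)

Section Rate.
Context {R : realType}.

Lemma sqrt_powR (x : R) : 0 <= x -> Num.sqrt x = x `^ (1 / 2).
Proof. by move=> x0; rewrite div1r powR12_sqrt. Qed.

Lemma sqrt_wasserstein_rate (G : sgraph) (c r : R) :
  Num.sqrt (wasserstein_rate G c r) <= clt_rate G (c / 2) r.
Proof.
rewrite /wasserstein_rate /clt_rate.
set n : R := #|G|%:R; set E : R := #|edge_set G|%:R; set B : R := (volume_growth G _)%:R.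
have n0 : 0 <= n by []; have E0 : 0 <= E by []; have B0 : 0 <= B by [].
have h4 : 1 / 2 * (1 / 2) = 1 / 4 :> R by field.
have sqrtV (x : R) : 0 <= x -> Num.sqrt x^-1 = (x `^ (1 / 2))^-1.
  by move=> x0; rewrite sqrtrV // sqrt_powR.
apply: (le_trans (sqrtrD_le _ _)).
- by rewrite addr_ge0 // !mulr_ge0 ?invr_ge0 ?sqrtr_ge0 ?expR_ge0.
- by rewrite !mulr_ge0 ?invr_ge0 ?mulr_ge0 ?sqrtr_ge0.
apply: lerD; first apply: (le_trans (sqrtrD_le _ _)).
- by rewrite !mulr_ge0 ?invr_ge0 ?sqrtr_ge0.
- by rewrite !mulr_ge0 ?invr_ge0 ?expR_ge0.
- apply: lerD.
    rewrite sqrtrM ?sqrtr_ge0 // sqrtV // (sqrt_powR (sqrtr_ge0 _)) sqrt_powR ?mulr_ge0 //.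
    by rewrite -powRrM h4 powRM // mulrAC.
  rewrite sqrtrM ?mulr_ge0 ?expR_ge0 // sqrtV // sqrtrM // sqrt_powR // mulrAC.
  rewrite (sqrt_powR (expR_ge0 _)) -expRM.
  by rewrite (_ : - (c * r) * (1 / 2) = - (c / 2 * r)) //; field.
rewrite sqrtrM // sqrtV ?mulr_ge0 ?sqrtr_ge0 // sqrt_powR //.
rewrite powRM ?sqrtr_ge0 // (sqrt_powR E0) -powRrM h4.
have [->|En] := eqVneq E 0; first by rewrite !powR0 ?mul0r //; apply/eqP; lra.
by rewrite -powRD ?En ?implybT // (_ : 1 / 2 + 1 / 4 = 3 / 4) //; field.
Qed.

End Rate.

Lemma wasserstein_rate_gt0 (R : realType) (G : sgraph) (c r : R) :
  edge_set G != finset.set0 -> 0 < wasserstein_rate G c r.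
Proof.
move=> Gne; have E0 : 0 < #|edge_set G|%:R :> R by rewrite ltr0n card_gt0.
have n0 : 0 < #|G|%:R :> R.
  rewrite ltr0n; have /set0Pn[ed] := Gne.
  by case/imsetP => -[x y] _ _; apply/card_gt0P; exists x.
rewrite /wasserstein_rate addr_gt0 // ?divr_gt0 ?mulr_gt0 ?sqrtr_gt0 //.
by rewrite ltr_wpDl ?divr_ge0 ?sqrtr_ge0 ?(ltW E0) // divr_gt0 ?mulr_gt0 ?expR_gt0.
Qed.

Lemma kolmogorov_clt (R : realType) (D : nat) (K1 K2 : R) : 0 < K1 -> 0 < K2 ->
  exists c C : R, [/\ 0 < c, 0 < C &
  forall mue muv : probability (measurableTypeR R) R,
    (abs_moment mue 4 < +oo)%E -> (abs_moment muv 4 < +oo)%E ->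
    (abs_moment mue 2 <= K1%:E)%E -> (abs_moment muv 2 <= K1%:E)%E ->
    (K2%:E <= mean_abs_diff mue)%E ->
  forall G : sgraph, max_degree G = D -> edge_set G != finset.set0 ->
  forall (d : measure_display) (Omega : measurableType d) (P : probability Omega R)
    (w : edge G -> {RV P >-> R}) (nu : G -> {RV P >-> R}),
    disordered_weights mue muv w nu ->
  forall r : R, 1 <= r ->
    (kolmogorov_to_gaussian P (standardized P (random_free_energy w nu))
      <= (C * fourth_moment_factor mue muv * clt_rate G c r)%:E)%E].
Proof.
move=> K10 K20; have [c [C [c0 C0 clt]]] := smooth_clt D K10 K20.
have sC0 : 0 < Num.sqrt C by rewrite sqrtr_gt0.
exists (c / 2), (2 * Num.sqrt C); split; [by rewrite divr_gt0|by rewrite mulr_gt0|].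
move=> mue muv e4 v4 e2 v2 md G GD Gne d Omega P w nu dw r r1.
have [mF smooth] := clt mue muv e4 v4 e2 v2 md G GD Gne d Omega P w nu dw.
have mW : measurable_fun setT (standardized P (random_free_energy w nu)).
  by apply: measurable_funM; [apply: measurable_funB => //|]; exact: measurable_cst.
set M4 := fine (abs_moment mue 4) + fine (abs_moment muv 4) in smooth.
have M40 : 0 < 1 + M4.
  by rewrite ltr_wpDr // addr_ge0 // fine_ge0 // abs_moment_ge0.
set A := C * (1 + M4) `^ (3 / 4) * wasserstein_rate G c r.
have A0 : 0 < A by rewrite !mulr_gt0 ?powR_gt0 ?wasserstein_rate_gt0.
apply: (le_trans (kolmogorov_le_sqrt mW A0 (fun s e e0 e1 => smooth r s e r1 e0 e1))).
rewrite lee_fin -!mulrA ler_pM2l // /A -mulrA sqrtrM ?(ltW C0) // ler_pM2l //.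
rewrite sqrtrM ?powR_ge0 // (sqrt_powR (powR_ge0 _ _)) -powRrM.
have -> : 3 / 4 * (1 / 2) = 3 / 8 :> R by field.
rewrite /fourth_moment_factor -addrA -/M4 ler_pM2l ?powR_gt0 //.
exact: sqrt_wasserstein_rate.
Qed.

Theorem theorem1p1 (R : realType) :
  (forall (D : nat) (mue muv : probability (measurableTypeR R) R),
    (abs_moment mue 4 < +oo)%E ->
    (abs_moment muv 4 < +oo)%E ->
    ~ point_mass mue ->
    exists c C : R, [/\ 0 < c, 0 < C &
      forall (G : sgraph),
        max_degree G = D ->
        edge_set G != finset.set0 ->
      forall (d : measure_display) (Omega : measurableType d)
        (P : probability Omega R)
        (w : edge G -> {RV P >-> R}) (nu : G -> {RV P >-> R}),
        disordered_weights mue muv w nu ->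
      forall r : R, 1 <= r ->
        (kolmogorov_to_gaussian P (standardized P (random_free_energy w nu))
          <= (C * clt_rate G c r)%:E)%E])
  /\
  (forall (D : nat) (K1 K2 : R), 0 < K1 -> 0 < K2 ->
    exists c C1 : R, [/\ 0 < c, 0 < C1 &
      forall (mue muv : probability (measurableTypeR R) R),
        (abs_moment mue 4 < +oo)%E ->
        (abs_moment muv 4 < +oo)%E ->
        ~ point_mass mue ->
        (maxe (abs_moment mue 2) (abs_moment muv 2) <= K1%:E)%E ->
        (K2%:E <= mean_abs_diff mue)%E ->
      forall (G : sgraph),
        max_degree G = D ->
        edge_set G != finset.set0 ->
      forall (d : measure_display) (Omega : measurableType d)
        (P : probability Omega R)
        (w : edge G -> {RV P >-> R}) (nu : G -> {RV P >-> R}),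
        disordered_weights mue muv w nu ->
      forall r : R, 1 <= r ->
        (kolmogorov_to_gaussian P (standardized P (random_free_energy w nu))
          <= (C1 * fourth_moment_factor mue muv * clt_rate G c r)%:E)%E]).

Proof.
have fmf_gt0 (mue muv : probability (measurableTypeR R) R) : 0 < fourth_moment_factor mue muv.
  by rewrite powR_gt0 // -addrA ltr_wpDr // addr_ge0 // fine_ge0 // abs_moment_ge0.
split=> [D mue muv e4 v4 npm|D K1 K2 K10 K20].
  have [K2 K20 md] := mean_abs_diff_gt0 npm.
  have ge0 mu : 0 <= fine (abs_moment (R := R) mu 4) by rewrite fine_ge0 // abs_moment_ge0.
  pose K1 : R := 1 + fine (abs_moment mue 4) + fine (abs_moment muv 4).
  have K10 : 0 < K1 by rewrite /K1 -addrA ltr_wpDr // addr_ge0.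
  have m2 mu : (abs_moment mu 4 < +oo)%E -> fine (abs_moment mu 4) <= K1 - 1 ->
      (abs_moment mu 2 <= K1%:E)%E.
    move=> m4 le; apply: (le_trans (abs_moment2_le mu)).
    rewrite -[abs_moment mu 4]fineK ?ge0_fin_numE ?abs_moment_ge0 //.
    by rewrite -EFinD lee_fin -lerBrDl.
  have K1E : K1 - 1 = fine (abs_moment mue 4) + fine (abs_moment muv 4).
    by rewrite /K1 -[1 + _ + _]addrA [LHS]addrC addKr.
  have [c [C [c0 C0 clt]]] := kolmogorov_clt D K10 K20.
  exists c, (C * fourth_moment_factor mue muv); split=> //; first by rewrite mulr_gt0.
  move=> G GD Gne d Omega P w nu dw r r1.
  by apply: (clt mue muv) => //; apply: m2 => //; rewrite K1E ?lerDl ?lerDr.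
have [c [C1 [c0 C10 clt]]] := kolmogorov_clt D K10 K20.
exists c, C1; split=> // mue muv e4 v4 _; rewrite ge_max => /andP[e2 v2] md.
by move=> G GD Gne d Omega P w nu dw r r1; apply: (clt mue muv).
Qed.
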